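(* Consider the following algorithm Test-Identity, given sample access to densities $p,q:[0,1]\to\mathbb{R}_+$, an integer $k$, and $\epsilon>0$, where $C$ is a sufficiently large absolute constant: (1) let $m=Ck^{4/5}/\epsilon^{6/5}$ and draw $\mathrm{Poi}(m)$ independent samples from $p$ and, independently, $\mathrm{Poi}(m)$ independent samples from $q$; (2) let $S$ be the union of these samples sorted increasingly (ties broken randomly), each labelled by its source distribution; (3) let $Z$ be the number of pairs of successive samples of $S$ with the same label minus the number with different labels; (4) if $Z>5\sqrt{m}$ return ``NO''; (5) repeat the following $O(C)$ times: (a) draw $\mathrm{Poi}(m)$ samples from $(p+q)/2$; (b) split $[0,1]$ into intervals whose endpoints are these sample points, and let $p',q'$ be the reduced distributions of $p,q$ with respect to these intervals; (c) run the tester $\mathcal{T}$ described below on $p',q'$ with failure probability $1/C^2$ to decide whether $p'=q'$ or $\|p'-q'\|_{\mathcal{A}_{2k+1}}>\epsilon/C$, and if its output is ``NO'', output ``NO''; (6) output ``YES''. Here $\mathcal{T}$ is a tester which, for discrete distributions $p',q'$ on $[n']$ with $\|p'\|_2,\|q'\|_2=O(1/\sqrt{n'})$ and parameters $k',\epsilon',\delta$, draws $O((\sqrt{k'}/\epsilon'^2)\log(1/\delta))$ samples and with probability at least $1-\delta$ distinguishes $p'=q'$ from $\|p'-q'\|_{\mathcal{A}_{k'}}>\epsilon'$ (samples of $p',q'$ are simulated by samples of $p,q$). Then Test-Identity draws $O(\max\{k^{4/5}/\epsilon^{6/5},\,k^{1/2}/\epsilon^2\})$ samples from $p,q$ and with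 probability at least $2/3$ returns ``YES'' if $p=q$ and ``NO'' if $\|p-q\|_{\mathcal{A}_k}>\epsilon$.
   Context: For a density $p$ and an interval $J$, $p(J)=\int_J p$. For a partition $\mathcal{I}=(I_i)_{i=1}^\ell$ of the domain into disjoint intervals, the reduced distribution of $p$ with respect to $\mathcal{I}$ is the discrete distribution on $[\ell]$ assigning mass $p(I_i)$ to $i$. For a positive integer $k$, $\|p-q\|_{\mathcal{A}_k}=\max\sum_{i=1}^k|p(I_i)-q(I_i)|$ over all partitions of the domain into $k$ disjoint intervals. $\mathrm{Poi}(m)$ denotes a Poisson random variable with mean $m$; $\|\cdot\|_2$ is the Euclidean norm of a probability vector. *)

(* Defs.v *)
From HB Require Import structures.
From mathcomp Require Import all_boot all_order all_algebra perm.
From mathcomp Require Import all_classical all_reals all_analysis.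
Set Implicit Arguments.
Unset Strict Implicit.
Unset Printing Implicit Defensive.
Import Order.TTheory GRing.Theory Num.Theory.
Import numFieldNormedType.Exports.
Local Open Scope classical_set_scope.
Local Open Scope ring_scope.

(* A partition of D into (at most) k disjoint intervals: empty intervals are
   allowed, so that a partition of [n] into k > n intervals exists. *)
Definition interval_partition d (T : orderType d) (D : set T) (k : nat)
    (I : 'I_k -> interval T) : Prop :=
  trivIset [set: 'I_k] (fun i => [set` I i]) /\
  \bigcup_(i in [set: 'I_k]) [set` I i] = D.

(* ||P - Q||_{A_k}, for P and Q giving the mass of each interval of D. *)
Definition Ak_dist (R : realType) d (T : orderType d) (D : set T)
    (P Q : interval T -> R) (k : nat) : R :=
  sup [set \sum_(i < k) `|P (I i) - Q (I i)|
      | I in [set I : 'I_k -> interval T | interval_partition D I]].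

Definition density (R : realType) (p : R -> R) : Prop :=
  [/\ measurable_fun (`[0, 1] : set R) p,
      {in `[0, 1], forall x : R, 0 <= p x} &
      (\int[lebesgue_measure]_(x in `[0%R, 1%R]) (p x)%:E = 1)%E].

Definition mass (R : realType) (p : R -> R) (I : interval R) : R :=
  \int[lebesgue_measure]_(x in [set` I]) p x.

Definition Ak_dens (R : realType) (p q : R -> R) (k : nat) : R :=
  Ak_dist (`[0, 1] : set R) (mass p) (mass q) k.

Definition distr (R : realType) (n : nat) (p : 'I_n -> R) : Prop :=
  (forall i, 0 <= p i) /\ \sum_i p i = 1.

Definition Ak_distr (R : realType) (n : nat) (p q : 'I_n -> R) (k : nat) : R :=
  Ak_dist [set: 'I_n] (fun I => \sum_(i | i \in I) p i)
    (fun I => \sum_(i | i \in I) q i) k.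

Definition norm2 (R : realType) (n : nat) (p : 'I_n -> R) : R :=
  Num.sqrt (\sum_i p i ^+ 2).

(* A random element of A is represented by its expectation functional, which
   maps f >= 0 to the expected value of f; rbind draws x from u and then, with
   fresh randomness, an element from g x. All the functionals below only
   integrate nonnegative measurable functions, so rbind is the usual (iterated)
   integration. *)
Definition rand (R : realType) (A : Type) : Type := (A -> \bar R) -> \bar R.

Definition rret (R : realType) (A : Type) (a : A) : rand R A := fun f => f a.

Definition rbind (R : realType) (A B : Type) (u : rand R A)
  (g : A -> rand R B) : rand R B := fun f => u (fun x => g x f).

Notation "x <~ u ;; v" := (rbind u (fun x => v))
  (at level 100, u at next level, right associativity).

Definition Pr (R : realType) (A : Type) (u : rand R A) (E : pred A) : \bar R :=
  u (fun x => (E x)%:R%:E).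

Definition finite_law (R : realType) (A : finType) (pr : A -> R) : rand R A :=
  fun f => (\sum_(a : A) (pr a)%:E * f a)%E.

Definition coin (R : realType) (a : R) : rand R bool :=
  finite_law (bernoulli_pmf a).

Definition poi (R : realType) (m : R) : rand R nat :=
  fun f => (\sum_(0 <= n <oo) (poisson_pmf m n)%:E * f n)%E.

Definition draw (R : realType) (p : R -> R) : rand R R :=
  fun f => (\int[lebesgue_measure]_(x in `[0%R, 1%R]) ((p x)%:E * f x))%E.

Fixpoint iid (R : realType) (A : Type) (n : nat) (u : rand R A) :
    rand R (seq A) :=
  if n is n'.+1 then x <~ u ;; s <~ iid n' u ;; rret (x :: s)
  else rret [::].

Definition poi_iid (R : realType) (A : Type) (m : R) (u : rand R A) :
    rand R (seq A) :=
  n <~ poi m ;; iid n u.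

(* If p and q are the laws of u and v, this draws from (p + q) / 2. *)
Definition mixture (R : realType) (A : Type) (u v : rand R A) : rand R A :=
  b <~ coin 2^-1 ;; if b then u else v.

Definition shuffle (R : realType) (A : Type) (s : seq A) : rand R (seq A) :=
  pi <~ finite_law (fun _ : 'S_(size s) => (size s)`!%:R^-1) ;;
  rret [seq tnth (in_tuple s) (pi i) | i <- enum 'I_(size s)].

(* The union of the samples, sorted. Since the library's sort is stable,
   shuffling first amounts to breaking the ties at random. *)
Definition merge_samples (R : realType) (X Y : seq R) :
    rand R (seq (R * bool)) :=
  s <~ shuffle ([seq (x, true) | x <- X] ++ [seq (y, false) | y <- Y]) ;;
  rret (sort (fun a b : R * bool => a.1 <= b.1) s).

Definition Zstat (R : realType) (S : seq (R * bool)) : int :=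
  \sum_(ab <- zip S (behead S)) (if ab.1.2 == ab.2.2 then 1 else -1).

(* For W = {w_1 <= ... <= w_N}, the index of the interval containing x among
   [0, w_1[, [w_1, w_2[, ..., [w_N, 1]. *)
Definition bucket (R : realType) (W : seq R) (x : R) : 'I_(size W).+1 :=
  inord (count (fun w => w <= x) W).

(* If p is the law of u, this is its reduced distribution with respect to the
   intervals with endpoints in W, sampled through one sample of u. *)
Definition reduced (R : realType) (W : seq R) (u : rand R R) :
    rand R 'I_(size W).+1 :=
  x <~ u ;; rret (bucket W x).
Arguments reduced {R} W u _.

(* A randomized tester for pairs of distributions on [n]. The arguments of the
   fields are n, k, eps, delta. It draws nsamples samples from each of the two
   distributions and answers YES (true) with probability accept, in which its
   internal randomness has been averaged out. *)
Record tester (R : realType) := Tester {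
  nsamples : nat -> nat -> R -> R -> nat ;
  accept : forall n : nat, nat -> R -> R -> seq 'I_n -> seq 'I_n -> R ;
  accept01 : forall n k eps delta (x y : seq 'I_n),
    0 <= accept k eps delta x y <= 1 }.

Definition run_tester (R : realType) (T : tester R) (n k : nat)
    (eps delta : R) (u v : rand R 'I_n) : rand R bool :=
  x <~ iid (nsamples T n k eps delta) u ;;
  y <~ iid (nsamples T n k eps delta) v ;;
  coin (accept T k eps delta x y).

(* B is the constant in the hypothesis ||p||_2, ||q||_2 = O(1/sqrt n) and D the
   one in the number of samples O(sqrt k / eps^2 * log(1/delta)). *)
Definition tester_spec (R : realType) (B D : R) (T : tester R) : Prop :=
  forall (n k : nat) (eps delta : R),
    (0 < k)%N -> 0 < eps -> 0 < delta < 1 ->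
    (nsamples T n k eps delta)%:R
      <= D * (Num.sqrt k%:R / eps ^+ 2 * ln (delta^-1)) /\
    forall p q : 'I_n -> R, distr p -> distr q ->
      norm2 p <= B / Num.sqrt n%:R -> norm2 q <= B / Num.sqrt n%:R ->
      let out := run_tester T k eps delta (finite_law p) (finite_law q) in
      (p =1 q -> ((1 - delta)%:E <= Pr out id)%E) /\
      (eps < Ak_distr p q k -> ((1 - delta)%:E <= Pr out negb)%E).

(* Step (5) with r repetitions, where u and v are the sample accesses to p and
   q and N is the number of samples drawn so far. The result is the answer
   (true for YES) and the total number of samples drawn. *)
Fixpoint test_rounds (R : realType) (T : tester R) (C : R) (k : nat)
    (eps m : R) (u v : rand R R) (r N : nat) : rand R (bool * nat) :=
  if r is r'.+1 then
    let k' := (2 * k + 1)%N in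
    let eps' := eps / C in
    let delta := (C ^+ 2)^-1 in
    W <~ poi_iid m (mixture u v) ;;
    b <~ run_tester T k' eps' delta (reduced W u) (reduced W v) ;;
    let N' := (N + size W + 2 * nsamples T (size W).+1 k' eps' delta)%N in
    if b then test_rounds T C k eps m u v r' N' else rret (false, N')
  else rret (true, N).

Definition test_identity (R : realType) (T : tester R) (C : R) (r k : nat)
    (eps : R) (u v : rand R R) : rand R (bool * nat) :=
  let m := C * k%:R `^ (4 / 5) / eps `^ (6 / 5) in
  X <~ poi_iid m u ;;
  Y <~ poi_iid m v ;;
  S <~ merge_samples X Y ;;
  let N := (size X + size Y)%N in
  if 5 * Num.sqrt m < (Zstat S)%:~R then rret (false, N)
  else test_rounds T C k eps m u v r N.

(* Main.v *)
(** The grid is chosen so fine that, with probability close to 1, the Poisson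
    samples fall into distinct cells; the cells are then independent, and both
    [Zstat] and the random partition of step (5) are read off the cells from
    left to right, with means given by backward linear recurrences.  The mean of
    [Zstat] is, up to a small error, a weighted energy [sum mu_i B_i^2], where
    [B i] measures how the label of the last sample before cell [i] influences
    the labels seen later.  If this mean is at least [25 sqrt m], Chebyshev's
    inequality makes step (4) answer NO.  Otherwise the energy is small, so the
    random partition loses at most half of the discrepancy of [p] and [q] on the
    intervals of an optimal partition, and by Chebyshev's inequality again the
    reduced distributions are far apart in [A_(2k+1)].  Markov's inequality for
    the sum of the squared interval masses gives the norm hypothesis of the
    tester.  As the events are not proved measurable, probabilities are bounded
    below by simple functions only; this is enough since the integral of a
    nonnegative function is a lower integral. *)
Require Import Defs.
From HB Require Import structures.
From mathcomp Require Import all_boot all_order all_algebra perm.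
From mathcomp Require Import all_classical all_reals all_analysis.
From mathcomp Require Import measurable_realfun ring lra.
Import Order.TTheory GRing.Theory Num.Theory.
Import numFieldNormedType.Exports.
Local Open Scope classical_set_scope.
Local Open Scope ring_scope.
Set Implicit Arguments.
Unset Strict Implicit.
Unset Printing Implicit Defensive.

(** The exponents 4/5 and 6/5 have a single origin. If step (4) is likely to stay silent, the energy
    [sum mu_i G_i^2] is at most a multiple of [sqrt m / m^3]. The step of [H] at cell [i] is
    [O(mu_i)], so increments of [H^3] are bounded by the energy, and the [k] jumps of [H] over the
    pieces sum to at most [k * eta] plus a multiple of [sqrt m / (m^3 * eta^2)]. With [eta] of order
    [eps / k] this is below [eps / 2] as soon as [m^3 * eps^3] exceeds a multiple of [k^2 * sqrt m],
    that is, [m^5 * eps^6] a multiple of [k^4]. The grid belongs to the analysis only. Dropping the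
    outcomes with two samples in one cell costs little for a fine mesh and replaces the sampling
    process by a product of finite laws, so that all estimates on means and variances are algebra
    with finite sums. The two answers are not symmetric: YES has to survive every round, which is
    why the norm constant [B] must grow with [c * C], whereas a NO in the first round is enough. *)

(** * Expectations for finite product laws *)

Section ProductExpectation.
Variables (R : realFieldType) (A : finType).
Implicit Types (w : nat -> A -> R) (f g : seq A -> R).

(* Expectation of [f [:: a_i; a_(i+1); ...; a_(i+n-1)]] for independent [a_j]
   with weights [w j]. *)
Fixpoint pexp w (i n : nat) f : R :=
  if n is n'.+1 then \sum_a w i a * pexp w i.+1 n' (fun t => f (a :: t))
  else f [::].

Lemma eq_pexp w i n f g :
  (forall t, size t = n -> f t = g t) -> pexp w i n f = pexp w i n g.
Proof.
elim: n i f g => [|n IH] i f g fg /=; first exact: fg.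
by apply: eq_bigr => a _; congr (_ * _); apply: IH => t tn; rewrite fg//= tn.
Qed.

Lemma pexpD w i n f g :
  pexp w i n (fun t => f t + g t) = pexp w i n f + pexp w i n g.
Proof.
elim: n i f g => [|n IH] i f g //=.
by rewrite -big_split /=; apply: eq_bigr => a _; rewrite IH mulrDr.
Qed.

Lemma pexpZ w i n k f : pexp w i n (fun t => k * f t) = k * pexp w i n f.
Proof.
elim: n i f => [|n IH] i f //=.
by rewrite mulr_sumr; apply: eq_bigr => a _; rewrite IH mulrCA.
Qed.

Lemma pexp_ge0 w i n f : (forall i a, 0 <= w i a) ->
  (forall t, size t = n -> 0 <= f t) -> 0 <= pexp w i n f.
Proof.
move=> w0; elim: n i f => [|n IH] i f f0 /=; first exact: f0.
by apply: sumr_ge0 => a _; apply: mulr_ge0 => //; apply: IH => t tn;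
  apply: f0; rewrite /= tn.
Qed.

Lemma ler_pexp w i n f g : (forall i a, 0 <= w i a) ->
  (forall t, size t = n -> f t <= g t) -> pexp w i n f <= pexp w i n g.
Proof.
move=> w0 fg; rewrite -subr_ge0.
have -> : pexp w i n g - pexp w i n f = pexp w i n (fun t => g t + (-1) * f t).
  by rewrite pexpD pexpZ mulN1r.
by apply: pexp_ge0 => // t tn; rewrite mulN1r subr_ge0 fg.
Qed.

Definition law_family w := forall i, (forall a, 0 <= w i a) /\ \sum_a w i a = 1.

Lemma pexp_cst w i n k : law_family w -> pexp w i n (fun=> k) = k.
Proof.
move=> wP; elim: n i => [|n IH] i //=.
by under eq_bigr do rewrite IH; rewrite -mulr_suml (wP i).2 mul1r.
Qed.

(** Sums over sample sets come with unnormalised weights; factoring out the total of each cell turns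
    them into expectations for probability laws. *)
Lemma pexp_scale w (v : nat -> R) i n f :
  pexp (fun j a => v j * w j a) i n f
    = (\prod_(i <= j < i + n) v j) * pexp w i n f.
Proof.
elim: n i f => [|n IH] i f /=; first by rewrite addn0 big_geq// mul1r.
rewrite big_ltn ?addnS ?ltnS ?leq_addr// -addSn mulr_sumr.
by apply: eq_bigr => a _; rewrite IH; ring.
Qed.

(** With a squared deviation for [f] this becomes Chebyshev's inequality. *)
Lemma pexp_markov w i n f (k : R) : law_family w -> 0 < k ->
  (forall t, size t = n -> 0 <= f t) ->
  1 - pexp w i n f / k <= pexp w i n (fun t => (f t < k)%R%:R).
Proof.
move=> wP k0 f0.
have -> : 1 - pexp w i n f / k = pexp w i n (fun t => 1 + (- k^-1) * f t).
  by rewrite pexpD pexpZ pexp_cst// mulNr mulrC.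
apply: ler_pexp => [j a|t tn]; first exact: (wP j).1.
rewrite mulNr; case: ltP => [_|kf] /=.
  by rewrite gerDl oppr_le0 mulr_ge0 ?f0// invr_ge0 ltW.
by rewrite subr_le0 mulrC ler_pdivlMr// mul1r.
Qed.

Lemma pexp_sqrD w i n f (k : R) : law_family w -> pexp w i n f = 0 ->
  pexp w i n (fun t => (f t + k) ^+ 2) = pexp w i n (fun t => f t ^+ 2) + k ^+ 2.
Proof.
move=> wP f0; rewrite (eq_pexp _ _ (g := fun t => f t ^+ 2 + (2 * k * f t + k ^+ 2))).
  by rewrite !pexpD pexpZ f0 mulr0 add0r pexp_cst.
by move=> t _; ring.
Qed.

End ProductExpectation.

Lemma sum_option_bool (R : nmodType) (F : option bool -> R) :
  \sum_a F a = F None + F (Some true) + F (Some false).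
Proof.
rewrite (bigD1 None)//= (bigD1 (Some true))//= (big_pred1 (Some false)) ?addrA//.
by case=> [[]|].
Qed.

(** Union bound for the complements, through the pointwise inequality [P + Q - 1 <= S] between
    indicators. *)
Lemma pexp2_mono (R : realFieldType) (A : finType) (w : nat -> A -> R) i n
    (P Q S : pred (seq A)) : law_family w ->
  (forall t, size t = n -> P t -> Q t -> S t) ->
  pexp w i n (fun t => (P t)%:R) + pexp w i n (fun t => (Q t)%:R) - 1
    <= pexp w i n (fun t => (S t)%:R).
Proof.
move=> wP PQS.
rewrite -[X in _ - X](pexp_cst i n 1 wP) -mulN1r -pexpZ -!pexpD.
apply: ler_pexp => [j a|t tn]; first exact: (wP j).1.
have := PQS t tn; case: (P t) (Q t) => -[] /= h; case: (S t) h => //= h;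
  first [by have := h isT isT | lra].
Qed.

(** * Mean and variance of the label statistic *)

Section LabelStatistic.
Variables (R : realFieldType).
Implicit Types (L : R) (t : seq (option bool)).

Definition sg (b : bool) : R := if b then 1 else -1.

(* [Zstat] read cell by cell: [None] is an empty cell, [Some b] one containing a
   single sample with label [b], and [L] is the sign of the last label read. *)
Fixpoint Zrun L t : R :=
  match t with
  | [::] => 0
  | None :: t' => Zrun L t'
  | Some b :: t' => L * sg b + Zrun (sg b) t'
  end.

Variables (al be : nat -> R).
Hypotheses (al0 : forall i, 0 <= al i) (be0 : forall i, 0 <= be i).
Let x i := al i + be i.
Let y i := al i - be i.

(* Poisson counts with means [al i] and [be i], conditioned on a total of at
   most 1. *)
Definition zlaw (i : nat) (o : option bool) : R :=
  (1 + (al i + be i))^-1 * match o with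
  | None => 1 | Some true => al i | Some false => be i end.

Let x0 i : 0 <= x i. Proof. exact: addr_ge0. Qed.
Let x1 i : 0 < 1 + x i. Proof. by rewrite ltr_wpDr. Qed.

Lemma zlaw_law : law_family zlaw.
Proof.
move=> i; split=> [a|].
  apply: mulr_ge0; first by rewrite invr_ge0 ltW// x1.
  by case: a => [[]|].
rewrite sum_option_bool /zlaw -!mulrDr -addrA mulVf// gt_eqF//; exact: x1.
Qed.

Variables (M : nat) (A B : nat -> R).
Hypotheses (AM : A M = 0) (BM : B M = 0).
Hypothesis Brec : forall i, (i < M)%N -> B i = (y i + B i.+1) / (1 + x i).
Hypothesis Arec : forall i, (i < M)%N -> A i = A i.+1 + y i * B i.+1 / (1 + x i).

(** The mean is affine in the incoming sign: an empty cell passes [L] on, a sample contributes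
    [L * sg b] and resets the sign. Comparing coefficients after conditioning on cell [i] yields
    [Brec] and [Arec]. *)
Lemma Zrun_mean L n i : (i + n)%N = M ->
  pexp zlaw i n (Zrun L) = A i + B i * L.
Proof.
elim: n i L => [|n IH] i L /=; first by rewrite addn0 => ->; rewrite AM BM mul0r addr0.
move=> inM; have iM : (i < M)%N by rewrite -inM addnS ltnS leq_addr.
have inM' : (i.+1 + n)%N = M by rewrite addSnnS.
rewrite sum_option_bool IH// !pexpD !IH//.
rewrite !pexp_cst; try exact: zlaw_law.
rewrite (Brec iM) (Arec iM) /zlaw /sg /y -/(x i).
have := x1 i; rewrite /x => h; field.
by rewrite gt_eqF.
Qed.

Lemma B_le1 i : (i <= M)%N -> `|B i| <= 1.
Proof.
move=> iM; move: {2}(M - i)%N (erefl (M - i)%N) => n.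
elim: n i iM => [|n IH] i iM E.
  have -> : i = M by apply/eqP; rewrite eqn_leq iM -subn_eq0 E.
  by rewrite BM normr0.
have iM' : (i < M)%N by rewrite -subn_gt0 E.
rewrite Brec// normrM normfV (gtr0_norm (x1 i)) ler_pdivrMr// mul1r.
apply: le_trans (ler_normD _ _) _; rewrite [leRHS]addrC; apply: lerD.
  rewrite /y /x ler_norml; have := al0 i; have := be0 i; lra.
by apply: IH; rewrite // subnS E.
Qed.

(** A martingale argument: the variance is the sum of the one-step conditional variances. Here [kap]
    bounds the squared change of the conditional mean caused by a sample, and a sample occurs with
    probability at most [x j]. The sign ranges over [[-1, 1]] because the run starts with 0. *)
Lemma Zrun_var (kap L : R) n i : (i + n)%N = M ->
  (forall j L0, -1 <= L0 <= 1 -> (j < M)%N ->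
    (L0 + B j.+1 * (1 - L0)) ^+ 2 <= kap /\ (L0 + B j.+1 * (1 + L0)) ^+ 2 <= kap) ->
  -1 <= L <= 1 ->
  pexp zlaw i n (fun t => (Zrun L t - (A i + B i * L)) ^+ 2)
    <= kap * \sum_(i <= j < M) x j.
Proof.
move=> + Bk; elim: n i L => [|n IH] i L /=.
  by rewrite addn0 => -> _; rewrite AM BM mul0r addr0 subr0 expr0n big_geq// mulr0.
move=> inM L1; have iM : (i < M)%N by rewrite -inM addnS ltnS leq_addr.
have inM' : (i.+1 + n)%N = M by rewrite addSnnS.
have step (L' k : R) :
    pexp zlaw i.+1 n (fun t => (k + Zrun L' t - (A i + B i * L)) ^+ 2) =
    pexp zlaw i.+1 n (fun t => (Zrun L' t - (A i.+1 + B i.+1 * L')) ^+ 2)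
      + (k + (A i.+1 + B i.+1 * L') - (A i + B i * L)) ^+ 2.
  rewrite -pexp_sqrD; first by apply: eq_pexp => t _; ring.
    exact: zlaw_law.
  by rewrite (pexpD _ _ _ (Zrun L') (fun=> - (A i.+1 + B i.+1 * L'))) pexp_cst ?Zrun_mean ?subrr//; exact: zlaw_law.
rewrite sum_option_bool.
rewrite (eq_pexp _ _ (g := fun t => (0 + Zrun L t - (A i + B i * L)) ^+ 2)); last first.
  by move=> t _; rewrite add0r.
rewrite !step.
have H0 := IH i.+1 L inM' L1.
have H1 := IH i.+1 1 inM'; have H2 := IH i.+1 (-1) inM'.
rewrite /sg in H1 H2 *.
have {}H1 := H1 ltac:(lra); have {}H2 := H2 ltac:(lra).
have [k1 k2] := Bk i L L1 iM.
rewrite [in leRHS]big_ltn//.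
set S := \sum_(i.+1 <= j < M) x j in H0 H1 H2 *.
set P0 := pexp _ _ _ _ in H0 *.
set P1 := pexp _ _ _ _ in H1 *.
set P2 := pexp _ _ _ _ in H2 *.
have [q0 [q1 q2]] : 0 <= zlaw i None /\ (0 <= zlaw i (Some true) /\
  0 <= zlaw i (Some false)) by have [h _] := zlaw_law i; split; [|split]; apply: h.
have qs : zlaw i None + zlaw i (Some true) + zlaw i (Some false) = 1.
  by rewrite -sum_option_bool; case: (zlaw_law i).
(* Tower property: the conditional mean moves by 0 on average. *)
have mean0 : zlaw i None * (0 + (A i.+1 + B i.+1 * L) - (A i + B i * L)) +
   zlaw i (Some true) * (L * 1 + (A i.+1 + B i.+1 * 1) - (A i + B i * L)) +
   zlaw i (Some false) * (L * -1 + (A i.+1 + B i.+1 * -1) - (A i + B i * L)) = 0.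
  rewrite (Brec iM) (Arec iM) /zlaw /y -/(x i); have := x1 i; rewrite /x => h; field.
  by rewrite gt_eqF.
have q12 : zlaw i (Some true) + zlaw i (Some false) <= x i.
  rewrite /zlaw -mulrDr -/(x i) mulrC ler_pdivrMr// ler_peMr// lerDl; exact: x0.
move: mean0 q0 q1 q2 qs q12.
set u0 := zlaw i None; set u1 := zlaw i (Some true); set u2 := zlaw i (Some false).
set k0 := 0 + _ - _; set c1 := L * 1 + _ - _; set c2 := L * -1 + _ - _.
move=> mean0 q0 q1 q2 qs q12.
have e1 : c1 - k0 = L + B i.+1 * (1 - L) by rewrite /c1 /k0; ring.
have e2 : c2 - k0 = - (L + B i.+1 * (1 + L)) by rewrite /c2 /k0; ring.
have g1 : (c1 - k0) ^+ 2 <= kap by rewrite e1.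
have g2 : (c2 - k0) ^+ 2 <= kap by rewrite e2 sqrrN.
(* The variance is at most the second moment about [k0], the value for an empty cell, to which only
   the two nonempty cases contribute. *)
have var : u0 * k0 ^+ 2 + u1 * c1 ^+ 2 + u2 * c2 ^+ 2 <= kap * x i.
  have -> : u0 * k0 ^+ 2 + u1 * c1 ^+ 2 + u2 * c2 ^+ 2 =
     u1 * (c1 - k0) ^+ 2 + u2 * (c2 - k0) ^+ 2
     + 2 * k0 * (u0 * k0 + u1 * c1 + u2 * c2) - k0 ^+ 2 * (u0 + u1 + u2) by ring.
  rewrite mean0 qs mulr0 addr0 mulr1.
  have kap0 : 0 <= kap by apply: le_trans g1; apply: sqr_ge0.
  have h1 := ler_wpM2l q1 g1; have h2 := ler_wpM2l q2 g2.
  have h3 := ler_wpM2l kap0 q12; have h4 := sqr_ge0 k0; lra.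
have h0 := ler_wpM2l q0 H0; have h1 := ler_wpM2l q1 H1; have h2 := ler_wpM2l q2 H2.
have : u0 * (kap * S) + u1 * (kap * S) + u2 * (kap * S) = kap * S.
  by rewrite -!mulrDl qs mul1r.
lra.
Qed.

Lemma Zrun_var9 L n i : (i + n)%N = M -> -1 <= L <= 1 ->
  pexp zlaw i n (fun t => (Zrun L t - (A i + B i * L)) ^+ 2)
    <= 9 * \sum_(i <= j < M) x j.
Proof.
move=> inM L1; apply: Zrun_var => // j L0 L01 jM.
have := B_le1 jM; rewrite ler_norml => B1.
(* Since [|L0| <= 1], [|B j.+1| <= 1] and [1 - L0], [1 + L0] are at most 2, the two expressions stay
   within 3. *)
have sq (z : R) : -3 <= z <= 3 -> z ^+ 2 <= 9 by move=> h; nra.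
by split; apply: sq; nra.
Qed.

End LabelStatistic.

Lemma down_ind (M : nat) (P : nat -> Prop) : P M ->
  (forall i, (i < M)%N -> P i.+1 -> P i) -> forall i, (i <= M)%N -> P i.
Proof.
move=> PM Ps i iM; rewrite -(subKn iM); move: (leq_subr i M).
elim: (M - i)%N => [|n IH] nM; first by rewrite subn0.
have nM' : (M - n.+1 < M)%N by rewrite ltn_subrL /= (leq_ltn_trans _ nM).
by apply: Ps => //; rewrite -subSn// subSS; apply: IH; apply: ltnW.
Qed.

Lemma backward_rec (T : Type) (f : nat -> T -> T) (a : T) (M : nat) :
  exists B : nat -> T, B M = a /\ forall i, (i < M)%N -> B i = f i (B i.+1).
Proof.
(* The first argument counts the steps left to [M], which makes the recursion structural. *)
pose g := fix g n i := if n is n'.+1 then f i (g n' i.+1) else a.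
exists (fun i => g (M - i)%N i); split=> [|i iM]; first by rewrite subnn.
by rewrite -subSS subSn.
Qed.

(** * Energy estimates for the backward recurrences *)

Section Energy.
Variables (R : realFieldType) (M : nat).
Implicit Types (x y A B : nat -> R).

(* [A 0] is the mean of [Zstat], see [Zrun_mean]. *)
Lemma energy x y A B : A M = 0 -> B M = 0 ->
  (forall i, (i < M)%N -> B i = (y i + B i.+1) / (1 + x i)) ->
  (forall i, (i < M)%N -> A i = A i.+1 + y i * B i.+1 / (1 + x i)) ->
  (forall i, 0 <= x i <= 1) -> (forall i, `|y i| <= x i) ->
  (forall i, (i <= M)%N -> `|B i| <= 1) ->
  \sum_(0 <= i < M) x i * B i ^+ 2 / 4 - 4 * \sum_(0 <= i < M) x i ^+ 2 <= A 0%N.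
Proof.
move=> AM BM Brec Arec x01 yx B1.
(* The potential [A - B^2 / 2] makes the induction close: going back over cell [i] it gains at least
   [x_i B_i^2 / 4], up to an error [4 x_i^2]. *)
suff H i : (i <= M)%N ->
  \sum_(i <= j < M) x j * B j ^+ 2 / 4 - 4 * \sum_(i <= j < M) x j ^+ 2
    <= A i - B i ^+ 2 / 2.
  by apply: le_trans (H 0%N _) _ => //; rewrite gerBl divr_ge0 ?sqr_ge0.
move=> iM; elim/(@down_ind M) : i / iM => [|i iM].
  by rewrite !big_geq// AM BM; lra.
rewrite ![X in _ -> X - _ <= _]big_ltn// ![X in _ -> _ - 4 * X <= _]big_ltn//.
set S1 := \sum_(_ <= j < _) _; set S2 := \sum_(_ <= j < _) _ => IH.
have /andP[x0 x1] := x01 i; have := yx i; rewrite ler_norml => /andP[y1 y2].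
have := B1 i (ltnW iM); rewrite ler_norml => /andP[b1 b2].
have E : B i.+1 = (1 + x i) * B i - y i.
  by rewrite (Brec i iM); field; rewrite gt_eqF// ltr_wpDr.
rewrite (Arec i iM).
have -> : y i * B i.+1 / (1 + x i) = (B i - B i.+1 / (1 + x i)) * B i.+1.
  by rewrite (Brec i iM); field; rewrite gt_eqF// ltr_wpDr.
have hx : x i / 2 <= 1 - (1 + x i)^-1.
  have -> : 1 - (1 + x i)^-1 = x i / (1 + x i) by field; rewrite gt_eqF// ltr_wpDr.
  by rewrite ler_wpM2l// lef_pV2 ?posrE; lra.
move: IH hx; set v := (1 + x i)^-1; set b' := B i.+1 in E *; set b := B i in E b1 b2 *.
move: (x i) (y i) (A i.+1) E x0 x1 y1 y2 => X Y A' E X0 X1 Y1 Y2 IH hx.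
have dl : - (2 * X) <= b - b' <= 2 * X by rewrite E; apply/andP; split; nra.
have h1 := ler_wpM2r (sqr_ge0 b') hx.
have dd : (b - b') ^+ 2 <= 4 * X ^+ 2.
  by rewrite -subr_ge0 (_ : _ - _ = (2 * X - (b - b')) * (2 * X + (b - b')));
    [apply: mulr_ge0; lra | ring].
have h2 := ler_wpM2l X0 dd.
have h3 : 0 <= X ^+ 2 * (1 - X) by apply: mulr_ge0; [exact: sqr_ge0|lra].
have h4 : 0 <= X * (b - 2 * b') ^+ 2 by apply: mulr_ge0 => //; exact: sqr_ge0.
(* Polarisation: the product becomes squares, which the potential absorbs, and [(b - b')^2], which
   is of second order in [X]. *)
have e1 : b * b' = (b ^+ 2 + b' ^+ 2 - (b - b') ^+ 2) / 2 by field.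
have e2 : (b - b' * v) * b' = b * b' - v * b' ^+ 2 by ring.
rewrite e2 e1.
have h5 : X * b ^+ 2 / 4 <= X * b' ^+ 2 / 2 + X * (b - b') ^+ 2 / 2.
  rewrite -subr_ge0 (_ : _ - _ = X * (b - 2 * b') ^+ 2 / 4).
    by rewrite divr_ge0.
  by field.
have h6 : X * (b - b') ^+ 2 <= X * (4 * X ^+ 2) by [].
lra.
Qed.

Variables (m : R) (mu del G H : nat -> R).
Hypotheses (m0 : 0 < m) (mu0 : forall i, 0 <= mu i).
Hypothesis del_mu : forall i, `|del i| <= 2 * mu i.
Hypotheses (HM : H M = 0) (GM : G M = 0).
Hypothesis Hrec : forall i, (i < M)%N -> (1 + m * mu i) * H i = del i + H i.+1.
Hypothesis Grec : forall i, (i < M)%N -> (1 + 2 * m * mu i) * G i = del i + G i.+1.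

Let mmu0 i : 0 <= m * mu i. Proof. by rewrite mulr_ge0// ltW. Qed.

(* [G] is [B / m] for the [B] of [Zrun_mean], whereas [H] gives the mean loss of
   [Wrun] at the jumps of [s], see [Wrun_mean]. *)
Lemma sum_H_sqr_le_G :
  \sum_(0 <= i < M) mu i * H i ^+ 2 <= 4 * \sum_(0 <= i < M) mu i * G i ^+ 2.
Proof.
(* The difference solves the recurrence of [H] with source [m * mu * G] instead of [del], so its
   energy is at most that of [G]; then [H^2 <= 2 F^2 + 2 G^2] gives the factor 4. *)
pose F i := H i - G i.
have Frec i : (i < M)%N -> (1 + m * mu i) * F i = F i.+1 + m * mu i * G i.
  move=> iM; have := Hrec iM; have := Grec iM; rewrite /F; lra.
have FG : \sum_(0 <= i < M) mu i * F i ^+ 2 <= \sum_(0 <= i < M) mu i * G i ^+ 2.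
  suff K i : (i <= M)%N -> F i ^+ 2 + m * \sum_(i <= j < M) mu j * F j ^+ 2
      <= m * \sum_(i <= j < M) mu j * G j ^+ 2.
    rewrite -(ler_pM2l m0); apply: le_trans (K 0%N _) => //.
    by rewrite lerDr sqr_ge0.
  move=> iM; elim/(@down_ind M) : i / iM => [|i iM].
    by rewrite !big_geq// /F HM GM; lra.
  rewrite [X in _ -> _ + _ * X <= _]big_ltn// [X in _ -> _ <= _ * X]big_ltn//.
  set S1 := \sum_(_ <= j < _) _; set S2 := \sum_(_ <= j < _) _ => IH.
  suff : F i ^+ 2 + m * mu i * F i ^+ 2 <= F i.+1 ^+ 2 + m * mu i * G i ^+ 2.
    lra.
  have := Frec i iM; have := mmu0 i.
  move: (m * mu i) (F i) (F i.+1) (G i) => z f f' g z0 E.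
  rewrite -(ler_pM2l (_ : 0 < 1 + z)); last by rewrite ltr_wpDr.
  (* What remains is the Cauchy-Schwarz inequality with weights 1 and [z]. *)
  have -> : (1 + z) * (f ^+ 2 + z * f ^+ 2) = (f' + z * g) ^+ 2 by rewrite -E; ring.
rewrite -subr_ge0 (_ : _ - _ = z * (f' - g) ^+ 2); first exact: mulr_ge0 z0 (sqr_ge0 _).
  by ring.
have K : \sum_(0 <= i < M) mu i * H i ^+ 2 <= \sum_(0 <= i < M)
    (2 * (mu i * F i ^+ 2) + 2 * (mu i * G i ^+ 2)).
  apply: ler_sum => i _; rewrite /F.
  rewrite -subr_ge0 (_ : _ - _ = mu i * (H i - 2 * G i) ^+ 2).
    by rewrite mulr_ge0// sqr_ge0.
  by ring.
apply: le_trans K _; rewrite big_split/= -!mulr_sumr; lra.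
Qed.

(** The value [2 / m] is a fixed point: [(1 + m * mu i) * |H i|] is at most
    [2 * mu i + |H i.+1|]. *)
Lemma H_le i : (i <= M)%N -> `|H i| <= 2 / m.
Proof.
move=> iM; elim/(@down_ind M) : i / iM => [|i iM IH].
  by rewrite HM normr0 divr_ge0// ltW.
have p : 0 < 1 + m * mu i by rewrite ltr_wpDr.
rewrite -(ler_pM2l p).
have -> : (1 + m * mu i) * `|H i| = `|del i + H i.+1|.
  by rewrite -Hrec// normrM (gtr0_norm p).
apply: le_trans (ler_normD _ _) _.
rewrite mulrDl mul1r addrC; apply: lerD => //.
rewrite (_ : _ * (2 / m) = 2 * mu i) ?del_mu//.
by field; rewrite gt_eqF.
Qed.

Lemma H_step i : (i < M)%N -> `|H i.+1 - H i| <= 4 * mu i.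
Proof.
move=> iM; have -> : H i.+1 - H i = m * mu i * H i - del i.
  by have := Hrec iM; lra.
apply: le_trans (ler_normB _ _) _.
have h : `|m * mu i * H i| <= 2 * mu i.
  rewrite normrM ger0_norm//.
  apply: le_trans (ler_wpM2l (mmu0 i) (H_le (ltnW iM))) _.
  by rewrite mulrAC mulrCA mulrA mulfK ?gt_eqF.
have := del_mu i; lra.
Qed.

(** Cubes are telescoped because a step of size [O(mu)] changes [H^3] by [O(mu * H^2)], an energy
    term; [|a - b|^3 <= 4 |a^3 - b^3|] returns to the jump. The constants are [4 * 4 * 3/2 = 24]
    times the coefficients in [a^2 + b^2 <= 3 a^2 + 32 u^2]. *)
Lemma H_cube lo hi : (lo <= hi <= M)%N -> `|H hi - H lo| ^+ 3
   <= \sum_(lo <= i < hi) (72 * (mu i * H i ^+ 2) + 768 * mu i ^+ 3).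
Proof.
move=> /andP[lohi hiM].
have cub (a b : R) : `|a - b| ^+ 3 <= 4 * `|a ^+ 3 - b ^+ 3|.
  have -> : a ^+ 3 - b ^+ 3 = (a - b) * (a ^+ 2 + a * b + b ^+ 2) by ring.
  rewrite normrM mulrCA exprS ler_wpM2l// -normrX !ger0_norm ?sqr_ge0//.
    by have := sqr_ge0 (a + b); lra.
  by have := sqr_ge0 (a + b); have := sqr_ge0 (a - b); lra.
apply: le_trans (cub _ _) _.
rewrite -(telescope_sumr (fun i => H i ^+ 3) lohi).
apply: le_trans (ler_wpM2l _ (ler_norm_sum _ _ _)) _ => //.
rewrite mulr_sumr big_nat [leRHS]big_nat; apply: ler_sum => i /andP[_ ihi].
have iM := leq_trans ihi hiM; have := H_step iM; have := mu0 i.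
move: (H i) (H i.+1) (mu i) => a b u u0 ba.
have -> : b ^+ 3 - a ^+ 3 = (b - a) * (b ^+ 2 + a * b + a ^+ 2) by ring.
rewrite normrM.
have q : `|b ^+ 2 + a * b + a ^+ 2| <= 3 / 2 * (a ^+ 2 + b ^+ 2).
  by rewrite ger0_norm; have := sqr_ge0 (a - b); have := sqr_ge0 (a + b); lra.
apply: le_trans (ler_wpM2l _ (ler_pM _ _ ba q)) _ => //.
have ba2 : (b - a) ^+ 2 <= 16 * u ^+ 2.
  rewrite -real_normK ?num_real// (_ : 16 * u ^+ 2 = (4 * u) ^+ 2); last by ring.
  by rewrite ler_sqr ?nnegrE// mulr_ge0.
have b2 : b ^+ 2 <= 2 * a ^+ 2 + 32 * u ^+ 2.
  by have := sqr_ge0 (b - 2 * a); nra.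
have := ler_wpM2l u0 b2; nra.
Qed.

End Energy.

(** * Partitions of the cells into pieces and their step functions *)

Section Pieces.
Variables (R : realFieldType) (M k : nat) (lo hi : 'I_k -> nat).
Hypothesis lohi : forall j, (lo j <= hi j <= M)%N.

Definition in_piece j i : bool := (lo j <= i < hi j)%N.

Hypothesis partM : forall i, (i < M)%N -> (\sum_j in_piece j i)%N = 1%N.

Lemma sum_piece (f : nat -> R) j :
  \sum_(lo j <= i < hi j) f i = \sum_(0 <= i < M) (in_piece j i)%:R * f i.
Proof.
have /andP[h1 h2] := lohi j.
rewrite [RHS](big_cat_nat (n := lo j)) ?(leq_trans h1)//=.
rewrite [X in _ + X](big_cat_nat (n := hi j))//=.
have -> : \sum_(0 <= i < lo j) (in_piece j i)%:R * f i = 0.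
  rewrite big_nat big1// => i /andP[_ il].
  by rewrite /in_piece leqNgt il mul0r.
have -> : \sum_(hi j <= i < M) (in_piece j i)%:R * f i = 0.
  rewrite big_nat big1// => i /andP[il _].
  by rewrite /in_piece [(i < _)%N]ltnNge il andbF mul0r.
rewrite add0r addr0.
by apply: eq_big_nat => i ih; rewrite /in_piece ih mul1r.
Qed.

Lemma sum_pieces (f : nat -> R) :
  \sum_j \sum_(lo j <= i < hi j) f i = \sum_(0 <= i < M) f i.
Proof.
under eq_bigr do rewrite sum_piece.
rewrite exchange_big /= big_nat [RHS]big_nat; apply: eq_bigr => i /andP[_ iM].
by rewrite -mulr_suml -natr_sum partM// mul1r.
Qed.

(* A jump [d] is at most [eta + d ^+ 3 / eta ^+ 2]. *)
Lemma sum_jumps (m eta : R) (mu del H : nat -> R) :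
  0 < m -> 0 < eta -> (forall i, 0 <= mu i) -> (forall i, `|del i| <= 2 * mu i) ->
  H M = 0 -> (forall i, (i < M)%N -> (1 + m * mu i) * H i = del i + H i.+1) ->
  \sum_j `|H (hi j) - H (lo j)| <= k%:R * eta +
    (72 * \sum_(0 <= i < M) mu i * H i ^+ 2 + 768 * \sum_(0 <= i < M) mu i ^+ 3)
      / eta ^+ 2.
Proof.
move=> m0 eta0 mu0 del_mu HM Hrec.
have step j : `|H (hi j) - H (lo j)| <= eta +
    (\sum_(lo j <= i < hi j) (72 * (mu i * H i ^+ 2) + 768 * mu i ^+ 3)) / eta ^+ 2.
  set S := \sum_(_ <= i < _) _.
  have cS : `|H (hi j) - H (lo j)| ^+ 3 <= S by apply: (H_cube (m := m)) (lohi j).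
  have S0 : 0 <= S by apply: le_trans cS; rewrite exprn_ge0.
  move: cS; move: `|_| (normr_ge0 (H (hi j) - H (lo j))) => d d0 cS.
  have [de|ed] := leP d eta.
    by rewrite (le_trans de)// lerDl divr_ge0// exprn_ge0// ltW.
  rewrite ler_wpDl ?(ltW eta0)// ler_pdivlMr ?exprn_gt0//.
  have d0' := lt_trans eta0 ed.
  by apply: le_trans cS; rewrite exprS ler_wpM2l// ler_sqr ?nnegrE// ltW.
apply: le_trans (ler_sum _ (fun j _ => step j)) _.
rewrite big_split /= sumr_const card_ord mulr_natl lerD2l.
by rewrite -mulr_suml sum_pieces big_split /= -!mulr_sumr.
Qed.

Variables (sig : 'I_k -> R).
Hypothesis sig1 : forall j, `|sig j| <= 1.

Definition pval (i : nat) : R := \sum_j sig j * (in_piece j i)%:R.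

Lemma pval_in j i : in_piece j i -> (i < M)%N -> pval i = sig j.
Proof.
move=> ji iM; rewrite /pval (bigD1 j)//= ji mulr1 big1 ?addr0// => j' jj'.
have := partM iM; rewrite (bigD1 j)//= ji (bigD1 j')//= => /eqP.
by case: (in_piece j' i) => //; rewrite mulr0.
Qed.

Lemma pval_le1 i : `|pval i| <= 1.
Proof.
have [iM|Mi] := ltnP i M.
  have /existsP[j ji] : [exists j, in_piece j i].
    apply: contraT; rewrite negb_exists => /forallP h.
    by have := partM iM; rewrite big1// => j _; rewrite (negbTE (h j)).
  by rewrite (pval_in ji).
rewrite /pval big1 ?normr0 ?ler01// => j _.
have /andP[_ hM] := lohi j.
by rewrite /in_piece [(_ < hi j)%N]ltnNge (leq_trans hM) ?andbF ?mulr0.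
Qed.

Lemma pval_tv : `|pval 0| + \sum_(0 <= i < M) `|pval i.+1 - pval i| <= 2 * k%:R.
Proof.
pose f j i : R := (in_piece j i)%:R.
have h0 : `|pval 0| <= \sum_j `|f j 0%N|.
  apply: le_trans (ler_norm_sum _ _ _) _; apply: ler_sum => j _.
  by rewrite normrM ler_piMl.
have hs i : `|pval i.+1 - pval i| <= \sum_j `|f j i.+1 - f j i|.
  rewrite /pval -sumrB; apply: le_trans (ler_norm_sum _ _ _) _; apply: ler_sum => j _.
  by rewrite -mulrBr normrM ler_piMl.
apply: le_trans (lerD h0 (ler_sum _ (fun i _ => hs i))) _.
rewrite exchange_big -big_split /=.
rewrite (_ : 2 * k%:R = \sum_(j < k) (2 : R)); last first.
  by rewrite sumr_const card_ord mulr_natr.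
apply: ler_sum => j _; have /andP[h1 h2] := lohi j.
(* The indicator of a piece is a difference of two monotone step functions, each with variation at
   most 1. *)
pose g (a i : nat) : R := (a <= i)%N%:R.
have fE i : f j i = g (lo j) i - g (hi j) i.
  rewrite /f /in_piece /g [(_ < hi j)%N]ltnNge.
  case: (leqP (hi j) i) => hi' /=; last by rewrite andbT subr0.
  by rewrite (leq_trans h1)//= subrr.
have gm a i : g a i <= g a i.+1.
  by rewrite /g ler_nat; case: (leqP a i) => // ai; rewrite leqW.
have step i : `|f j i.+1 - f j i| <= (g (lo j) i.+1 - g (lo j) i) + (g (hi j) i.+1 - g (hi j) i).
  rewrite !fE ler_norml; have := gm (lo j) i; have := gm (hi j) i; lra.
apply: le_trans (lerD (lexx _) (ler_sum _ (fun i _ => step i))) _.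
rewrite big_split /= !telescope_sumr//.
have f0 : `|f j 0%N| <= g (lo j) 0%N.
  by rewrite /f /g /in_piece ger0_norm// ler_nat; case: (lo j <= 0)%N => //=; case: (0 < hi j)%N.
have gM a : g a M <= 1 by rewrite /g; case: (_ <= _)%N.
have g0 : 0 <= g (hi j) 0%N by rewrite /g.
have := gM (lo j); have := gM (hi j); lra.
Qed.

End Pieces.

(** * The discrepancy seen by a random partition *)

Section SignStatistic.
Variables (R : realFieldType) (M : nat) (m : R) (mu del s : nat -> R).
Hypotheses (m0 : 0 < m) (mu0 : forall i, 0 <= mu i).
Hypothesis del_mu : forall i, `|del i| <= 2 * mu i.
Hypothesis mmu1 : forall i, m * mu i <= 1.
Hypothesis s1 : forall i, `|s i| <= 1.

(* The bit of cell [i] tells whether the cell contains an endpoint of the random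
   partition; [Wrun] weights the discrepancy [del] of each cell by the value of
   [s] at the last endpoint. *)
Fixpoint Wrun (i : nat) (l : R) (t : bitseq) : R :=
  if t is b :: t' then
    let l' := if b then s i else l in del i * l' + Wrun i.+1 l' t'
  else 0.

(** A Poisson count with mean [m * mu i], conditioned on being at most 1. *)
Definition wlaw (i : nat) (b : bool) : R :=
  (1 + m * mu i)^-1 * (if b then m * mu i else 1).

Let mmu0 i : 0 <= m * mu i. Proof. by rewrite mulr_ge0// ltW. Qed.
Let mmu_gt0 i : 0 < 1 + m * mu i. Proof. by rewrite ltr_wpDr. Qed.

Lemma wlaw_law : law_family wlaw.
Proof.
move=> i; split=> [a|].
  by apply: mulr_ge0; [rewrite invr_ge0 ltW|case: a].
by rewrite big_bool /wlaw /= -mulrDr addrC [_ + 1]addrC mulVf ?gt_eqF//.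
Qed.

Variables (A H : nat -> R).
Hypotheses (AM : A M = 0) (HM : H M = 0).
Hypothesis Hrec : forall i, (i < M)%N -> (1 + m * mu i) * H i = del i + H i.+1.
Hypothesis Arec : forall i, (i < M)%N -> A i = A i.+1 + s i * (m * mu i * H i).

(** [H i] is the mean discrepancy collected from cell [i] up to the cell of the next endpoint, where
    the current sign [l] is given up. *)
Lemma Wrun_mean l n i : (i + n)%N = M -> pexp wlaw i n (Wrun i l) = A i + H i * l.
Proof.
elim: n i l => [|n IH] i l /=; first by rewrite addn0 => ->; rewrite AM HM mul0r addr0.
move=> inM; have iM : (i < M)%N by rewrite -inM addnS ltnS leq_addr.
have inM' : (i.+1 + n)%N = M by rewrite addSnnS.
rewrite big_bool !pexpD !IH// !pexp_cst; try exact: wlaw_law.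
have E : H i.+1 = (1 + m * mu i) * H i - del i by rewrite Hrec//; ring.
rewrite (Arec iM) E /wlaw /=; field; rewrite gt_eqF//; exact: mmu_gt0.
Qed.

(** One-step variances add up again. An endpoint in cell [i] costs a multiple of [|s i - l| / m^2],
    but it also erases the potential [|s i - l|], which grows only when [s] jumps. Hence the
    variation of [s] enters the bound, not the number of endpoints. *)
Lemma Wrun_var l n i : (i + n)%N = M -> `|l| <= 1 ->
  pexp wlaw i n (fun t => (Wrun i l t - (A i + H i * l)) ^+ 2)
    <= 16 / m ^+ 2 * (`|s i - l| + \sum_(i <= j < M) `|s j.+1 - s j|).
Proof.
elim: n i l => [|n IH] i l /=.
  rewrite addn0 => -> _; rewrite AM HM mul0r addr0 subr0 expr0n/=.
  rewrite mulr_ge0 ?divr_ge0 ?sqr_ge0 ?addr_ge0//.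
  by rewrite sumr_ge0.
move=> inM l1; have iM : (i < M)%N by rewrite -inM addnS ltnS leq_addr.
have inM' : (i.+1 + n)%N = M by rewrite addSnnS.
have step (l' k : R) :
    pexp wlaw i.+1 n (fun t => (k + Wrun i.+1 l' t - (A i + H i * l)) ^+ 2) =
    pexp wlaw i.+1 n (fun t => (Wrun i.+1 l' t - (A i.+1 + H i.+1 * l')) ^+ 2)
      + (k + (A i.+1 + H i.+1 * l') - (A i + H i * l)) ^+ 2.
  rewrite -pexp_sqrD; first by apply: eq_pexp => t _; ring.
    exact: wlaw_law.
  by rewrite (pexpD _ _ _ (Wrun i.+1 l') (fun=> - (A i.+1 + H i.+1 * l')))
    pexp_cst ?Wrun_mean ?subrr//; exact: wlaw_law.
rewrite big_bool /= !step.
have H0 := IH i.+1 l inM' l1.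
have H1 := IH i.+1 (s i) inM' (s1 i).
rewrite [in leRHS]big_ltn//.
set S := \sum_(i.+1 <= j < M) _ in H0 H1 *.
set P0 := pexp _ _ _ _ in H1 *.
set P1 := pexp _ _ _ _ in H0 *.
set kap := 16 / m ^+ 2 in H0 H1 *.
have kap0 : 0 <= kap by rewrite divr_ge0 ?sqr_ge0.
have q0 := (wlaw_law i).1 false; have q1 := (wlaw_law i).1 true.
have qs : wlaw i true + wlaw i false = 1.
  by rewrite -[RHS](wlaw_law i).2 big_bool.
have E : H i.+1 = (1 + m * mu i) * H i - del i by rewrite Hrec//; ring.
have Hi : `|H i| <= 2 / m by apply: (H_le (M := M) (del := del) (mu := mu)) => //; exact: ltnW.
have Hi2 : m ^+ 2 * H i ^+ 2 <= 4.
  rewrite -exprMn -real_normK ?num_real// (_ : 4 = 2 ^+ 2 :> R); last by ring.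
  rewrite ler_sqr ?nnegrE// normrM gtr0_norm//.
  by rewrite mulrC -ler_pdivlMr.
have sl : (s i - l) ^+ 2 <= 2 * `|s i - l|.
  rewrite -real_normK ?num_real// expr2 ler_wpM2r//.
  by apply: le_trans (ler_normB _ _) _; have := s1 i; lra.
have var : wlaw i true * (del i * s i + (A i.+1 + H i.+1 * s i) - (A i + H i * l)) ^+ 2
  + wlaw i false * (del i * l + (A i.+1 + H i.+1 * l) - (A i + H i * l)) ^+ 2
  <= wlaw i true * (kap * `|s i - l|).
  have -> : wlaw i true * (del i * s i + (A i.+1 + H i.+1 * s i) - (A i + H i * l)) ^+ 2
    + wlaw i false * (del i * l + (A i.+1 + H i.+1 * l) - (A i + H i * l)) ^+ 2 =
    wlaw i true * ((1 + m * mu i) * (s i - l) ^+ 2 * H i ^+ 2).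
    rewrite (Arec iM) E /wlaw /=; field; rewrite gt_eqF//; exact: mmu_gt0.
  rewrite ler_wpM2l// /kap.
  rewrite -(ler_pM2r (_ : 0 < m ^+ 2)) ?exprn_gt0//.
  (* The 16 is a product of three bounds: 2 for [1 + m * mu i], [2 * |s i - l|] for the square, and
     4 for [(m * H i)^2]. *)
  have -> : 16 / m ^+ 2 * `|s i - l| * m ^+ 2 = 2 * (2 * `|s i - l|) * 4.
    by field; rewrite gt_eqF.
  rewrite -[X in X <= _]mulrA [H i ^+ 2 * _]mulrC.
  have p : 0 <= (1 + m * mu i) * (s i - l) ^+ 2 by rewrite mulr_ge0 ?sqr_ge0// ltW.
  apply: ler_pM => //; first by rewrite mulr_ge0 ?sqr_ge0.
  apply: ler_pM => //; rewrite ?sqr_ge0 ?(ltW (mmu_gt0 i))//.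
  by have := mmu1 i; lra.
have tr : `|s i.+1 - l| <= `|s i.+1 - s i| + `|s i - l|.
  by apply: le_trans (ler_normD _ _); rewrite addrA subrK.
have h0 := ler_wpM2l q0 H0; have h1 := ler_wpM2l q1 H1.
have h2 := ler_wpM2l (mulr_ge0 q0 kap0) tr.
set w0 := wlaw i false in q0 qs var h0 h2 *; set w1 := wlaw i true in q1 qs var h1 *.
have e : w1 * (kap * (`|s i.+1 - s i| + S)) + w0 * (kap * (`|s i.+1 - s i| + `|s i - l| + S))
  + w1 * (kap * `|s i - l|) = kap * (`|s i - l| + (`|s i.+1 - s i| + S)).
  by rewrite -[RHS]mul1r -qs; ring.
rewrite -e; lra.
Qed.

End SignStatistic.

(** * Squared masses of the random intervals *)

Section GapStatistic.
Variables (R : realFieldType) (m : R) (mu : nat -> R).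
Hypotheses (m0 : 0 < m) (mu0 : forall i, 0 <= mu i).
Hypothesis mmu1 : forall i, m * mu i <= 1.

(* Upper bound for the sum of the squared masses of the intervals of the random
   partition, [g] being the mass accumulated since the last endpoint. *)
Fixpoint Qrun (i : nat) (g : R) (t : bitseq) : R :=
  if t is b :: t' then
    mu i * (mu i + 2 * g) + Qrun i.+1 (mu i + (if b then 0 else g)) t'
  else 0.

Lemma Qrun_ge0 i g t : 0 <= g -> 0 <= Qrun i g t.
Proof.
elim: t i g => [|b t IH] i g g0 //=.
have gg : 0 <= (if b then 0 else g) by case: b.
rewrite addr_ge0 ?mulr_ge0 ?addr_ge0 ?mulr_ge0//.
by apply: IH; rewrite addr_ge0.
Qed.

Let mmu0 i : 0 <= m * mu i. Proof. by rewrite mulr_ge0// ltW. Qed.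

Lemma Qrun_mean i g n : 0 <= g ->
  pexp (wlaw m mu) i n (Qrun i g)
    <= \sum_(i <= j < i + n) mu j ^+ 2 + 4 / m * (\sum_(i <= j < i + n) mu j + g).
Proof.
have wP := wlaw_law m0 mu0.
elim: n i g => [|n IH] i g g0 /=.
  by rewrite addn0 !big_geq// !add0r mulr_ge0// divr_ge0// ltW.
rewrite big_bool /= !(pexpD _ _ _ (fun=> mu i * (mu i + 2 * g))) !pexp_cst//.
rewrite -addSnnS.
rewrite ![\sum_(i <= j < i.+1 + n) _]big_ltn ?addSn ?ltnS ?leq_addr//.
have H1 := IH i.+1 (mu i + 0) ltac:(by rewrite addr0).
have H0 := IH i.+1 (mu i + g) (addr_ge0 (mu0 i) g0).
rewrite addSn in H0 H1.
set S2 := \sum_(_ <= j < _) mu j ^+ 2 in H0 H1 *.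
set S1 := \sum_(_ <= j < _) mu j in H0 H1 *.
have q0 := (wP i).1 false; have q1 := (wP i).1 true.
have qs : wlaw m mu i true + wlaw m mu i false = 1 by rewrite -[RHS](wP i).2 big_bool.
(* The potential [4 / m * g] pays for the cross term: an endpoint, which discards [g], has
   probability at least [m * mu i / 2]. *)
have e : mu i * g * 2 <= 4 / m * (wlaw m mu i true * g).
  have -> : 4 / m * (wlaw m mu i true * g) = (4 / (1 + m * mu i)) * (mu i * g).
    rewrite /wlaw; field; rewrite !gt_eqF ?ltr_wpDr//.
  rewrite mulrC ler_wpM2r ?mulr_ge0// ler_pdivlMr ?ltr_wpDr//.
  by have := mmu1 i; lra.
move: q0 q1 qs e H0 H1.
set w0 := wlaw _ _ _ false; set w1 := wlaw _ _ _ true; set P0 := pexp _ _ _ _.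
set P1 := pexp _ _ _ _ => q0 q1 qs e H0 H1.
have h0 := ler_wpM2l q0 H0; have h1 := ler_wpM2l q1 H1.
set k := 4 / m in h0 h1 e *.
have -> : w1 * (mu i * (mu i + 2 * g) + P1) + w0 * (mu i * (mu i + 2 * g) + P0)
  = (w1 + w0) * (mu i * (mu i + 2 * g)) + w1 * P1 + w0 * P0 by ring.
have E : w1 * (S2 + k * (S1 + (mu i + 0))) + w0 * (S2 + k * (S1 + (mu i + g)))
   = (w1 + w0) * (S2 + k * (S1 + mu i + g)) - k * (w1 * g) by ring.
rewrite qs mul1r in E *; lra.
Qed.

Lemma count_mean i n :
  pexp (wlaw m mu) i n (fun t => (count id t)%:R) <= m * \sum_(i <= j < i + n) mu j.
Proof.
have wP := wlaw_law m0 mu0.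
elim: n i => [|n IH] i /=; first by rewrite addn0 big_geq// mulr0.
rewrite big_bool /=.
rewrite (eq_pexp _ _ (g := fun t => 1 + (count id t)%:R)); last first.
  by move=> t _; rewrite natrD.
rewrite (pexpD _ _ _ (fun=> 1)) pexp_cst//.
rewrite (eq_pexp _ _ (g := fun t => (count id t)%:R)); last first.
  by move=> t _; rewrite add0n.
rewrite -addSnnS big_ltn ?addSn ?ltnS ?leq_addr//.
have H0 := IH i.+1; rewrite addSn in H0.
have qs : wlaw m mu i true + wlaw m mu i false = 1 by rewrite -[RHS](wP i).2 big_bool.
have e : wlaw m mu i true <= m * mu i.
  by rewrite /wlaw mulrC ler_pdivrMr ?ltr_wpDr// ler_peMr// lerDl.
set P := pexp _ _ _ _ in H0 *; set S := \sum_(_ <= j < _) _ in H0 *.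
rewrite mulrDr mulr1 -addrA -mulrDl qs mul1r mulrDr; lra.
Qed.

End GapStatistic.

(** * Distributing the mass of the cells over the buckets *)

Section Buckets.
Variables (R : realFieldType) (M N : nat) (t : bitseq).
Hypothesis tM : size t = M.

(** The index of the bucket that contains the left end of cell [j]. *)
Definition rnk (j : nat) : nat := count id (take j t).

Lemma rnk0 : rnk 0 = 0%N. Proof. by rewrite /rnk take0. Qed.

Lemma rnkS j : (j < M)%N -> rnk j.+1 = (rnk j + nth false t j)%N.
Proof. by move=> jM; rewrite /rnk (take_nth false) ?tM// -cats1 count_cat /= addn0. Qed.

Lemma leq_rnk i j : (i <= j)%N -> (rnk i <= rnk j)%N.
Proof.
move=> ij; rewrite /rnk -[take j t](cat_take_drop i) take_takel// count_cat.
exact: leq_addr.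
Qed.

(* [c i b] is the mass that cell [i] sends to bucket [b]: everything goes to
   bucket [rnk i], except that a sampled cell is cut in two by its sample. *)
Definition cell_split (c : nat -> nat -> R) (p : nat -> R) :=
  [/\ forall i b, 0 <= c i b,
      forall i, (i < M)%N -> \sum_(b < N) c i b = p i &
      forall i b, (i < M)%N -> b != rnk i -> b != rnk i.+1 -> c i b = 0].

Lemma Qrun_buckets c mu : cell_split c mu ->
  \sum_(b < N) (\sum_(0 <= i < M) c i b) ^+ 2 <= Qrun mu 0 0 t.
Proof.
move=> [c0 cs cz].
have mu0 i : (i < M)%N -> 0 <= mu i by move=> iM; rewrite -cs// sumr_ge0.
pose S (j b : nat) := \sum_(0 <= i < j) c i b.
(* The mass of the earlier cells whose right end lies in the bucket where cell [j] begins; this is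
   the accumulated argument of [Qrun] at bit [j]. *)
pose g j := \sum_(0 <= i < j) mu i * (rnk i.+1 == rnk j)%:R.
suff H n j : (j + n)%N = M ->
    \sum_(b < N) S M b ^+ 2 <= \sum_(b < N) S j b ^+ 2 + Qrun mu j (g j) (drop j t).
  have := H M 0%N (add0n M); rewrite /g big_geq// drop0 => /le_trans; apply.
  rewrite [X in X + _]big1 ?add0r// => b _.
  by rewrite /S big_geq// expr0n.
elim: n j => [|n IH] j.
  by rewrite addn0 => ->; rewrite drop_oversize ?tM//= addr0.
move=> jnM; have jM : (j < M)%N by rewrite -jnM addnS ltnS leq_addr.
apply: le_trans (IH j.+1 _) _; first by rewrite addSnnS.
rewrite (drop_nth false (n := j)) ?tM//=.
have -> : g j.+1 = mu j + (if nth false t j then 0 else g j).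
  rewrite /g big_nat_recr//= eqxx mulr1 addrC; congr (_ + _).
  rewrite big_nat; case: ifP => bj.
    apply: big1 => i /andP[_ ij].
    have le := leq_rnk ij; rewrite (rnkS jM) bj.
    by rewrite (ltn_eqF (_ : rnk i.+1 < rnk j + true)%N) ?mulr0// addn1 ltnS.
  by rewrite [RHS]big_nat; apply: eq_bigr => i _; rewrite (rnkS jM) bj addn0.
rewrite [leRHS]addrA lerD2r.
have step b : S j.+1 b ^+ 2 <= S j b ^+ 2 + c j b * (mu j + 2 * g j) ->
   S j.+1 b ^+ 2 - S j b ^+ 2 <= c j b * (mu j + 2 * g j) by lra.
rewrite -lerBlDl -sumrB.
rewrite (_ : mu j * _ = \sum_(b < N) c j b * (mu j + 2 * g j)); last first.
  by rewrite -mulr_suml cs.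
apply: ler_sum => b _; apply: step.
rewrite {1}/S big_nat_recr//= -/(S j b).
have cb : c j b <= mu j.
  by rewrite -cs// (bigD1 b)//= lerDl sumr_ge0.
have [->|cjb0] := eqVneq (c j b) 0; first by rewrite addr0 mul0r addr0.
have bj : (rnk j <= b)%N.
  rewrite leqNgt; apply: contra cjb0 => bj; apply/eqP/cz => //.
    by rewrite (ltn_eqF bj).
  by rewrite (ltn_eqF (leq_trans bj (leq_rnk (leqnSn j)))).
(* As [b] is at least [rnk j], an earlier cell can reach bucket [b] only if its right end is still
   in bucket [rnk j]. *)
suff Sg : S j b <= g j by have := c0 j b; nra.
rewrite /S /g big_nat [leRHS]big_nat; apply: ler_sum => i /andP[_ ij].
have iM := ltn_trans ij jM.
have ci : c i b <= mu i by rewrite -cs// (bigD1 b)//= lerDl sumr_ge0.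
case: eqP => [_|/eqP ne]; first by rewrite mulr1.
rewrite mulr0; suff -> : c i b = 0 by [].
have lt : (rnk i.+1 < b)%N.
  by apply: leq_trans bj; rewrite ltn_neqAle ne leq_rnk.
apply: cz => //; last by rewrite gtn_eqF.
by rewrite gtn_eqF// (leq_ltn_trans _ lt)// leq_rnk.
Qed.

Variables (k : nat) (lo hi : 'I_k -> nat) (sig : 'I_k -> R).
Hypothesis lohi : forall j, (lo j <= hi j <= M)%N.
Hypothesis sig1 : forall j, `|sig j| <= 1.
Let s := pval lo hi sig.

(** A bucket takes the sign of the piece holding its left end, the [b]-th endpoint. Bucket 0
    precedes all endpoints and gets 0. *)
Definition bucket_sign (b : nat) : R :=
  \sum_j sig j * (rnk (lo j) < b <= rnk (hi j))%N%:R.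

Lemma bucket_sign0 : bucket_sign 0 = 0.
Proof. by rewrite /bucket_sign big1// => j _; rewrite ltn0 mulr0. Qed.

Lemma bucket_signS j : (j < M)%N -> bucket_sign (rnk j.+1) =
  if nth false t j then s j else bucket_sign (rnk j).
Proof.
move=> jM; case: ifP => bj; last by rewrite (rnkS jM) bj addn0.
rewrite /bucket_sign /s /pval rnkS// bj addn1; apply: eq_bigr => a _.
congr (_ * _%:R); rewrite /in_piece ltnS; congr (nat_of_bool (_ && _)).
  apply/idP/idP => [|/leq_rnk//]; apply: contraTT; rewrite -!ltnNge => ja.
  by rewrite (leq_trans _ (leq_rnk ja))// rnkS// bj addn1.
apply/idP/idP => [|ja]; last by rewrite (leq_trans _ (leq_rnk ja))// rnkS// bj addn1.
by apply: contraTT; rewrite -!ltnNge !ltnS => /leq_rnk.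
Qed.

Lemma Wrun_sum del : Wrun del s 0 0 t = \sum_(0 <= i < M) del i * bucket_sign (rnk i.+1).
Proof.
suff H n j : (j + n)%N = M -> Wrun del s j (bucket_sign (rnk j)) (drop j t) =
    \sum_(j <= i < M) del i * bucket_sign (rnk i.+1).
  by have := H M 0%N (add0n M); rewrite rnk0 bucket_sign0 drop0.
elim: n j => [|n IH] j.
  by rewrite addn0 => ->; rewrite drop_oversize ?tM//= big_geq.
move=> jnM; have jM : (j < M)%N by rewrite -jnM addnS ltnS leq_addr.
rewrite (drop_nth false (n := j)) ?tM//= [RHS]big_ltn// -bucket_signS//.
by rewrite IH// addSnnS.
Qed.

Lemma bucket_sign_tv :
  \sum_(0 <= i < M) `|bucket_sign (rnk i.+1) - bucket_sign (rnk i)| <= 2 * k%:R.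
Proof.
apply: le_trans (pval_tv lohi sig1).
rewrite -/s.
(* The distance from the sign held to [s j] is the slack: it grows at most by the jumps of [s] and
   is spent when an endpoint updates the sign. *)
suff H j : (j <= M)%N -> \sum_(0 <= i < j) `|bucket_sign (rnk i.+1) - bucket_sign (rnk i)|
    + `|s j - bucket_sign (rnk j)| <= `|s 0%N| + \sum_(0 <= i < j) `|s i.+1 - s i|.
  by apply: le_trans (H M _) => //; rewrite lerDl.
elim: j => [|j IH] jM; first by rewrite !big_geq// rnk0 bucket_sign0 subr0 addrC.
have := IH (ltnW jM); rewrite !big_nat_recr//= => {}IH.
have tr (u : R) : `|s j.+1 - u| <= `|s j.+1 - s j| + `|s j - u|.
  by apply: le_trans (ler_normD _ _); rewrite addrA subrK.
rewrite bucket_signS//; case: ifP => _.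
  lra.
by rewrite subrr normr0; have := tr (bucket_sign (rnk j)); lra.
Qed.

(** Only a cell cut by an endpoint errs: part of its mass keeps the old sign, and the whole cell is
    charged with the change of sign. *)
Lemma bucket_sign_split c p : cell_split c p -> (forall i, (i < M)%N -> 0 <= p i) ->
  `|\sum_(b < N) bucket_sign b * (\sum_(0 <= i < M) c i b)
     - \sum_(0 <= i < M) p i * bucket_sign (rnk i.+1)|
  <= \sum_(0 <= i < M) p i * `|bucket_sign (rnk i.+1) - bucket_sign (rnk i)|.
Proof.
move=> [c0 cs cz] p0.
under eq_bigr do rewrite mulr_sumr.
rewrite exchange_big /= -sumrB; apply: le_trans (ler_norm_sum _ _ _) _.
rewrite [leLHS]big_nat [leRHS]big_nat; apply: ler_sum => i /andP[_ iM].
rewrite -cs// !mulr_suml -sumrB; apply: le_trans (ler_norm_sum _ _ _) _.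
apply: ler_sum => b _; rewrite [bucket_sign b * _]mulrC -mulrBr normrM ger0_norm//.
have [->|b1] := eqVneq (nat_of_ord b) (rnk i.+1).
  by rewrite subrr normr0 mulr0 mulr_ge0.
have [->|b2] := eqVneq (nat_of_ord b) (rnk i); first by rewrite distrC.
by rewrite cz// !mul0r.
Qed.

(** The loss [4 * k * tau] is [2 * tau], the bound on a cut cell, times the variation [2 * k] of the
    bucket signs. *)
Lemma Wrun_buckets cp cq p q (tau : R) : cell_split cp p -> cell_split cq q ->
  (forall i, (i < M)%N -> 0 <= p i) -> (forall i, (i < M)%N -> 0 <= q i) ->
  (forall i, (i < M)%N -> p i + q i <= 2 * tau) -> 0 <= tau ->
  Wrun (fun i => p i - q i) s 0 0 t - 4 * k%:R * tau <=
  \sum_(b < N) bucket_sign b *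
     (\sum_(0 <= i < M) cp i b - \sum_(0 <= i < M) cq i b).
Proof.
move=> sp sq p0 q0 pq tau0; rewrite Wrun_sum.
have := bucket_sign_split sp p0; rewrite ler_norml => /andP[h1 _].
have := bucket_sign_split sq q0; rewrite ler_norml => /andP[_ h2].
under [X in _ <= X]eq_bigr do rewrite mulrBr.
under [X in X - _ <= _]eq_bigr do rewrite mulrBl.
rewrite !sumrB.
suff : \sum_(0 <= i < M) p i * `|bucket_sign (rnk i.+1) - bucket_sign (rnk i)|
  + \sum_(0 <= i < M) q i * `|bucket_sign (rnk i.+1) - bucket_sign (rnk i)|
  <= 4 * k%:R * tau by lra.
rewrite -big_split /= big_nat.
apply: le_trans (_ : \sum_(0 <= i < M)
   2 * tau * `|bucket_sign (rnk i.+1) - bucket_sign (rnk i)| <= _).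
  rewrite [leRHS]big_nat; apply: ler_sum => i /andP[_ iM].
  by rewrite -mulrDl ler_wpM2r// pq.
rewrite -mulr_sumr; have := ler_wpM2l tau0 bucket_sign_tv; lra.
Qed.

End Buckets.

Lemma sqr_lt_itv (R : realFieldType) (z w : R) : 0 <= w -> z ^+ 2 < w ^+ 2 -> -w < z < w.
Proof.
move=> w0; rewrite -ltr_norml -real_normK ?num_real// => h.
by rewrite -ltr_sqr ?nnegrE.
Qed.

(** * The dichotomy for distributions on cells *)

Section Discrete.
Variables (R : realFieldType) (M : nat) (m y tau : R) (p q : nat -> R).
Hypotheses (m0 : 0 < m) (y0 : 0 < y) (ym : y ^+ 2 = m).
Hypotheses (p0 : forall i, 0 <= p i) (q0 : forall i, 0 <= q i).
Hypotheses (pM : \sum_(0 <= i < M) p i = 1) (qM : \sum_(0 <= i < M) q i = 1).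
Let mu i := (p i + q i) / 2.
Let del i := p i - q i.
Let al i := m * p i.
Let be i := m * q i.

Let al0 i : 0 <= al i. Proof. by rewrite mulr_ge0// ltW. Qed.
Let be0 i : 0 <= be i. Proof. by rewrite mulr_ge0// ltW. Qed.
Let mu0 i : 0 <= mu i. Proof. by rewrite divr_ge0// addr_ge0. Qed.
Let muM : \sum_(0 <= i < M) mu i = 1.
Proof. by rewrite -mulr_suml big_split /= pM qM; field. Qed.
Let del_mu i : `|del i| <= 2 * mu i.
Proof. rewrite /del /mu ler_norml; have := p0 i; have := q0 i; lra. Qed.
Let sum_x : \sum_(0 <= i < M) (al i + be i) = 2 * m.
Proof. by rewrite big_split /= -!mulr_sumr pM qM; ring. Qed.

Lemma Z_null : (forall i, p i = q i) ->
  23 / 25 <= pexp (zlaw al be) 0 M (fun t => (Zrun 0 t <= 5 * y)%R%:R).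
Proof.
move=> pq; have zP := zlaw_law al0 be0.
have k0 : 0 < 25 * m by rewrite mulr_gt0.
have V : pexp (zlaw al be) 0 M (fun t => Zrun 0 t ^+ 2) <= 2 * m.
  rewrite -sum_x -[leRHS]mul1r.
  rewrite (eq_pexp _ _ (g := fun t => (Zrun 0 t - (0 + 0 * 0)) ^+ 2)); last first.
    by move=> t _; rewrite mul0r addr0 subr0.
  (* For [p = q] the zero sequences solve both recurrences, so the constant 1 replaces 9 and the
     variance is at most [2 * m]. *)
  apply: (@Zrun_var _ al be al0 be0 M (fun=> 0) (fun=> 0)) => //.
  - by move=> i _; rewrite /= addr0 /al /be pq subrr mul0r.
  - by move=> i _; rewrite mulr0 mul0r addr0.
  - by move=> j L L1 _; rewrite /= !mul0r addr0; split; nra.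
  - by rewrite oppr_le0 ler01.
have := @pexp_markov _ _ (zlaw al be) 0 M (fun t => Zrun 0 t ^+ 2) (25 * m) zP k0.
move=> /(_ (fun t _ => sqr_ge0 _)) h.
apply: le_trans (_ : _ <= 1 - pexp (zlaw al be) 0 M (fun t => Zrun 0 t ^+ 2) / (25 * m)) _.
  have : pexp (zlaw al be) 0 M (fun t => Zrun 0 t ^+ 2) / (25 * m) <= 2 / 25.
    rewrite ler_pdivrMr//; lra.
  lra.
apply: le_trans h _; apply: ler_pexp => [i a|t _]; first exact: (zP i).1.
case: ltP => //= lt; rewrite ?ler0n//.
suff -> : Zrun 0 t <= 5 * y by [].
have /andP[_ /ltW//] : - (5 * y) < Zrun 0 t < 5 * y.
apply: sqr_lt_itv; first by rewrite mulr_ge0// ltW.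
by rewrite exprMn ym; move: lt; rewrite (_ : 5 ^+ 2 = 25)//; ring.
Qed.

(** Two uses of Markov's inequality, each losing [1 / T]. The 5 is 1, for the squared cell masses
    summing to at most [1 / m], plus the 4 of [Qrun_mean]. *)
Lemma gap_good (T : R) : 0 < T -> (forall i, mu i <= tau) -> m * tau <= 1 ->
  1 - 2 / T <= pexp (wlaw m mu) 0 M (fun t =>
     (((count id t)%:R < T * (m + 1)) && (Qrun mu 0 0 t < 5 * T / m))%R%:R).
Proof.
move=> T0 mu_tau mtau.
have mmu1 i : m * mu i <= 1 by apply: le_trans mtau; rewrite ler_pM2l.
have wP := wlaw_law m0 mu0.
have k1 : 0 < T * (m + 1) by rewrite mulr_gt0// ltr_wpDl// ltW.
have k2 : 0 < 5 * T / m by rewrite divr_gt0// mulr_gt0.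
have h1 := @pexp_markov _ _ (wlaw m mu) 0 M (fun t => (count id t)%:R) _ wP k1
  (fun t _ => ler0n _ _).
have h2 := @pexp_markov _ _ (wlaw m mu) 0 M (Qrun mu 0 0) _ wP k2
  (fun t _ => Qrun_ge0 mu0 0 t (lexx 0)).
have e1 := count_mean m0 mu0 0 M.
have e2 := Qrun_mean m0 mu0 mmu1 0 M (lexx 0).
rewrite muM mulr1 in e1; rewrite muM addr0 mulr1 in e2.
have sq : \sum_(0 <= i < M) mu i ^+ 2 <= 1 / m.
  apply: le_trans (_ : \sum_(0 <= i < M) mu i * tau <= _).
    by apply: ler_sum => i _; rewrite expr2 ler_wpM2l.
  by rewrite -mulr_suml muM mul1r ler_pdivlMr// mulrC.
rewrite add0n in e1 e2.
have f1 : pexp (wlaw m mu) 0 M (fun t => (count id t)%:R) / (T * (m + 1)) <= 1 / T.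
  rewrite ler_pdivrMr// (_ : 1 / T * _ = m + 1); first lra.
  by field; rewrite gt_eqF.
have f2 : pexp (wlaw m mu) 0 M (Qrun mu 0 0) / (5 * T / m) <= 1 / T.
  rewrite ler_pdivrMr//.
  have -> : 1 / T * (5 * T / m) = 5 / m by field; rewrite !gt_eqF.
  lra.
have h3 := @pexp2_mono R _ (wlaw m mu) 0 M
  (fun t => (count id t)%:R < T * (m + 1)) (fun t => Qrun mu 0 0 t < 5 * T / m)
  (fun t => ((count id t)%:R < T * (m + 1)) && (Qrun mu 0 0 t < 5 * T / m))%R wP.
apply: le_trans (h3 _); last by move=> t _ /= -> ->.
rewrite (_ : 2 / T = 1 / T + 1 / T); last by ring.
lra.
Qed.

Hypotheses (m1 : 1 <= m) (mu_tau : forall i, mu i <= tau) (tau_m : 1000 * m ^+ 2 * tau <= 1).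
Variables (C eps : R) (k : nat) (lo hi : 'I_k -> nat).
Hypotheses (C0 : 2000 <= C) (eps0 : 0 < eps) (k0 : (0 < k)%N).
Hypothesis lohi : forall j, (lo j <= hi j <= M)%N.
Hypothesis partM : forall i, (i < M)%N -> (\sum_j in_piece lo hi j i)%N = 1%N.
Hypothesis discr : eps < \sum_j `|\sum_(lo j <= i < hi j) del i|.
Hypothesis k_m3 : k%:R ^+ 2 * y * C ^+ 2 <= m ^+ 3 * eps ^+ 3.
Hypothesis k_m2 : k%:R * C ^+ 2 <= 2 * (m ^+ 2 * eps ^+ 2).

Let tau0 : 0 <= tau. Proof. exact: le_trans (mu0 0%N) (mu_tau 0%N). Qed.
Let mtau_small : 1000 * m * tau <= 1.
Proof.
apply: le_trans tau_m; rewrite -!mulrA; apply: ler_wpM2l (ler0n _ _) _ _ _.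
rewrite mulrA; apply: ler_wpM2r tau0 _ _ _.
by rewrite ler_peMr// ltW.
Qed.
Let y1 : 1 <= y.
Proof. by rewrite -ler_sqr ?nnegrE ?ler01 ?(ltW y0)// ym expr1n. Qed.

Definition piece_sign (j : 'I_k) : R := Num.sg (\sum_(lo j <= i < hi j) del i).

Lemma piece_sign_le1 j : `|piece_sign j| <= 1.
Proof. by rewrite /piece_sign normr_sg; case: (_ != 0). Qed.

Lemma Z_or_W :
  19 / 20 <= pexp (zlaw al be) 0 M (fun t => (5 * y < Zrun 0 t)%R%:R) \/
  19 / 20 <= pexp (wlaw m mu) 0 M
    (fun t => (eps / 4 < Wrun del (pval lo hi piece_sign) 0 0 t)%R%:R).
Proof.
have x0 i : 0 <= al i + be i by rewrite addr_ge0.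
have x1 i : 0 < 1 + (al i + be i) by rewrite ltr_wpDr.
have xE i : al i + be i = 2 * m * mu i by rewrite /al /be /mu; field.
have yE i : al i - be i = m * del i by rewrite /al /be /del; ring.
have mmu1 i : 1000 * (m * mu i) <= 1.
  apply: le_trans mtau_small; rewrite -mulrA; apply: ler_wpM2l (ler0n _ _) _ _ _.
  exact: ler_wpM2l (ltW m0) _ _ _.
have [B [BM Brec]] := backward_rec (fun i b => (al i - be i + b) / (1 + (al i + be i))) (0 : R) M.
have [A [AM Arec]] := backward_rec (fun i a => a + (al i - be i) * B i.+1 / (1 + (al i + be i))) (0 : R) M.
have B1 i := B_le1 al0 be0 BM Brec (i := i).
have [big|small] := leP (25 * y) (A 0%N).
  left; have zP := zlaw_law al0 be0.
  (* The mean exceeds the threshold [5 * y] by [20 * y], and the variance is at most [9 * (2 * m)],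
     so the failure probability is at most 18/400. *)
  have K0 : 0 < 400 * m := mulr_gt0 (ltr0Sn _ _) m0.
  have V := @Zrun_var9 _ al be al0 be0 M A B AM BM Brec Arec 0 M 0 (add0n M)
    ltac:(by rewrite oppr_le0 ler01).
  rewrite sum_x mulr0 addr0 in V.
  have h := @pexp_markov _ _ (zlaw al be) 0 M (fun t => (Zrun 0 t - A 0%N) ^+ 2)
    (400 * m) zP K0 (fun t _ => sqr_ge0 _).
  apply: le_trans (_ : _ <= 1 - pexp (zlaw al be) 0 M (fun t => (Zrun 0 t - A 0%N) ^+ 2) / (400 * m)) _.
    have : pexp (zlaw al be) 0 M (fun t => (Zrun 0 t - A 0%N) ^+ 2) / (400 * m) <= 1 / 20.
      rewrite ler_pdivrMr//; lra.
    lra.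
  apply: le_trans h _; apply: ler_pexp => [i a|t _]; first exact: (zP i).1.
  case: ltP => //= lt; rewrite ?ler0n//.
  suff -> : 5 * y < Zrun 0 t by [].
  have : - (20 * y) < Zrun 0 t - A 0%N < 20 * y.
    apply: sqr_lt_itv; first by rewrite mulr_ge0// ltW.
    by rewrite exprMn ym; move: lt; rewrite (_ : 20 ^+ 2 = 400)//; ring.
  by case/andP => + _; rewrite ltrBrDl => /(le_lt_trans _); apply; lra.
right.
have En := energy AM BM Brec Arec (fun i => _) (fun i => _) (fun i => B1 i).
have {}En : \sum_(0 <= i < M) (al i + be i) * B i ^+ 2 / 4
    - 4 * \sum_(0 <= i < M) (al i + be i) ^+ 2 <= A 0%N.
  apply: En => i.
    by rewrite x0 xE -mulrA /=; have := mmu1 i; lra.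
  by rewrite yE xE -mulrA normrM gtr0_norm// mulrCA ler_pM2l.
have sq : \sum_(0 <= i < M) (al i + be i) ^+ 2 <= y / 4.
  apply: le_trans (_ : \sum_(0 <= i < M) mu i * (4 * m ^+ 2 * tau) <= _).
    apply: ler_sum => i _; rewrite xE.
    have -> : (2 * m * mu i) ^+ 2 = mu i * (4 * m ^+ 2 * mu i) by ring.
    by rewrite !ler_wpM2l// mulr_ge0// sqr_ge0.
  by rewrite -mulr_suml muM mul1r; have := tau_m; have := y1; lra.
pose G i := B i / m.
have GM : G M = 0 by rewrite /G BM mul0r.
have Grec i : (i < M)%N -> (1 + 2 * m * mu i) * G i = del i + G i.+1.
  move=> iM; rewrite /G (Brec i iM) yE xE; field.
  by rewrite -xE !gt_eqF.
have [H [HM Hrec']] := backward_rec (fun i h => (del i + h) / (1 + m * mu i)) (0 : R) M.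
have e0 i : 0 < 1 + m * mu i by rewrite ltr_wpDr// mulr_ge0// ltW.
have Hrec i : (i < M)%N -> (1 + m * mu i) * H i = del i + H i.+1.
  by move=> iM; rewrite (Hrec' i iM) mulrC divfK// gt_eqF.
have HG := sum_H_sqr_le_G m0 mu0 HM GM Hrec Grec.
(* The energy is at most [25 * y + y], the last term for the quadratic error; passing from [x] and
   [B] to [mu] and [G] multiplies it by [2 / m^3]. *)
have sumG : \sum_(0 <= i < M) mu i * G i ^+ 2 <= 52 * y / m ^+ 3.
  rewrite (_ : \sum_(0 <= i < M) mu i * G i ^+ 2 =
    2 / m ^+ 3 * \sum_(0 <= i < M) (al i + be i) * B i ^+ 2 / 4).
    rewrite mulrAC ler_pdivrMr ?exprn_gt0// divfK ?gt_eqF ?exprn_gt0//; lra.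
  by rewrite mulr_sumr; apply: eq_bigr => i _; rewrite xE /G; field; rewrite gt_eqF.
(* Jumps below [eta] then contribute at most [eps / 8] in total. *)
pose eta := eps / (8 * k%:R).
have kR : 0 < k%:R :> R by rewrite ltr0n.
have eta0 : 0 < eta by rewrite divr_gt0// mulr_gt0.
have J := sum_jumps lohi partM m0 eta0 mu0 del_mu HM Hrec.
have cub : 768 * \sum_(0 <= i < M) mu i ^+ 3 <= 24 * y / m ^+ 3.
  apply: le_trans (_ : 768 * tau ^+ 2 <= _).
    apply: ler_wpM2l (ler0n _ _) _ _ _.
    apply: le_trans (_ : \sum_(0 <= i < M) mu i * tau ^+ 2 <= _).
      by apply: ler_sum => i _; rewrite exprS ler_wpM2l// ler_sqr ?nnegrE.
    by rewrite -mulr_suml muM mul1r.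
  rewrite ler_pdivlMr ?exprn_gt0//.
  have h : m ^+ 3 * tau ^+ 2 <= 1 / 1000.
    have -> : m ^+ 3 * tau ^+ 2 = (m ^+ 2 * tau) * (m * tau) by ring.
    have := mulr_ge0 (ltW m0) tau0.
    move: mtau_small tau_m; rewrite -!(mulrA 1000).
    have := mulr_ge0 (sqr_ge0 m) tau0; move: (m * tau) (m ^+ 2 * tau) => *; nra.
  have := y1; lra.
have J2 : \sum_j `|H (hi j) - H (lo j)| <= eps / 2.
  apply: le_trans J _.
  have -> : k%:R * eta = eps / 8 by rewrite /eta; field; rewrite gt_eqF.
  suff : (72 * \sum_(0 <= i < M) mu i * H i ^+ 2
      + 768 * \sum_(0 <= i < M) mu i ^+ 3) / eta ^+ 2 <= eps / 4 by have := eps0; lra.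
  rewrite ler_pdivrMr ?exprn_gt0//.
  (* 15000 = 72 * 4 * 52 + 24, where 4 is lost from [G] to [H]. *)
  apply: le_trans (_ : 15000 * y / m ^+ 3 <= _).
    move: cub sumG; rewrite -!mulrA; move: (y / m ^+ 3) => ? *; lra.
  rewrite (ler_pdivrMr _ _ (exprn_gt0 3 m0)).
  have -> : eps / 4 * eta ^+ 2 * m ^+ 3 = (m ^+ 3 * eps ^+ 3) / (256 * k%:R ^+ 2).
    by rewrite /eta; field; rewrite gt_eqF.
  have pk : 0 < 256 * k%:R ^+ 2 :> R := mulr_gt0 (ltr0Sn _ _) (exprn_gt0 2 kR).
  rewrite (ler_pdivlMr _ _ pk); apply: le_trans k_m3.
  (* The constant to absorb is 15000 * 256 = 3840000, just below the square of 2000. *)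
  have C2 : 2000 * 2000 <= C ^+ 2 := ler_pM (ler0n _ _) (ler0n _ _) C0 C0.
  have : 0 <= k%:R ^+ 2 * y by rewrite mulr_ge0 ?sqr_ge0// ltW.
  move: C2; move: (C ^+ 2) (k%:R ^+ 2) => c2 k2 *; nra.
set s := pval lo hi piece_sign.
have s1 i : `|s i| <= 1 by rewrite /s; apply: (pval_le1 lohi partM); exact: piece_sign_le1.
have [W [WM Wrec]] := backward_rec (fun i a => a + s i * (m * mu i * H i)) (0 : R) M.
(* By [Hrec], [m * mu j * H j] is the discrepancy of the cell plus the increment of [H]. *)
have WE i : (i <= M)%N -> W i = \sum_(i <= j < M) s j * (del j + (H j.+1 - H j)).
  move=> iM; elim/(@down_ind M) : i / iM => [|i iM IH]; first by rewrite WM big_geq.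
  rewrite (Wrec i iM) IH [RHS]big_ltn// addrC; congr (_ * _ + _).
  have := Hrec i iM; lra.
have Wlow : eps / 2 <= W 0%N.
  rewrite WE//.
  (* On a piece [s] is constant, so the increments of [H] telescope and only the jump over the piece
     is lost. *)
  have -> : \sum_(0 <= i < M) s i * (del i + (H i.+1 - H i)) =
    \sum_j (`|\sum_(lo j <= i < hi j) del i| + piece_sign j * (H (hi j) - H (lo j))).
    rewrite -(sum_pieces lohi partM (fun i => s i * (del i + (H i.+1 - H i)))).
    apply: eq_bigr => j _; have /andP[h1 h2] := lohi j.
    rewrite -(telescope_sumr _ h1) {1}[`|_|]normrEsg -/(piece_sign j) !mulr_sumr.
    rewrite -big_split /= big_nat [RHS]big_nat; apply: eq_bigr => i ih.
    have -> : s i = piece_sign j.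
      by apply: (pval_in partM) => //; apply: leq_trans h2; case/andP: ih.
    exact: mulrDr.
  rewrite big_split /=.
  have : - \sum_j `|H (hi j) - H (lo j)| <= \sum_j piece_sign j * (H (hi j) - H (lo j)).
    rewrite -sumrN; apply: ler_sum => j _; rewrite lerNl.
    apply: le_trans (ler_norm _) _; rewrite normrN normrM ler_piMl//.
    exact: piece_sign_le1.
  have := discr; have := J2; lra.
have mmu1' i : m * mu i <= 1.
  by have := mmu1 i; have := mulr_ge0 (ltW m0) (mu0 i); lra.
have wP := wlaw_law m0 mu0.
have V := @Wrun_var _ M m mu del s m0 mu0 del_mu mmu1' s1 W H WM HM Hrec Wrec 0 M 0%N
  (add0n M) ltac:(by rewrite normr0).
rewrite mulr0 addr0 subr0 in V.
have tv := pval_tv lohi piece_sign_le1; rewrite -/s in tv.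
have e16 : 0 < eps ^+ 2 / 16 by rewrite divr_gt0// exprn_gt0.
have h := @pexp_markov _ _ (wlaw m mu) 0 M (fun t => (Wrun del s 0 0 t - W 0%N) ^+ 2)
    _ wP e16 (fun t _ => sqr_ge0 _).
apply: le_trans (_ : _ <= 1 - pexp (wlaw m mu) 0 M (fun t => (Wrun del s 0 0 t - W 0%N) ^+ 2) / (eps ^+ 2 / 16)) _.
  suff : pexp (wlaw m mu) 0 M (fun t => (Wrun del s 0 0 t - W 0%N) ^+ 2) / (eps ^+ 2 / 16) <= 1 / 20.
    lra.
  rewrite ler_pdivrMr//; apply: le_trans V _.
  (* The run starts with sign 0, so the jump to [s 0] is part of the variation bounded by
     [pval_tv]. *)
  apply: le_trans (_ : 16 / m ^+ 2 * (2 * k%:R) <= _).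
    by rewrite ler_wpM2l// divr_ge0// sqr_ge0.
  rewrite mulrAC ler_pdivrMr ?exprn_gt0//.
  have C2 : 2000 * 2000 <= C ^+ 2 := ler_pM (ler0n _ _) (ler0n _ _) C0 C0.
  have -> : 1 / 20 * (eps ^+ 2 / 16) * m ^+ 2 = m ^+ 2 * eps ^+ 2 / 320 by field.
  have := ler_wpM2l (ltW kR) C2; have := k_m2; lra.
apply: le_trans h _; apply: ler_pexp => [i a|t _]; first exact: (wP i).1.
case: ltP => //= lt; rewrite ?ler0n//.
suff -> : eps / 4 < Wrun del s 0 0 t by [].
have : - (eps / 4) < Wrun del s 0 0 t - W 0%N < eps / 4.
  apply: sqr_lt_itv; first by rewrite divr_ge0// ltW.
  by rewrite exprMn; move: lt; rewrite (_ : 4^-1 ^+ 2 = 16^-1)//; field.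
by case/andP => + _; rewrite ltrBrDl => /(le_lt_trans _); apply; lra.
Qed.

End Discrete.

(* No measurability is required of [f] and [g]: for nonnegative functions the
   integral is the supremum of the integrals of the simple functions below. *)
Lemma ge0_le_lower_integral d (T : measurableType d) (R : realType)
    (mu : {measure set T -> \bar R}) (D : set T) (f g : T -> \bar R) :
  (forall x, D x -> 0 <= f x)%E -> (forall x, D x -> f x <= g x)%E ->
  (\int[mu]_(x in D) f x <= \int[mu]_(x in D) g x)%E.
Proof.
move=> f0 fg; rewrite !ge0_integralE//; last first.
  by move=> x Dx; exact: le_trans (f0 x Dx) (fg x Dx).
apply: ereal_sup_le => _ [h hf <-]; exists h => //= x.
apply: le_trans (hf x) _; rewrite /patch; case: ifPn => //.
by rewrite inE => Dx; exact: fg.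
Qed.

(** * Masses of measurable sets under a density *)

Section DensityMass.
Variables (R : realType) (p : R -> R).
Hypothesis dp : density p.
Let I01 : set R := `[0, 1].

Definition pmass (A : set R) : R := fine (draw p (fun x => (\1_A x)%:E)).

Let mI : measurable I01. Proof. exact: measurable_itv. Qed.
Let p0 x : I01 x -> 0 <= p x. Proof. by case: dp => _ + _; apply; rewrite inE. Qed.
Let p0E x : I01 x -> (0 <= (p x)%:E)%E. Proof. by move=> /p0; rewrite lee_fin. Qed.
Let mp : measurable_fun I01 (fun x : R => (p x)%:E).
Proof. by case: dp => mp _ _; apply/measurable_EFinP. Qed.

Lemma draw_cst (k : \bar R) : (0 <= k)%E -> draw p (fun=> k) = k.
Proof.
move=> k0; rewrite /draw; under eq_integral do rewrite muleC.
by rewrite ge0_integralZl//; case: dp => _ _ ->; rewrite mule1.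
Qed.

Lemma le_draw (f g : R -> \bar R) : (forall x, 0 <= f x)%E ->
  (forall x, I01 x -> f x <= g x)%E -> (draw p f <= draw p g)%E.
Proof.
move=> f0 fg; apply: ge0_le_lower_integral => x Dx; first by rewrite mule_ge0 ?p0E.
by rewrite lee_wpmul2l ?p0E// fg.
Qed.

Lemma draw_ge0 (f : R -> \bar R) : (forall x, 0 <= f x)%E -> (0 <= draw p f)%E.
Proof. by move=> f0; apply: integral_ge0 => x Dx; rewrite mule_ge0 ?p0E. Qed.

Let mind (A : set R) : measurable A -> measurable_fun I01 (fun x => (\1_A x)%:E : \bar R).
Proof. by move=> mA; apply/measurable_EFinP/measurable_funTS; exact: measurable_indic. Qed.

Lemma pmassE (A : set R) : draw p (fun x => (\1_A x)%:E) = (pmass A)%:E.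
Proof.
rewrite /pmass fineK// ge0_fin_numE; last by apply: draw_ge0 => x; rewrite lee_fin.
apply: le_lt_trans (_ : _ <= draw p (fun=> 1%E))%E _; last by rewrite draw_cst// ltry.
by apply: le_draw => x; rewrite ?lee_fin// => _; rewrite indicE; case: (_ \in _); rewrite ?lexx ?ler01.
Qed.

Lemma pmass_ge0 A : 0 <= pmass A.
Proof. by rewrite -lee_fin -pmassE; apply: draw_ge0 => x; rewrite lee_fin. Qed.

Lemma draw_simple n (A : 'I_n -> set R) (phi : 'I_n -> \bar R) :
  (forall i, measurable (A i)) -> (forall i, 0 <= phi i)%E ->
  draw p (fun x => \sum_i phi i * (\1_(A i) x)%:E)%E = (\sum_i (pmass (A i))%:E * phi i)%E.
Proof.
move=> mA phi0; rewrite /draw.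
have H x : ((p x)%:E * \sum_i phi i * (\1_(A i) x)%:E
    = \sum_i phi i * ((p x)%:E * (\1_(A i) x)%:E))%E.
  rewrite ge0_sume_distrr => [|i _]; last by rewrite mule_ge0 ?lee_fin.
  by apply: eq_bigr => i _; rewrite muleCA.
under eq_integral do rewrite H.
have mpA i : measurable_fun I01 (fun x => (p x)%:E * (\1_(A i) x)%:E)%E.
  by apply: emeasurable_funM => //; exact: mind.
have mpA0 i x : I01 x -> (0 <= (p x)%:E * (\1_(A i) x)%:E)%E.
  by move=> Dx; rewrite mule_ge0 ?p0E// lee_fin.
rewrite ge0_integral_sum//=; last 2 first.
- by move=> i; apply: measurable_funeM; exact: mpA.
- by move=> i x Dx; rewrite mule_ge0// mpA0.
apply: eq_bigr => i _; rewrite ge0_integralZl//; [|exact: mpA|exact: mpA0].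
by rewrite muleC -pmassE.
Qed.

Lemma draw_fibers n (g : R -> 'I_n) (phi : 'I_n -> \bar R) :
  (forall i, measurable (g @^-1` [set i])) -> (forall i, 0 <= phi i)%E ->
  draw p (fun x => phi (g x)) = (\sum_i (pmass (g @^-1` [set i]))%:E * phi i)%E.
Proof.
move=> mg phi0; rewrite -draw_simple//; congr (draw p _); apply/funext => x.
rewrite (bigD1 (g x))//= big1 ?adde0.
  by rewrite indicE mem_set ?mule1.
by move=> i ix; rewrite indicE memNset ?mule0//= => e; rewrite e eqxx in ix.
Qed.

Lemma pmassT : pmass setT = 1.
Proof.
apply: EFin_inj; rewrite -pmassE -(draw_cst (k := 1%E))//.
by congr draw; apply/funext => x; rewrite indicE in_setT.
Qed.

Lemma pmass_split n (g : R -> 'I_n) A : measurable A ->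
  (forall i, measurable (g @^-1` [set i])) ->
  pmass A = \sum_i pmass (A `&` g @^-1` [set i]).
Proof.
move=> mA mg; apply: EFin_inj; rewrite -pmassE -sumEFin.
have := @draw_simple n (fun i => A `&` g @^-1` [set i]) (fun=> 1%E).
move=> /(_ (fun i => measurableI _ _ mA (mg i)) (fun=> lee01)).
under [in X in _ = X -> _]eq_bigr do rewrite mule1.
move=> <-; congr draw; apply/funext => x.
under eq_bigr do rewrite mul1e.
rewrite (bigD1 (g x))//= big1 ?adde0.
  by rewrite !indicE in_setI; congr (_%:R%:E); rewrite [X in _ && X]mem_set ?andbT.
by move=> i ix; rewrite indicE memNset//= => -[_ e]; rewrite e eqxx in ix.
Qed.

Lemma pmass_eq A B : measurable A -> measurable B ->
  lebesgue_measure (A `\` B) = 0%E -> lebesgue_measure (B `\` A) = 0%E -> pmass A = pmass B.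
Proof.
move=> mA mB AB BA; rewrite /pmass /draw; congr fine.
apply: ge0_ae_eq_integral => //.
- by apply: emeasurable_funM => //; exact: mind.
- by apply: emeasurable_funM => //; exact: mind.
- by move=> x Dx; rewrite mule_ge0 ?p0E// lee_fin.
- by move=> x Dx; rewrite mule_ge0 ?p0E// lee_fin.
exists ((A `\` B) `|` (B `\` A)); split.
- by apply: measurableU; exact: measurableD.
- apply/eqP; rewrite eq_le measure_ge0 andbT.
  apply: le_trans (measureU2 _ _ _) _; [exact: measurableD|exact: measurableD|].
  by rewrite [X in (X + _)%E]AB [X in (_ + X)%E]BA adde0.
move=> x /= h; have [xA|xA] := pselect (A x); have [xB|xB] := pselect (B x).
- by exfalso; apply: h => _; rewrite !indicE !mem_set.
- by left.
- by right.
- by exfalso; apply: h => _; rewrite !indicE !memNset.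
Qed.

Lemma pmass_null A : measurable A -> lebesgue_measure A = 0%E -> pmass A = 0.
Proof.
move=> mA A0; rewrite (@pmass_eq A set0)//.
- rewrite /pmass /draw (eq_integral (cst 0%E)) ?integral0// => x _.
  by rewrite indicE in_set0 mule0.
- by rewrite setD0.
- by rewrite set0D; exact: measure0.
Qed.

Lemma mass_pmass (J : interval R) : [set` J] `<=` I01 -> mass p J = pmass [set` J].
Proof.
move=> JI; rewrite /mass /Rintegral /pmass /draw; congr fine.
rewrite [RHS](_ : _ = \int[lebesgue_measure]_(x in I01) ((EFin \o p) \_ [set` J]) x)%E.
  by rewrite -integral_mkcondr setIidr.
apply: eq_integral => x _; rewrite /patch indicE.
by case: ifP => _; rewrite ?mule1 ?mule0.
Qed.

(** Absolute continuity of the integral of [p], extended by 0 outside the unit interval. *)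
Lemma pmass_small (e : R) : 0 < e -> exists2 d : R, 0 < d & forall A, measurable A ->
  (lebesgue_measure A < d%:E)%E -> pmass A <= e.
Proof.
move=> e0; pose f : R -> R := p \_ I01.
have fE : EFin \o f = ((EFin \o p) \_ I01)%E.
  by apply/funext => x; rewrite /f /patch /=; case: ifP.
have intf : lebesgue_measure.-integrable setT (EFin \o f).
  rewrite fE; apply: (iffLR (integrable_mkcond _ _)) => //.
  apply/integrableP; split=> //.
  apply: le_lt_trans (ltry 1%R); case: dp => _ _ <-.
  rewrite le_eqVlt; apply/orP; left; apply/eqP/eq_integral => x; rewrite inE => Dx.
  by rewrite gee0_abs//; exact: p0E.
have [d [d0 H]] := integral_normr_continuous intf e0.
exists d => // A mA Ad; apply: le_trans (ltW (H A mA Ad)).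
rewrite /pmass /draw /Rintegral; rewrite le_eqVlt; apply/orP; left; apply/eqP; congr fine.
rewrite [RHS]integral_mkcond [LHS]integral_mkcond; apply: eq_integral => x _.
rewrite /f /patch indicE; case: ifPn => xI; case: ifPn => xA; rewrite ?mule1 ?mule0 ?normr0//.
by rewrite ger0_norm// p0//; rewrite inE in xI.
Qed.

End DensityMass.

(** * Poisson samples as random sets of cells *)

Lemma sum_setU1 (R : nmodType) (M n : nat) (g : {set 'I_M} -> R) :
  \sum_(a : 'I_M) \sum_(D : {set 'I_M} | #|D| == n) (if a \in D then 0 else g (a |: D)%SET)
  = (\sum_(D : {set 'I_M} | #|D| == n.+1) g D) *+ n.+1.
Proof.
rewrite -sumrMnl.
(* Double counting of the pairs of a set and one of its elements. *)
transitivity (\sum_(D : {set 'I_M} | #|D| == n.+1) \sum_(a in D) g D); last first.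
  by apply: eq_bigr => D /eqP cD; rewrite sumr_const cD.
rewrite [RHS](exchange_big_dep xpredT)//=; apply: eq_bigr => a _.
rewrite (bigID (fun D : {set 'I_M} => a \in D))/= big1 ?add0r; last first.
  by move=> D /andP[_ ->].
rewrite [RHS](reindex_onto (fun D => a |: D)%SET (fun D => D :\ a)%SET)/=; last first.
  by move=> D /andP[_ aD]; rewrite finset.setD1K.
apply: eq_big => [D|D /andP[_ /negbTE ->]//].
rewrite !inE eqxx /= andbT cardsU1; case: (boolP (a \in D)) => aD.
  rewrite andbF; apply/esym/negbTE; rewrite negb_and; apply/orP; right.
  by apply/eqP => /finset.setP/(_ a); rewrite !inE eqxx aD.
by rewrite andbT add1n eqSS finset.setU1K// eqxx andbT.
Qed.

Section SampleSets.
Variables (R : realType) (M : nat) (cell : R -> 'I_M) (G : set R).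
Variables (u : rand R R) (lam : 'I_M -> R).
Hypothesis lam0 : forall i, 0 <= lam i.

(* Only lower bounds by simple functions are available: the [f] that occur have
   not been proved measurable. *)
Definition dominates_cells : Prop := forall (f : R -> \bar R) (phi : 'I_M -> R),
  (forall x, 0 <= f x)%E -> (forall i, 0 <= phi i) ->
  (forall x, G x -> ((phi (cell x))%:E <= f x)%E) ->
  ((\sum_i lam i * phi i)%:E <= u f)%E.

Hypothesis low : dominates_cells.

Lemma iid_ge0 n f : (forall s, 0 <= f s)%E -> (0 <= iid n u f)%E.
Proof.
elim: n f => [|n IH] f f0 /=; first exact: f0.
have := @low (fun x => iid n u (fun s => f (x :: s))) (fun=> 0).
rewrite big1 => [|i _]; last by rewrite mulr0.
by apply=> // x; [apply: IH => s|move=> _; apply: IH => s].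
Qed.

(** The cells of [D] can be hit in [n!] orders. Outcomes with two draws in one cell are dropped,
    whence a lower bound only. *)
Lemma iid_sets n (f : seq R -> \bar R) (phi : {set 'I_M} -> R) :
  (forall s, 0 <= f s)%E -> (forall D, 0 <= phi D) ->
  (forall X : seq R, (forall x, x \in X -> G x) -> uniq (map cell X) ->
     ((phi [set i in map cell X]%SET)%:E <= f X)%E) ->
  ((n`!%:R * \sum_(D : {set 'I_M} | #|D| == n) (\prod_(i in D) lam i) * phi D)%:E
     <= iid n u f)%E.
Proof.
elim: n f phi => [|n IH] f phi f0 phi0 H.
  rewrite /= fact0 mul1r (big_pred1 finset.set0) => [|D]; last by rewrite cards_eq0.
  rewrite big_set0 mul1r; apply: (le_trans _ (H [::] _ _)) => //.
pose psi (a : 'I_M) (D : {set 'I_M}) := if a \in D then 0 else phi (a |: D)%SET.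
pose phi' (a : 'I_M) := n`!%:R * \sum_(D : {set 'I_M} | #|D| == n) (\prod_(i in D) lam i) * psi a D.
have psi0 a D : 0 <= psi a D by rewrite /psi; case: ifP.
have lamp0 (D : {set 'I_M}) : 0 <= \prod_(i in D) lam i by apply: prodr_ge0.
apply: (le_trans _ (low (f := fun x => iid n u (fun s => f (x :: s))) (phi := phi') _ _ _)).
- rewrite lee_fin le_eqVlt; apply/orP; left; apply/eqP.
  transitivity (n`!%:R * \sum_a \sum_(D : {set 'I_M} | #|D| == n)
     (if a \in D then 0 else (\prod_(i in (a |: D)%SET) lam i) * phi (a |: D)%SET)).
    rewrite (sum_setU1 n (fun D => (\prod_(i in D) lam i) * phi D)) factS natrM.
    by rewrite -[in RHS]mulr_natl; ring.
  rewrite mulr_sumr; apply: eq_bigr => a _; rewrite /phi' mulrCA; congr (_ * _).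
  rewrite mulr_sumr; apply: eq_bigr => D _; rewrite /psi.
  case: (boolP (a \in D)) => aD; first by rewrite !mulr0.
  by rewrite big_setU1//= mulrA.
- by move=> x; apply: iid_ge0 => s.
- by move=> a; rewrite mulr_ge0// sumr_ge0// => D _; rewrite mulr_ge0.
move=> x Gx; apply: IH => // X GX uX; rewrite /psi.
case: ifPn => [_|]; first exact: f0.
rewrite inE => cX; apply: (le_trans _ (H (x :: X) _ _)).
- rewrite lee_fin le_eqVlt; apply/orP; left; apply/eqP; congr phi.
  by apply/finset.setP => i; rewrite !inE.
- by move=> z; rewrite inE => /predU1P[->|/GX].
- by rewrite /= cX.
Qed.

(** The Poisson weights cancel the [n!], leaving a product over the occupied cells: this is the
    independence of the cells. *)
Lemma poi_iid_sets m (f : seq R -> \bar R) (phi : {set 'I_M} -> R) : 0 < m ->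
  (forall s, 0 <= f s)%E -> (forall D, 0 <= phi D) ->
  (forall X : seq R, (forall x, x \in X -> G x) -> uniq (map cell X) ->
     ((phi [set i in map cell X]%SET)%:E <= f X)%E) ->
  ((expR (- m) * \sum_(D : {set 'I_M}) (\prod_(i in D) (m * lam i)) * phi D)%:E
     <= poi_iid m u f)%E.
Proof.
move=> m0 f0 phi0 H; rewrite /poi_iid /rbind /poi.
have pos n : (0 <= (poisson_pmf m n)%:E * iid n u f)%E.
  by rewrite mule_ge0 ?lee_fin ?poisson_pmf_ge0// iid_ge0.
(* A set of cells has at most [M] elements, so the first [M.+1] terms carry the whole sum over
   [D]. *)
apply: (le_trans _ (nneseries_lim_ge M.+1 _)) => //.
rewrite big_mkord mulr_sumr.
rewrite (partition_big (fun D : {set 'I_M} => inord #|D| : 'I_M.+1) xpredT)//=.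
rewrite -sumEFin; apply: lee_sum => n _.
apply: (le_trans _ (lee_wpmul2l _ (iid_sets n f0 phi0 H))); last first.
  by rewrite lee_fin poisson_pmf_ge0.
rewrite -EFinM lee_fin /poisson_pmf m0 le_eqVlt; apply/orP; left; apply/eqP.
rewrite !mulr_sumr; apply: eq_big => [D|D /eqP cD].
  by rewrite -val_eqE /= inordK// ltnS -[leqRHS](card_ord M) max_card.
have {}cD : #|D| = n.
  by rewrite -cD inordK// ltnS -[leqRHS](card_ord M) max_card.
rewrite big_split /= prodr_const cD; field.
by rewrite pnatr_eq0 -lt0n fact_gt0.
Qed.

End SampleSets.

(** * From sets of cells to product laws *)

Section SubsetSums.
Variables (R : realFieldType) (M : nat).

(** The unnormalised form of [wlaw], for [w i = m * mu i]. *)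
Definition bitlaw (w : nat -> R) (i : nat) (b : bool) : R := if b then w i else 1.

Lemma sum_subsets (w : nat -> R) (Phi : bitseq -> R) :
  \sum_(D : {set 'I_M}) (\prod_(i in D) w i) * Phi [seq i \in D | i <- enum 'I_M]
  = pexp (bitlaw w) 0 M Phi.
Proof.
have H (s : seq 'I_M) i n Psi : map val s = iota i n ->
    \sum_(D : {set 'I_M} | D \subset [set x in s]%SET)
      (\prod_(i in D) w i) * Psi [seq x \in D | x <- s] = pexp (bitlaw w) i n Psi.
  elim: s i n Psi => [|x s IH] i [|n] Psi //= E.
    rewrite (big_pred1 finset.set0) => [|D]; last first.
      have -> : [set x in ([::] : seq 'I_M)]%SET = finset.set0.
        by apply/finset.setP => z; rewrite !inE.
      by rewrite finset.subset0.
    by rewrite big_set0 mul1r.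
  case: E => xi E.
  have xs : x \notin s.
    apply/negP => /(map_f val); rewrite E mem_iota /= xi.
    by rewrite ltnn.
  rewrite big_bool /= [RHS]addrC -!(IH _ _ _ E) /bitlaw mul1r mulr_sumr.
  rewrite (bigID (fun D : {set 'I_M} => x \in D))/= addrC; congr (_ + _).
    apply: eq_big => [D|D /andP[_ /negbTE ->]//].
    apply/andP/idP => [[/fintype.subsetP sD xD]|/fintype.subsetP sD].
      apply/fintype.subsetP => z zD; have := sD z zD; rewrite !inE => /predU1P[zx|//].
      by rewrite -zx zD in xD.
    split; first by apply/fintype.subsetP => z /sD; rewrite !inE => ->; rewrite orbT.
    by apply/negP => /sD; rewrite inE (negbTE xs).
  rewrite (reindex_onto (fun D => x |: D)%SET (fun D => D :\ x)%SET)/=; last first.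
    by move=> D /andP[_ aD]; rewrite finset.setD1K.
  apply: eq_big => [D|D sD].
    rewrite !inE eqxx /= andbT; apply/andP/idP => [[/fintype.subsetP sD /eqP DE]|/fintype.subsetP sD].
      apply/fintype.subsetP => z; rewrite -DE !inE => /andP[zx /orP[/eqP zx'|zD]].
        by rewrite zx' eqxx in zx.
      by have := sD z; rewrite !inE zD orbT (negbTE zx) => /(_ isT).
    have xD : x \notin D by apply/negP => /sD; rewrite inE (negbTE xs).
    rewrite finset.setU1K//; split=> //; apply/fintype.subsetP => z; rewrite !inE.
    by case/predU1P => [->|/sD]; rewrite ?eqxx// inE => ->; rewrite orbT.
  have xD : x \notin D.
    move: sD => /andP[_ /eqP DE]; rewrite -DE !inE eqxx//.
  rewrite big_setU1//= xi mulrA; congr (_ * Psi (_ :: _)).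
    by rewrite !inE eqxx.
  apply/eq_in_map => z zs; rewrite !inE; case: eqP => // zx.
  by rewrite zx (negbTE xs) in zs.
rewrite -(H (enum 'I_M)) ?val_enum_ord//; apply: eq_bigl => D.
by apply/esym/fintype.subsetP => z _; rewrite inE mem_enum.
Qed.

Definition symlaw (a b : nat -> R) (i : nat) (o : option bool) : R :=
  match o with None => 1 | Some true => a i | Some false => b i end.

Definition is_sym (c : bool) (o : option bool) := o == Some c.

(** Of the four pairs of bits in a cell, the one with both bits set is dropped, its weight being
    nonnegative; the other three are the symbols of [symlaw]. *)
Lemma pexp_pair (a b : nat -> R) i n (Psi : bitseq -> bitseq -> R) :
  (forall i, 0 <= a i) -> (forall i, 0 <= b i) -> (forall t t', 0 <= Psi t t') ->
  pexp (symlaw a b) i n (fun s => Psi (map (is_sym true) s) (map (is_sym false) s))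
  <= pexp (bitlaw a) i n (fun t => pexp (bitlaw b) i n (Psi t)).
Proof.
move=> a0 b0; elim: n i Psi => [|n IH] i Psi Psi0 //=.
rewrite sum_option_bool big_bool /=.
have E c : pexp (bitlaw a) i.+1 n
     (fun t => \sum_d bitlaw b i d * pexp (bitlaw b) i.+1 n (fun t0 => Psi (c :: t) (d :: t0)))
  = b i * pexp (bitlaw a) i.+1 n (fun t => pexp (bitlaw b) i.+1 n (fun t' => Psi (c :: t) (true :: t')))
  + pexp (bitlaw a) i.+1 n (fun t => pexp (bitlaw b) i.+1 n (fun t' => Psi (c :: t) (false :: t'))).
  rewrite -pexpZ -pexpD; apply: eq_pexp => t _.
  by rewrite big_bool /= mul1r.
rewrite !E !mul1r /bitlaw.
have IHc c d := IH i.+1 (fun t t' => Psi (c :: t) (d :: t')) ltac:(by move=> *; apply: Psi0).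
have tt : 0 <= a i * (b i * pexp (bitlaw a) i.+1 n
    (fun t => pexp (bitlaw b) i.+1 n (fun t' => Psi (true :: t) (true :: t')))).
  rewrite !mulr_ge0//; apply: pexp_ge0 => [? []|? _]; rewrite /bitlaw//.
  by apply: pexp_ge0 => [? []|? _].
have h1 := ler_wpM2l (a0 i) (IHc true false).
have h2 := ler_wpM2l (b0 i) (IHc false true).
have h0 := IHc false false.
rewrite mulrDr; move: tt h0 h1 h2; rewrite /bitlaw; lra.
Qed.

End SubsetSums.

(** The right side is the probability that independent Poisson counts with means [x i] are all at
    most 1. One cell gives at least [(1 - x) * (1 + x)], and the losses [x^2] add up. *)
Lemma prod_exp_ge (R : realType) (M : nat) (x : nat -> R) :
  (forall i, 0 <= x i <= 1) ->
  1 - \sum_(0 <= i < M) x i ^+ 2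
    <= expR (- \sum_(0 <= i < M) x i) * \prod_(0 <= i < M) (1 + x i).
Proof.
move=> x01; elim: M => [|M IH]; first by rewrite !big_geq// oppr0 expR0 addr0 mulr1.
rewrite !big_nat_recr//= [- (\sum_(0 <= i < M) x i + _)]opprD expRD.
have /andP[x0 x1] := x01 M.
set E := expR _ in IH *; set P := \prod_(_ <= i < _) _ in IH *.
have EP : 0 <= E * P.
  rewrite mulr_ge0 ?expR_ge0// prodr_ge0// => i _.
  by have /andP[? _] := x01 i; rewrite addr_ge0.
have h : 1 - x M ^+ 2 <= expR (- x M) * (1 + x M).
  rewrite (_ : 1 - x M ^+ 2 = (1 - x M) * (1 + x M)); last by ring.
  by rewrite ler_wpM2r ?addr_ge0// expR_ge1Dx.
have S0 : 0 <= \sum_(0 <= i < M) x i ^+ 2 by rewrite sumr_ge0// => i _; exact: sqr_ge0.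
rewrite (_ : E * expR (- x M) * (P * (1 + x M)) = (E * P) * (expR (- x M) * (1 + x M))); last by ring.
set S := \sum_(_ <= i < _) _ in IH S0 *.
have sq : 0 <= 1 - x M ^+ 2 by rewrite subr_ge0 expr_le1.
apply: le_trans (ler_wpM2l EP h); apply: le_trans (ler_wpM2r sq IH).
have := mulr_ge0 S0 (sqr_ge0 (x M)); lra.
Qed.

(** * Sorted samples read cell by cell *)

Section ZstatRun.
Variable R : realType.

(** The initial sign 0 silences the first sample, which has no predecessor. *)
Lemma ZstatE (S : seq (R * bool)) :
  (Zstat S)%:~R = Zrun 0 (map (fun a => Some a.2) S) :> R.
Proof.
have H (a : R * bool) S' : (\sum_(ab <- zip (a :: S') S') (if ab.1.2 == ab.2.2 then 1 else -1) : int)%:~R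
    = Zrun (sg R a.2) (map (fun a => Some a.2) S') :> R.
  elim: S' a => [|b S' IH] a /=; first by rewrite big_nil.
  rewrite big_cons rmorphD /= IH; congr (_ + _).
  by case: a b => [? []] [? []]; rewrite /= /sg ?mulr1 ?mul1r ?mulrN1 ?opprK ?mulrN1z.
case: S => [|a S]; first by rewrite /Zstat big_nil.
by rewrite /Zstat /= H mul0r add0r.
Qed.

Lemma Zrun_pmap (I : Type) (L : R) (h : I -> option bool) (s : seq I) :
  Zrun L (map h s) = Zrun L (map Some (pmap h s)).
Proof.
elim: s L => [|i s IH] L //=.
by case: (h i) => [b|] /=; rewrite IH.
Qed.

Variables (M : nat) (cell : R -> 'I_M).
Hypothesis cell_mono : forall x y, x <= y -> (cell x <= cell y)%N.

Definition cell_sym (X Y : seq R) (i : 'I_M) : option bool :=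
  if i \in map cell X then Some true
  else if i \in map cell Y then Some false else None.

(** Samples in distinct cells are ordered as their cells; there are no ties, and every shuffle sorts
    to the same labels. *)
Lemma Zstat_sort (X Y : seq R) (s : seq (R * bool)) :
  uniq (map cell (X ++ Y)) ->
  perm_eq s ([seq (x, true) | x <- X] ++ [seq (y, false) | y <- Y]) ->
  (Zstat (sort (fun a b : R * bool => a.1 <= b.1) s))%:~R
    = Zrun 0 (map (cell_sym X Y) (enum 'I_M)) :> R.
Proof.
move=> uXY sXY.
set le := fun a b : R * bool => a.1 <= b.1.
set S := sort le s.
have pS : perm_eq S ([seq (x, true) | x <- X] ++ [seq (y, false) | y <- Y]).
  by rewrite /S (permPl (permEl (perm_sort _ _))).
have sS : sorted le S.
  by apply: sort_sorted => a b; exact: le_total.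
pose c (a : R * bool) := cell a.1.
have pc : perm_eq (map c S) (map cell (X ++ Y)).
  apply: perm_trans (perm_map c pS) _; rewrite !map_cat -!map_comp.
  by rewrite (eq_map (g := cell))// (eq_map (g := cell)).
have uc : uniq (map c S) by rewrite (perm_uniq pc).
have cE : map c S = [seq i <- enum 'I_M | i \in map cell (X ++ Y)].
  apply: (@irr_sorted_eq _ (fun i j : 'I_M => (i < j)%N)).
  - by move=> j i k; exact: ltn_trans.
  - by move=> i; rewrite ltnn.
  - have : sorted ltn (map val (map c S)).
      rewrite ltn_sorted_uniq_leq (map_inj_uniq val_inj) uc /= !sorted_map.
      by apply: sub_sorted sS => a b /= /cell_mono.
    by rewrite sorted_map.
  - apply: sorted_filter; first by move=> j i k; exact: ltn_trans.
    by have := iota_ltn_sorted 0 M; rewrite -val_enum_ord sorted_map.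
  by move=> i; rewrite mem_filter mem_enum andbT (perm_mem pc).
rewrite ZstatE [RHS]Zrun_pmap.
have -> : [seq Some a.2 | a <- S] = map Some (map snd S) by rewrite -map_comp.
congr (Zrun 0 (map Some _)).
have -> : map snd S = map (fun i => i \in map cell X) (map c S).
  rewrite -map_comp; apply/eq_in_map => a; rewrite (perm_mem pS) mem_cat.
  case/orP => /mapP[x xX ->] /=; first by apply/esym; exact: map_f.
  apply/esym/negbTE/negP => xcX; move: uXY; rewrite map_cat cat_uniq.
  by case/and3P => _ /hasPn/(_ _ (map_f cell xX))/negP + _; apply.
have hE i : (i \in map cell (X ++ Y)) = (i \in map cell X) || (i \in map cell Y).
  by rewrite map_cat mem_cat.
rewrite cE; elim: (enum 'I_M) => [|i e IH] //=.
rewrite -IH {1}/cell_sym hE.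
by case iX : (i \in map cell X); case: (i \in map cell Y) => //=; rewrite iX.
Qed.

End ZstatRun.

Lemma merge_samples_ge (R : realType) (X Y : seq R) (f : seq (R * bool) -> \bar R) (v : \bar R) :
  (0 <= v)%E ->
  (forall s, perm_eq s ([seq (x, true) | x <- X] ++ [seq (y, false) | y <- Y]) ->
    (v <= f (sort (fun a b : R * bool => (a.1 <= b.1)%R) s))%E) ->
  (v <= merge_samples X Y f)%E.
Proof.
move=> v0 H; rewrite /merge_samples /rbind /shuffle /rbind /rret /finite_law.
set L := _ ++ _ in H *.
have w : (\sum_(pi : 'S_(size L)) ((size L)`!%:R^-1)%:E * v)%E = v.
  rewrite -ge0_sume_distrl => [|pi _]; last by rewrite lee_fin.
  by rewrite sumEFin sumr_const card_Sn -[X in (X%:E * _)%E]mulr_natl mulfV ?mul1e//.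
rewrite -[leLHS]w; apply: lee_sum => pi _.
rewrite lee_wpmul2l ?lee_fin//; apply: H.
suff : perm_eq [seq tnth (in_tuple L) (pi i) | i <- enum 'I_(size L)] (in_tuple L) by [].
by apply/tuple_permP; exists pi.
Qed.

(** * Lower bounds for the sampling functionals *)

Section Transfer.
Variables (R : realType) (M : nat) (cell : R -> 'I_M) (G : set R).
Variables (u v : rand R R) (p q : nat -> R) (m : R).
Hypotheses (m0 : 0 < m).
Hypotheses (p0 : forall i, 0 <= p i) (q0 : forall i, 0 <= q i).
Hypothesis lowu : dominates_cells cell G u p.
Hypothesis lowv : dominates_cells cell G v q.

Definition cell_bits (X : seq R) : bitseq := [seq i \in map cell X | i <- enum 'I_M].

Lemma poi_iid_bits (P : pred bitseq) (k : R) (f : seq R -> \bar R) :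
  0 <= k -> (forall s, 0 <= f s)%E ->
  (forall X, (forall x, x \in X -> G x) -> uniq (map cell X) -> P (cell_bits X) ->
     (k%:E <= f X)%E) ->
  ((expR (- m) * (k * pexp (bitlaw (fun i => m * p i)) 0 M (fun t => (P t)%:R)))%:E
    <= poi_iid m u f)%E.
Proof.
move=> k0 f0 H.
have := @poi_iid_sets R M cell G u p p0 lowu m f
  (fun D => k * (P [seq i \in D | i <- enum 'I_M])%:R) m0 f0.
move=> /(_ (fun D => mulr_ge0 k0 (ler0n _ _))) H1.
have {}H1 := H1 _.
apply: le_trans (H1 _); last first.
  move=> X GX uX.
  have -> : [seq i \in [set i in map cell X]%SET | i <- enum 'I_M] = cell_bits X.
    by apply: eq_map => i; rewrite inE.
  case: (boolP (P _)) => PX; last by rewrite mulr0 f0.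
  by rewrite mulr1; apply: H.
rewrite lee_fin ler_wpM2l ?expR_ge0// -pexpZ.
by rewrite -(sum_subsets M (fun i => m * p i)).
Qed.

Lemma poi_iid_pair (P : pred R) (k : R) (f : seq R -> seq R -> \bar R) :
  0 <= k -> (forall s s', 0 <= f s s')%E ->
  (forall X Y, uniq (map cell (X ++ Y)) -> P (Zrun 0 (map (cell_sym cell X Y) (enum 'I_M))) ->
     (k%:E <= f X Y)%E) ->
  ((expR (- (2 * m)) * (k * pexp (symlaw (fun i => m * p i) (fun i => m * q i)) 0 M
        (fun t => (P (Zrun 0 t))%:R)))%:E
    <= poi_iid m u (fun X => poi_iid m v (f X)))%E.
Proof.
move=> k0 f0 H.
pose sym2 (t t' : bitseq) := [seq (if ab.1 then Some true else if ab.2 then Some false else None) | ab <- zip t t'].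
(* The first condition keeps the samples of the two sources in different cells. *)
pose Psi (t t' : bitseq) : R :=
  (all (fun ab => ~~ (ab.1 && ab.2)) (zip t t') && P (Zrun 0 (sym2 t t')))%:R.
pose bits (D : {set 'I_M}) := [seq i \in D | i <- enum 'I_M].
have Psi0 t t' : 0 <= Psi t t' by rewrite /Psi.
have low2 X : (forall x, x \in X -> G x) -> uniq (map cell X) ->
   ((expR (- m) * (k * pexp (bitlaw (fun i => m * q i)) 0 M (Psi (cell_bits X))))%:E
     <= poi_iid m v (f X))%E.
  move=> GX uX.
  have H1 := @poi_iid_sets R M cell G v q q0 lowv m (f X)
    (fun D => k * Psi (cell_bits X) (bits D)) m0 (f0 X)
    (fun D => mulr_ge0 k0 (Psi0 _ _)).
  apply: le_trans (H1 _); last first.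
    move=> Y GY uY.
    have -> : bits [set i in map cell Y]%SET = cell_bits Y.
      by apply: eq_map => i; rewrite inE.
    rewrite /Psi; case: (boolP (_ && _)) => [/andP[dXY PXY]|_]; last by rewrite mulr0 f0.
    rewrite mulr1; apply: H.
      rewrite map_cat cat_uniq uX uY /= andbT; apply/hasPn => _ /mapP[y yY ->].
      apply/negP => yX; move/allP: dXY => /(_ (true, true)) /=.
      suff -> : (true, true) \in zip (cell_bits X) (cell_bits Y) by move=> /(_ isT).
      rewrite /cell_bits zip_map; apply/mapP; exists (cell y); first by rewrite mem_enum.
      by rewrite yX map_f.
    move: PXY; rewrite /sym2 /cell_bits zip_map -map_comp.
    by congr (is_true (P (Zrun 0 _))); apply: eq_map => i /=.
  rewrite lee_fin ler_wpM2l ?expR_ge0// -pexpZ.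
  by rewrite -(sum_subsets M (fun i => m * q i)).
have H1 := @poi_iid_sets R M cell G u p p0 lowu m (fun X => poi_iid m v (f X))
  (fun D => expR (- m) * (k * pexp (bitlaw (fun i => m * q i)) 0 M (Psi (bits D)))) m0.
apply: le_trans (H1 _ _ _); last 3 first.
- move=> X; apply: le_trans (_ : _ <= (expR (- m) * \sum_(D : {set 'I_M})
    (\prod_(i in D) (m * q i)) * 0)%:E)%E _.
    by rewrite big1 ?mulr0// => D _; rewrite mulr0.
  by apply: (@poi_iid_sets R M cell G v q q0 lowv m (f X) (fun=> 0)).
- move=> D; rewrite !mulr_ge0 ?expR_ge0//; apply: pexp_ge0 => [i [|]|t _]//=.
  by rewrite mulr_ge0// ltW.
- move=> X GX uX.
  have -> : bits [set i in map cell X]%SET = cell_bits X.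
    by apply: eq_map => i; rewrite inE.
  exact: low2.
rewrite lee_fin.
have -> : expR (- m) * (\sum_(D : {set 'I_M}) (\prod_(i in D) (m * p i)) *
    (expR (- m) * (k * pexp (bitlaw (fun i => m * q i)) 0 M (Psi (bits D)))))
  = expR (- (2 * m)) * (k * pexp (bitlaw (fun i => m * p i)) 0 M (fun t =>
      pexp (bitlaw (fun i => m * q i)) 0 M (Psi t))).
  rewrite -(sum_subsets M (fun i => m * p i)).
  rewrite (_ : - (2 * m) = - m - m); last by ring.
  rewrite expRD !mulr_sumr; apply: eq_bigr => D _; rewrite /bits; ring.
rewrite ler_wpM2l ?expR_ge0// ler_wpM2l//.
apply: le_trans (pexp_pair 0 M _ _ Psi0); last 2 first.
- by move=> i; rewrite mulr_ge0// ltW.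
- by move=> i; rewrite mulr_ge0// ltW.
rewrite le_eqVlt; apply/orP; left; apply/eqP; apply: eq_pexp => s _.
rewrite /Psi /sym2 zip_map all_map -map_comp.
rewrite (eq_all (a2 := predT)) ?all_predT; last by case=> [[]|].
congr (P (Zrun 0 _))%:R; rewrite -[LHS]map_id; apply: eq_map => -[[]|] //.
Qed.

End Transfer.

Lemma dist01 (R : realFieldType) (u v : R) : 0 <= u <= 1 -> 0 <= v <= 1 -> `|u - v| <= 1.
Proof. by move=> /andP[? ?] /andP[? ?]; rewrite ler_norml; lra. Qed.

(** * Buckets, null sets and domination by cells *)

Section Bucket.
Variable R : realType.
Implicit Types (W : seq R) (x y : R).

Lemma val_bucket W x : bucket W x = count (fun w => w <= x) W :> nat.
Proof. by rewrite /bucket inordK// ltnS count_size. Qed.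

Lemma bucket_mono W x y : x <= y -> (bucket W x <= bucket W y)%N.
Proof. by move=> xy; rewrite !val_bucket; apply: sub_count => w /le_trans; apply. Qed.

Lemma measurable_bucket W i : measurable (bucket W @^-1` [set i]).
Proof.
have H k : measurable [set x | count (fun w => w <= x) W = k].
  elim: W k {i} => [|w W IH] k.
    have [->|k0] := eqVneq k 0%N; first by rewrite (_ : mkset _ = setT)//; apply/seteqP.
    rewrite (_ : mkset _ = set0)//; apply/seteqP; split=> // x /= /esym k0'.
    by rewrite k0' eqxx in k0.
  rewrite (_ : mkset _ =
     ([set` `[w, +oo[] `&` [set x | (count (fun w => (w <= x)%R) W).+1 = k]) `|`
     ([set` `]-oo, w[] `&` [set x | count (fun w => (w <= x)%R) W = k])).
    apply: measurableU; apply: measurableI => //.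
    case: k => [|k]; last first.
      rewrite (_ : mkset _ = [set x | count (fun w => w <= x) W = k])//.
      by apply/seteqP; split=> x /= => [[]|->].
    by rewrite (_ : mkset _ = set0)//; apply/seteqP; split.
  apply/seteqP; split=> x /=; rewrite !in_itv/= ?andbT.
    by case: leP => /= wx; rewrite ?add1n ?add0n => e; [left|right].
  by case: leP => /= wx; rewrite ?add1n ?add0n; case=> -[].
rewrite (_ : _ @^-1` _ = [set x | count (fun w => w <= x) W = i])//.
apply/seteqP; split=> x /=; first by move=> <-; rewrite val_bucket.
by move=> e; apply: val_inj => /=; rewrite val_bucket.
Qed.

End Bucket.

Section Domination.
Variables (R : realType) (n : nat) (cell : R -> 'I_n) (N : set R).
Hypothesis mcell : forall i, measurable (cell @^-1` [set i]).
Hypotheses (mN : measurable N) (N0 : lebesgue_measure N = 0%E).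

Lemma draw_dominates p : density p ->
  dominates_cells cell (`[0, 1] `\` N) (draw p) (fun i => pmass p (cell @^-1` [set i])).
Proof.
move=> dp f phi f0 phi0 H.
have mA i : measurable (cell @^-1` [set i] `\` N) by apply: measurableD.
have D := draw_simple dp mA (fun i => (phi0 i : (0 <= (phi i)%:E)%E)).
have -> : ((\sum_i pmass p (cell @^-1` [set i]) * phi i)%:E =
    \sum_i (pmass p (cell @^-1` [set i] `\` N))%:E * (phi i)%:E)%E.
  rewrite -sumEFin; apply: eq_bigr => i _; rewrite -EFinM; congr (_ * _)%:E.
  apply: (pmass_eq dp (mcell i) (mA i)).
    rewrite setDD; apply/eqP; rewrite eq_le measure_ge0 andbT -N0.
    by apply: le_measure; rewrite ?inE; [exact: measurableI (mcell i) mN|exact: mN|exact: subIsetr].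
  by rewrite (_ : _ `\` _ = set0) ?measure0//; apply/seteqP; split=> x //= [[]].
rewrite -D; apply: le_draw => // x.
  by apply: sume_ge0 => i _; rewrite mule_ge0// lee_fin.
move=> Ix; rewrite (bigD1 (cell x))//= big1 => [|i ix]; last first.
  rewrite indicE memNset ?mule0// => -[/= e _].
  by rewrite e eqxx in ix.
rewrite adde0 indicE; have [xN|xN] := pselect (N x).
  by rewrite memNset ?mule0// => -[].
by rewrite mem_set ?mule1; [apply: H|].
Qed.

Lemma mixture_dominates G (u v : rand R R) lam lam' :
  dominates_cells cell G u lam -> dominates_cells cell G v lam' ->
  dominates_cells cell G (mixture u v) (fun i => (lam i + lam' i) / 2).
Proof.
move=> Hu Hv f phi f0 phi0 H; rewrite /mixture /rbind /coin /finite_law big_bool /=.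
rewrite /bernoulli_pmf.
have -> : \sum_i (lam i + lam' i) / 2 * phi i =
   2^-1 * (\sum_i lam i * phi i) + (1 - 2^-1) * (\sum_i lam' i * phi i).
  by rewrite !mulr_sumr -big_split /=; apply: eq_bigr => i _; field.
rewrite EFinD !EFinM; apply: leeD; rewrite lee_wpmul2l ?lee_fin//.
- exact: Hu.
- by rewrite subr_ge0 invf_le1 ?ler1n.
- exact: Hv.
Qed.

End Domination.

(** * Reduced distributions: norm and distance *)

Section Reduced.
Variables (R : realType) (T W : seq R).
Let M := (size T).+1.
Let N := (size W).+1.

(** Extended by 0 beyond the last cell, since the estimates on sequences assume their bounds at
    every index. *)
Definition cell_mass (p : R -> R) (i : nat) : R :=
  if (i < M)%N then pmass p (bucket T @^-1` [set inord i]) else 0.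

Lemma cell_massE p (i : 'I_M) : pmass p (bucket T @^-1` [set i]) = cell_mass p i.
Proof. by rewrite /cell_mass ltn_ord inord_val. Qed.

Lemma cell_mass_ge0 p i : density p -> 0 <= cell_mass p i.
Proof. by move=> dp; rewrite /cell_mass; case: ifP => // _; exact: pmass_ge0. Qed.

Lemma sum_cell_mass p : density p -> \sum_(0 <= i < M) cell_mass p i = 1.
Proof.
move=> dp; rewrite big_mkord -(pmassT dp) (pmass_split dp _ (@measurable_bucket R T))//.
by apply: eq_bigr => i _; rewrite setTI -cell_massE.
Qed.

Definition red_mass (p : R -> R) (b : 'I_N) : R := pmass p (bucket W @^-1` [set b]).

Lemma red_mass_distr p : density p -> distr (red_mass p).
Proof.
move=> dp; split=> [b|]; first exact: pmass_ge0.
rewrite -(pmassT dp) (pmass_split dp _ (@measurable_bucket R W))//.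
by apply: eq_bigr => i _; rewrite setTI.
Qed.

Definition sub_mass (p : R -> R) (i b : nat) : R :=
  if (i < M)%N && (b < N)%N then
    pmass p (bucket T @^-1` [set inord i] `&` bucket W @^-1` [set inord b]) else 0.

Lemma red_massE p (b : 'I_N) : density p ->
  red_mass p b = \sum_(0 <= i < M) sub_mass p i b.
Proof.
move=> dp; rewrite big_mkord /red_mass.
rewrite (pmass_split dp (measurable_bucket b) (@measurable_bucket R T)).
by apply: eq_bigr => i _; rewrite /sub_mass !ltn_ord /= !inord_val setIC.
Qed.

Hypothesis uW : uniq (map (bucket T) W).
Let t := cell_bits (bucket T) W.

Lemma size_cell_bits : size t = M.
Proof. by rewrite size_map size_enum_ord. Qed.

Lemma rnk_cell_bits j : rnk t j = count (fun w => (bucket T w < j)%N) W.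
Proof.
rewrite /rnk /t /cell_bits -map_take count_map -size_filter.
rewrite -(count_map (bucket T) (fun c : 'I_M => (c < j)%N)) -[RHS]size_filter.
apply/perm_size/uniq_perm; first by rewrite filter_uniq// take_uniq// enum_uniq.
  by rewrite filter_uniq.
move=> i; rewrite !mem_filter /= andbC; congr (_ && _).
rewrite -(mem_map val_inj) map_take val_enum_ord take_iota mem_iota add0n /=.
by rewrite leq_min ltn_ord andbT.
Qed.

(** Endpoints in earlier cells lie below [x], those in later cells above, and the cell of [x]
    contains at most one. *)
Lemma rnk_bucket x : (bucket W x == rnk t (bucket T x) :> nat) ||
  (bucket W x == rnk t (bucket T x).+1 :> nat).
Proof.
have h1 : (rnk t (bucket T x) <= bucket W x)%N.
  rewrite rnk_cell_bits [X in (_ <= X)%N]val_bucket; apply: sub_count => w /=.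
  by rewrite leNgt; apply: contraTN => /ltW/(bucket_mono T); rewrite leqNgt.
have h2 : (bucket W x <= rnk t (bucket T x).+1)%N.
  rewrite rnk_cell_bits [X in (X <= _)%N]val_bucket; apply: sub_count => w /=.
  by rewrite ltnS; exact: bucket_mono.
rewrite (rnkS size_cell_bits (ltn_ord _)) in h2 *.
move: h2; case: (nth false t (bucket T x)) => h2; last first.
  by rewrite eqn_leq h1 addn0 in h2 *; rewrite h2.
rewrite addn1 leq_eqVlt ltnS in h2 *.
by case/orP: h2 => [->|h2]; rewrite ?orbT// eqn_leq h1 h2.
Qed.

Lemma sub_mass_split p : density p ->
  cell_split M N t (sub_mass p) (cell_mass p).
Proof.
move=> dp; split.
- by move=> i b; rewrite /sub_mass; case: ifP => // _; exact: pmass_ge0.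
- move=> i iM; rewrite /cell_mass iM.
  rewrite (pmass_split dp (measurable_bucket _) (@measurable_bucket R W)).
  by apply: eq_bigr => b _; rewrite /sub_mass iM ltn_ord /= inord_val.
- move=> i b iM b1 b2; rewrite /sub_mass iM /=; case: ifP => // bN.
  rewrite (_ : _ `&` _ = set0).
    by apply: pmass_null => //; rewrite measure0.
  apply/seteqP; split=> // x /= [Tx Wx].
  have := rnk_bucket x; rewrite Tx Wx !inordK//.
  by rewrite (negbTE b1) (negbTE b2).
Qed.

(** The bound 1 on the sum of squares serves for small [m]. The 4 is the square of the factor 2 lost
    by comparing [p] with the average [(p + q) / 2]. *)
Lemma norm2_red_mass p q (r B : R) : density p -> density q -> 0 <= B -> 0 <= r ->
  Qrun (fun i => (cell_mass p i + cell_mass q i) / 2) 0 0 t <= r ->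
  N%:R * Num.min 1 (4 * r) <= B ^+ 2 ->
  norm2 (red_mass p) <= B / Num.sqrt N%:R.
Proof.
move=> dp dq B0 r0 Qr NB.
have [d0 d1] := red_mass_distr dp.
have s1 : \sum_b red_mass p b ^+ 2 <= 1.
  rewrite -d1; apply: ler_sum => b _; rewrite expr2 ler_piMr//.
  by rewrite -d1 (bigD1 b)//= lerDl sumr_ge0.
have s4 : \sum_b red_mass p b ^+ 2 <= 4 * r.
  pose c i b := (sub_mass p i b + sub_mass q i b) / 2.
  have sc : cell_split M N t c (fun i => (cell_mass p i + cell_mass q i) / 2).
    have [p0 ps pz] := sub_mass_split dp; have [q0 qs qz] := sub_mass_split dq.
    split.
    - by move=> i b; rewrite divr_ge0// addr_ge0.
    - by move=> i iM; rewrite -mulr_suml big_split /= ps// qs.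
    - by move=> i b iM b1 b2; rewrite /c pz// qz// addr0 mul0r.
  have := Qrun_buckets size_cell_bits sc => Qb.
  apply: le_trans (ler_wpM2l (ler0n _ 4) (le_trans Qb Qr)).
  rewrite mulr_sumr; apply: ler_sum => b _.
  have -> : \sum_(0 <= i < M) c i b = (red_mass p b + red_mass q b) / 2.
    by rewrite !red_massE// -big_split /= -mulr_suml.
  have q0 : 0 <= red_mass q b by apply: pmass_ge0.
  have := d0 b; nra.
rewrite /norm2 ler_pdivlMr ?sqrtr_gt0 ?ltr0n// -sqrtrM ?sumr_ge0//; last first.
  by move=> b _; exact: sqr_ge0.
rewrite -[leRHS]ger0_norm// -sqrtr_sqr ler_wsqrtr//.
by apply: le_trans NB; rewrite mulrC ler_wpM2l// le_min s1.
Qed.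

Variables (k : nat) (lo hi : 'I_k -> nat) (sig : 'I_k -> R).
Hypothesis lohi : forall j, (lo j <= hi j <= M)%N.
Hypothesis partM : forall i, (i < M)%N -> (\sum_j in_piece lo hi j i)%N = 1%N.
Hypothesis sig1 : forall j, `|sig j| <= 1.

Lemma rnk_bound j : (rnk t j < N)%N.
Proof. by rewrite rnk_cell_bits ltnS count_size. Qed.

Let I0 : interval 'I_N := `[ord0, ord0].
Let Ie : interval 'I_N := `]ord0, ord0].
Let Ij (j : 'I_k) : interval 'I_N := `]inord (rnk t (lo j)), inord (rnk t (hi j))].

Let mem_Ij j (b : 'I_N) : (b \in Ij j) = (rnk t (lo j) < b <= rnk t (hi j))%N.
Proof.
rewrite in_itv /=; rewrite ltEord leEord.
by rewrite !inordK ?rnk_bound.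
Qed.

(** Bucket 0 and one interval for each piece make [k + 1] intervals; the other [k] indices carry the
    empty interval [Ie]. *)
Let pieces (a : 'I_(2 * k + 1)) : interval 'I_N :=
  if (a == 0%N :> nat) then I0 else
  if insub a.-1 is Some j then Ij j else Ie.

(** A discrete intermediate value argument, which locates the cell of the [b]-th endpoint. *)
Lemma rnk_crossing a c b : (a <= c)%N -> (rnk t a < b <= rnk t c)%N ->
  exists2 i, (a <= i < c)%N & (rnk t i < b <= rnk t i.+1)%N.
Proof.
elim: c => [|c IH].
  by rewrite leqn0 => /eqP -> /andP[h1 h2]; have := leq_trans h1 h2; rewrite ltnn.
rewrite leq_eqVlt => /predU1P[->|ac] /andP[h1 h2].
  by have := leq_trans h1 h2; rewrite ltnn.
have [bc|cb] := leqP b (rnk t c).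
  have [|i /andP[ai ic] h] := IH ac; first by rewrite h1.
  by exists i => //; rewrite ai /= ltnS ltnW.
by rewrite ltnS in ac; exists c; [rewrite ac ltnSn|rewrite cb h2].
Qed.

Lemma rnk_crossing_uniq i j b : (rnk t i < b <= rnk t i.+1)%N ->
  (rnk t j < b <= rnk t j.+1)%N -> i = j.
Proof.
move=> /andP[i1 i2] /andP[j1 j2]; apply/eqP; rewrite eqn_leq; apply/andP; split.
  rewrite leqNgt; apply/negP => /(leq_rnk t) ji.
  by have := leq_ltn_trans (leq_trans j2 ji) i1; rewrite ltnn.
rewrite leqNgt; apply/negP => /(leq_rnk t) ij.
by have := leq_ltn_trans (leq_trans i2 ij) j1; rewrite ltnn.
Qed.

Let pieceS_lt (j : 'I_k) : (j.+1 < 2 * k + 1)%N.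
Proof. by rewrite addn1 ltnS mul2n -addnn (leq_trans (ltn_ord j))// leq_addr. Qed.

Let pieceS (j : 'I_k) : 'I_(2 * k + 1) := Ordinal (pieceS_lt j).

Let pieceSE j : pieceS j = j.+1 :> nat. Proof. by []. Qed.

Let pieces_S j : pieces (pieceS j) = Ij j.
Proof. by rewrite /pieces pieceSE /= insubT//= => lt; congr Ij; apply: val_inj. Qed.

Let pieces_cases (a : 'I_(2 * k + 1)) (b : 'I_N) : b \in pieces a ->
  (a = 0%N :> nat /\ b = 0%N :> nat) \/ exists2 j, a = pieceS j & b \in Ij j.
Proof.
rewrite /pieces; case: eqP => [a0|/eqP a0].
  move=> bI; left; split=> //; apply/eqP; rewrite -leqn0; move: bI.
  by rewrite in_itv /= !leEord; do ?case/andP.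
case: insubP => [j _ ja bj|_].
  right; exists j => //; apply: val_inj; rewrite /= -[nat_of_ord j]/(val j) ja.
  by rewrite prednK// lt0n.
by rewrite in_itv /= ltEord leEord => /andP[h1 h2]; have := leq_trans h1 h2; rewrite ltnn.
Qed.

Let pieces_partition : interval_partition [set: 'I_N] pieces.
Proof.
split=> [a a' _ _ [b /= [ba ba']]|].
  have pos j : b \in Ij j -> b != 0%N :> nat.
    by rewrite mem_Ij => /andP[h _]; rewrite -lt0n (leq_ltn_trans _ h).
  case: (pieces_cases ba) => [[a0 b0]|[j aj bj]]; case: (pieces_cases ba') => [[a0' b0']|[j' aj' bj']].
  - by apply: val_inj; rewrite /= a0 a0'.
  - by have := pos _ bj'; rewrite b0.
  - by have := pos _ bj; rewrite b0'.
  rewrite aj aj'; congr pieceS; move: bj bj'; rewrite !mem_Ij => bj bj'.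
  have /andP[l1 l2] := lohi j; have /andP[l1' l2'] := lohi j'.
  have [i ij ib] := rnk_crossing l1 bj; have [i' ij' ib'] := rnk_crossing l1' bj'.
  have ii' := rnk_crossing_uniq ib ib'; rewrite -ii' in ij' => {i' ii' ib'}.
  have iM : (i < M)%N by case/andP: ij => _ /leq_trans; apply.
  apply/eqP; apply: contraT => jj'.
  have := partM iM; rewrite (bigD1 j)//= (bigD1 j')/=; last by rewrite eq_sym.
  by rewrite /in_piece ij ij'.
apply/seteqP; split=> // b _; have [b0|b0] := eqVneq (b : nat) 0%N.
  have h : (0 < 2 * k + 1)%N by rewrite addn1.
  exists (Ordinal h) => //=; rewrite /pieces /= in_itv /= !leEord /=.
  by rewrite b0.
have bN : (rnk t 0 < b <= rnk t M)%N.
  rewrite rnk0 lt0n b0 /= rnk_cell_bits.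
  rewrite (eq_count (a2 := predT)); last by move=> w; exact: ltn_ord.
  by rewrite count_predT -ltnS; exact: ltn_ord.
have [i /andP[_ iM] /andP[ib bi]] := rnk_crossing (leq0n M) bN.
have /existsP[j ji] : [exists j, in_piece lo hi j i].
  apply: contraT; rewrite negb_exists => /forallP h.
  by have := partM iM; rewrite big1// => j _; rewrite (negbTE (h j)).
exists (pieceS j) => //=; rewrite pieces_S mem_Ij.
case/andP: ji => li ih; rewrite (leq_ltn_trans (leq_rnk t li) ib).
by rewrite (leq_trans bi (leq_rnk t ih)).
Qed.

Lemma Ak_red_mass p q (tau : R) : density p -> density q ->
  (forall i, cell_mass p i + cell_mass q i <= 2 * tau) -> 0 <= tau ->
  Wrun (fun i => cell_mass p i - cell_mass q i) (pval lo hi sig) 0 0 t - 4 * k%:R * tau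
    <= Ak_distr (red_mass p) (red_mass q) (2 * k + 1).
Proof.
move=> dp dq pq tau0.
apply: le_trans (Wrun_buckets size_cell_bits lohi sig1 (sub_mass_split dp)
  (sub_mass_split dq) _ _ _ tau0) _.
- by move=> i _; exact: cell_mass_ge0.
- by move=> i _; exact: cell_mass_ge0.
- by move=> i _.
have [p0 p1] := red_mass_distr dp; have [q0 q1] := red_mass_distr dq.
rewrite /Ak_distr /Ak_dist.
set P := fun I : interval 'I_N => \sum_(i | i \in I) red_mass p i.
set Q := fun I : interval 'I_N => \sum_(i | i \in I) red_mass q i.
have P1 I : 0 <= P I <= 1.
  rewrite /P sumr_ge0//= -p1 [leRHS](bigID (fun b => b \in I))/= lerDl sumr_ge0//.
have Q1 I : 0 <= Q I <= 1.
  rewrite /Q sumr_ge0//= -q1 [leRHS](bigID (fun b => b \in I))/= lerDl sumr_ge0//.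
apply: le_trans (_ : \sum_(a < 2 * k + 1) `|P (pieces a) - Q (pieces a)| <= _); last first.
  apply: ub_le_sup; last by exists pieces.
  (* Boundedness is needed for the supremum to dominate its elements. *)
  exists (\sum_(a < 2 * k + 1) 1) => _ [I _ <-]; apply: ler_sum => a _.
  exact: dist01 (P1 (I a)) (Q1 (I a)).
apply: le_trans (_ : \sum_j `|P (Ij j) - Q (Ij j)| <= _); last first.
  have inj : injective pieceS.
    by move=> j j' /(congr1 (@nat_of_ord _)); rewrite !pieceSE => -[] /val_inj.
  rewrite (eq_bigr (fun j => `|P (pieces (pieceS j)) - Q (pieces (pieceS j))|)); last first.
    by move=> j _; rewrite pieces_S.
  rewrite -(big_imset (h := pieceS) (fun a => `|P (pieces a) - Q (pieces a)|))/=; last by move=> ? ? _ _; exact: inj.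
  rewrite [leRHS](bigID (fun a => a \in pieceS @: 'I_k)%SET)/= lerDl sumr_ge0//.
have -> : \sum_(b < N) bucket_sign t lo hi sig b *
     (\sum_(0 <= i < M) sub_mass p i b - \sum_(0 <= i < M) sub_mass q i b)
   = \sum_j sig j * (P (Ij j) - Q (Ij j)).
  rewrite /bucket_sign; under eq_bigr do rewrite -!red_massE// mulr_suml.
  rewrite exchange_big /=; apply: eq_bigr => j _.
  rewrite /P /Q -sumrB mulr_sumr [RHS]big_mkcond /=; apply: eq_bigr => b _.
  by rewrite mem_Ij; case: ifP => _; rewrite ?mulr1// mulr0 mul0r.
apply: ler_sum => j _; apply: le_trans (ler_norm _) _.
by rewrite normrM ler_piMl.
Qed.

End Reduced.

(** * A fine grid adapted to a partition *)

Section Grid.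
Variable R : realType.

Lemma count_le_split (T : seq R) (x z : R) : x <= z ->
  count (fun w => w <= z) T
    = (count (fun w => (w <= x)%R) T + count (fun w => (x < w)%R && (w <= z)%R) T)%N.
Proof.
move=> xz; elim: T => //= w T ->; rewrite addnACA; congr (_ + _)%N.
by have [wx|wx] := leP w x => //=; rewrite (le_trans wx xz).
Qed.

Lemma pmass_setI01 (p : R -> R) (A : set R) : pmass p (A `&` `[0, 1]) = pmass p A.
Proof.
rewrite /pmass /draw; congr fine; apply: eq_integral => x xI; congr (_ * _)%E.
by rewrite !indicE in_setI xI andbT.
Qed.

Definition grid (T : seq R) : Prop :=
  sorted <%R T /\ (forall t, t \in T -> 0 < t < 1).

(** The multiples of [1 / n.+1] make the cells short, and absolute continuity makes short cells
    light. [pts] will hold the endpoints of a partition witnessing the distance. *)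
Lemma grid_exists (pts : seq R) (p q : R -> R) (tau : R) :
  density p -> density q -> 0 < tau ->
  exists T, [/\ grid T, (forall z, z \in pts -> 0 < z < 1 -> z \in T),
    (forall i, cell_mass T p i <= tau) & (forall i, cell_mass T q i <= tau)].
Proof.
move=> dp dq tau0.
have [d1 d10 H1] := pmass_small dp tau0; have [d2 d20 H2] := pmass_small dq tau0.
have [n nd] : exists n : nat, 2 / n.+1%:R < Num.min d1 d2.
  have dm : 0 < Num.min d1 d2 / 2 by rewrite divr_gt0// lt_min d10.
  exists (Num.trunc (Num.min d1 d2 / 2)^-1).
  rewrite ltr_pdivrMr ?ltr0n// mulrC -ltr_pdivrMr ?lt_min ?d10//.
  by rewrite -invf_div truncnS_gt.
pose T0 := pts ++ [seq i%:R / n.+1%:R | i <- iota 0 n.+1].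
pose T := sort <=%R (undup [seq z <- T0 | 0 < z < 1]).
have TE z : z \in T = (0 < z < 1) && (z \in T0).
  by rewrite mem_sort mem_undup mem_filter.
exists T; have small i (A := bucket T @^-1` [set i] `&` `[0, 1]) :
    measurable A /\ (lebesgue_measure A < (Num.min d1 d2)%:E)%E.
  have mA : measurable A by apply: measurableI => //; exact: measurable_bucket.
  split=> //; have [->|/set0P[x0 [/= x0i x0I]]] := eqVneq A set0.
    by rewrite measure0 lte_fin lt_min d10.
  have sub : A `<=` [set` `[x0 - n.+1%:R^-1, x0 + n.+1%:R^-1]].
    have key x y : A x -> A y -> y <= x + n.+1%:R^-1.
      move=> [/= xi xI] [/= yi yI]; rewrite leNgt; apply/negP => xy.
      move: xI yI; rewrite !in_itv/= => /andP[x0' x1] /andP[y0 y1].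
      (* The next multiple of [1 / n.+1] after [x] would separate [x] from [y]. *)
      pose j := (Num.trunc (x * n.+1%:R)).+1; pose z : R := j%:R / n.+1%:R.
      have n0 : 0 < n.+1%:R :> R by rewrite ltr0n.
      have xz : x < z by rewrite ltr_pdivlMr// truncnS_gt.
      have zx : z <= x + n.+1%:R^-1.
        rewrite ler_pdivrMr// mulrDl mulVf ?gt_eqF// /j -natr1 lerD2r.
        by rewrite truncn_le// mulr_ge0// ltW.
      have zT : z \in T.
        rewrite TE; apply/andP; split.
          by rewrite (le_lt_trans x0' xz)/= (lt_le_trans (le_lt_trans zx xy)).
        rewrite mem_cat; apply/orP; right; apply/mapP; exists j => //.
        rewrite mem_iota /= add0n -(ltr_nat R).
        have : z < 1 by rewrite (lt_le_trans (le_lt_trans zx xy)).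
        by rewrite ltr_pdivrMr// mul1r.
      have : (bucket T x < bucket T y)%N.
        rewrite !val_bucket.
        have xy' : x <= y by rewrite (le_trans _ (ltW xy))// lerDl invr_ge0.
        rewrite (count_le_split T xy').
        rewrite -[X in (X < _)%N]addn0 ltn_add2l -has_count; apply/hasP; exists z => //.
        by rewrite xz (le_trans zx (ltW xy)).
      by rewrite xi yi ltnn.
    move=> x Ax; rewrite /= in_itv/= lerBlDr (key x x0)//= ?(key x0 x)//.
  apply: le_lt_trans (_ : _ <= (2 / n.+1%:R)%:E)%E _; last by rewrite lte_fin.
  apply: (@le_trans _ _ (lebesgue_measure [set` `[x0 - n.+1%:R^-1, x0 + n.+1%:R^-1]])).
    by apply: le_measure; rewrite ?inE//; exact: measurable_itv.
  rewrite lebesgue_measure_itv/=; case: ifP => _; last by rewrite lee_fin divr_ge0.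
  by rewrite -EFinB lee_fin; set e := n.+1%:R^-1; lra.
have cm r d : density r -> Num.min d1 d2 <= d -> (forall A, measurable A ->
    (lebesgue_measure A < d%:E)%E -> pmass r A <= tau) ->
    forall i, cell_mass T r i <= tau.
  move=> dr dd Hr i; rewrite /cell_mass; case: ifP => [iM|_]; last exact: ltW.
  rewrite -pmass_setI01; have [mA lA] := small (inord i); apply: Hr => //.
  by apply: lt_le_trans lA _; rewrite lee_fin.
split.
- split; last by move=> t; rewrite TE => /andP[].
  by rewrite lt_sorted_uniq_le sort_uniq undup_uniq/= sort_sorted//; exact: le_total.
- by move=> z zp z01; rewrite TE z01 mem_cat zp.
- by apply: (cm _ d1) => //; rewrite ge_min lexx.
- by apply: (cm _ d2) => //; rewrite ge_min lexx orbT.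
Qed.

Variable (T : seq R).
Hypothesis gT : grid T.
Let M := (size T).+1.

(** Such a point off the grid decides to which interval of a partition the cell belongs. *)
Lemma grid_rep i : (i < M)%N ->
  exists x, [/\ 0 < x < 1, x \notin T & bucket T x = i :> nat].
Proof.
case: gT => sT T01 iM.
(* The ends of cell [i]; the default 1 is the right end of the last cell. *)
pose a := nth 1 (0 :: T) i; pose b := nth 1 T i.
have ab : a < b.
  rewrite /a /b; case: i iM {a b} => [|i] iM /=.
    case: {sT} T T01 => [|t T'] H /=; first exact: ltr01.
    by case/andP: (H t (mem_head _ _)).
  have [iT|Ti] := ltnP i.+1 (size T).
    by apply: (sorted_ltn_nth lt_trans) => //; rewrite inE ltnW.
  rewrite [X in _ < X]nth_default//.
  have : nth 1 T i \in T by rewrite mem_nth.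
  by move/T01 => /andP[].
have a0 : 0 <= a.
  rewrite /a; case: i iM {a b ab} => [|i] iM //=.
  by have /T01/andP[/ltW] : nth 1 T i \in T by rewrite mem_nth.
have b1 : b <= 1.
  rewrite /b; have [iT|Ti] := ltnP i (size T); last by rewrite nth_default.
  by have /T01/andP[_ /ltW] : nth 1 T i \in T by rewrite mem_nth.
pose x := (a + b) / 2; have ax : a < x by rewrite /x; lra.
have xb : x < b by rewrite /x; lra.
have low t : t \in take i T -> t <= a.
  rewrite /a; case: i iM {a b ab a0 b1 x ax xb} => [|i] iM; first by rewrite take0.
  move/(nthP 1) => [j]; rewrite size_takel; last exact: iM.
  move=> ji <-; rewrite nth_take//=; apply: (sorted_leq_nth le_trans lexx) => //.
  - by move: sT; rewrite lt_sorted_uniq_le => /andP[].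
  - by rewrite inE; apply: leq_ltn_trans ji iM.
have high t : t \in drop i T -> b <= t.
  move/(nthP 1) => [j]; rewrite size_drop nth_drop => ji <-; rewrite /b.
  apply: (sorted_leq_nth le_trans lexx) => //; rewrite ?leq_addr ?inE//.
  - by move: sT; rewrite lt_sorted_uniq_le => /andP[].
  - by rewrite (leq_ltn_trans (leq_addr j i))// -ltn_subRL.
  - by rewrite -ltn_subRL.
exists x; split; first by rewrite (le_lt_trans a0 ax) (lt_le_trans xb b1).
  rewrite -(cat_take_drop i T) mem_cat; apply/negP => /orP[/low|/high].
    by rewrite leNgt ax.
  by rewrite leNgt xb.
rewrite val_bucket -[in LHS](cat_take_drop i T) count_cat.
have -> : count (fun w => w <= x) (take i T) = i.
  rewrite (eq_in_count (a2 := predT)) ?count_predT ?size_takel//.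
  by move=> t /low ta; rewrite (le_trans ta)// ltW.
rewrite (eq_in_count (a2 := pred0)) ?count_pred0 ?addn0//.
by move=> t /high bt; apply/negbTE; rewrite -ltNge (lt_le_trans xb).
Qed.

(** For a grid point [z], the index of the cell that starts at [z]. *)
Definition grid_pos (z : R) : nat :=
  if 1 <= z then M else count (fun t => t <= z) T.

Lemma grid_pos_lt z x : 0 < x < 1 -> x \notin T -> (0 < z < 1 -> z \in T) ->
  ((z < x) = (grid_pos z <= bucket T x)%N) /\ ((x < z) = (bucket T x < grid_pos z)%N).
Proof.
case: gT => _ T01 /andP[x0 x1] xT zT; rewrite /grid_pos.
have [z1|z1] := leP 1 z.
  rewrite ltNge (ltW (lt_le_trans x1 z1)) (lt_le_trans x1 z1) ltn_ord.
  by split=> //; apply/esym/negbTE; rewrite -ltnNge ltn_ord.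
have [zx|xz|zx] := ltgtP z x.
- rewrite [(_ < count _ _)%N]ltnNge.
  suff -> : (count (fun t => (t <= z)%R) T <= bucket T x)%N by [].
  by rewrite val_bucket; apply: sub_count => t /= /le_trans; apply; exact: ltW.
- have z01 : 0 < z < 1 by rewrite (lt_trans x0 xz).
  rewrite [(count _ _ <= _)%N]leqNgt.
  suff -> : (bucket T x < count (fun t => (t <= z)%R) T)%N by [].
  rewrite val_bucket.
  rewrite (count_le_split T (ltW xz)).
  rewrite -[X in (X < _)%N]addn0 ltn_add2l -has_count; apply/hasP; exists z => //=.
    exact: zT.
  by rewrite xz lexx.
- by move: xT; rewrite -zx zT// zx x0 x1.
Qed.

Definition bound_pts (b : itv_bound R) : seq R := if b is BSide _ z then [:: z] else [::].

Definition itv_pts (J : interval R) : seq R :=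
  let: Interval l r := J in bound_pts l ++ bound_pts r.

Definition bound_pos (b : itv_bound R) : nat :=
  match b with
  | BSide _ z => grid_pos z
  | BInfty true => 0
  | BInfty false => M
  end.

(** Off the grid, open and closed ends need not be distinguished. *)
Lemma mem_itv_pos (J : interval R) x : 0 < x < 1 -> x \notin T ->
  (forall z, z \in itv_pts J -> 0 < z < 1 -> z \in T) ->
  (x \in J) = (bound_pos (let: Interval l _ := J in l) <= bucket T x
                < bound_pos (let: Interval _ r := J in r))%N.
Proof.
move=> x01 xT; case: J => l r /= HJ.
have Hl b z : l = BSide b z -> (z < x ?<= if b) = (grid_pos z <= bucket T x)%N.
  move=> E; have [|h1 h2] := @grid_pos_lt z x x01 xT.
    by apply: HJ; rewrite E mem_head.
  by case: b E => _ /=; [rewrite leNgt h2 -leqNgt|exact: h1].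
have Hr b z : r = BSide b z -> (x < z ?<= if ~~ b) = (bucket T x < grid_pos z)%N.
  move=> E; have [|h1 h2] := @grid_pos_lt z x x01 xT.
    by apply: HJ; rewrite E mem_cat mem_head orbT.
  by case: b E => _ /=; [exact: h2|rewrite leNgt h1 -ltnNge].
rewrite in_itv /=; case: l Hl {HJ} => [b z|[]] Hl; case: r Hr => [b' z'|[]] Hr /=;
  rewrite ?ltn_ord ?ltn0 ?andbF ?andbT ?(Hl _ _ erefl) ?(Hr _ _ erefl)//.
all: by rewrite [(M <= _)%N]leqNgt ltn_ord.
Qed.

Let N : set R := [set` 0 :: 1 :: T].

Lemma measurable_grid : measurable N.
Proof.
apply: countable_measurable; first by move=> t; exact: measurable_set1.
exact/finite_set_countable/finite_seq.
Qed.

Lemma grid_null : lebesgue_measure N = 0%E.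
Proof. exact/countable_lebesgue_measure0/finite_set_countable/finite_seq. Qed.

Lemma notin_grid x : (`[0, 1] `\` N) x -> 0 < x < 1 /\ x \notin T.
Proof.
move=> [/=]; rewrite in_itv/= => /andP[x0 x1] /negP; rewrite !inE !negb_or.
by move=> /and3P[x0' x1' xT]; rewrite !lt_def x0' x0 x1 eq_sym x1'.
Qed.

Lemma grid_pieces k (J : 'I_k -> interval R) : interval_partition (`[0, 1] : set R) J ->
  (forall j z, z \in itv_pts (J j) -> 0 < z < 1 -> z \in T) ->
  exists lo hi : 'I_k -> nat,
  [/\ forall j, (lo j <= hi j <= M)%N,
      forall i, (i < M)%N -> (\sum_j in_piece lo hi j i)%N = 1%N &
      forall p, density p -> forall j,
        mass p (J j) = \sum_(lo j <= i < hi j) cell_mass T p i].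
Proof.
move=> [Jdis Jcov] JT.
pose l j := bound_pos (let: Interval l _ := J j in l).
pose r j := bound_pos (let: Interval _ r := J j in r).
(* An interval whose bounds are in the wrong order becomes the empty range at 0, so that
   [lo j <= hi j] holds throughout. *)
pose lo j := if (l j <= r j)%N then l j else 0%N.
pose hi j := if (l j <= r j)%N then r j else 0%N.
have pos_le b : (bound_pos b <= M)%N.
  case: b => [b z|[]]//=; rewrite /grid_pos; case: ifP => // _.
  by rewrite ltnW// ltnS count_size.
have lohi j : (lo j <= hi j <= M)%N by rewrite /lo /hi; case: ifP => //= ->; rewrite /r pos_le.
have inE' j x : 0 < x < 1 -> x \notin T -> (x \in J j) = in_piece lo hi j (bucket T x).
  move=> x01 xT; rewrite (mem_itv_pos x01 xT (JT j)) -/(l j) -/(r j) /in_piece /lo /hi.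
  case: (leqP (l j) (r j)) => // rl; rewrite ltn0 andbF; apply/negP => /andP[h1 h2].
  by have := leq_ltn_trans h1 (ltn_trans h2 rl); rewrite ltnn.
exists lo, hi; split=> // [i iM|p dp j].
  have [x [x01 xT xi]] := grid_rep iM.
  have [j _ xj] : (\bigcup_(j in [set: 'I_k]) [set` J j]) x.
    by rewrite Jcov /= in_itv/= !ltW//; case/andP: x01.
  have pj : in_piece lo hi j i by rewrite -xi -inE'.
  rewrite (bigD1 j)//= pj big1// => j' jj'; apply/eqP; rewrite eqb0.
  apply: contraNN jj'; rewrite -xi -inE'// => xj'; apply/eqP.
  by apply: Jdis => //; exists x; split.
have JI : [set` J j] `<=` `[0, 1].
  by move=> x Jx; rewrite -Jcov; exists j.
rewrite (mass_pmass p JI) (sum_piece lohi) big_mkord.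
have mJ : measurable [set` J j] by exact: measurable_itv.
rewrite (pmass_split dp mJ (@measurable_bucket R T)); apply: eq_bigr => i _.
have null A : A `<=` N -> measurable A -> lebesgue_measure A = 0%E.
  move=> AN mA; apply/eqP; rewrite eq_le measure_ge0 andbT -grid_null.
  by apply: le_measure; rewrite ?inE//; exact: measurable_grid.
have mA := measurableI _ _ mJ (measurable_bucket i).
have mC : measurable (bucket T @^-1` [set i] `&` `[0, 1]).
  by apply: measurableI; [exact: measurable_bucket|exact: measurable_itv].
rewrite -cell_massE; case: (boolP (in_piece lo hi j i)) => ji; last first.
  rewrite mul0r; apply: (pmass_null dp) => //; apply: null => // x [/= xJ xi].
  apply: contrapT => xN; move: ji; rewrite -xi -inE' ?xJ//.
    by case: (notin_grid (conj (JI _ xJ) xN)).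
  by case: (notin_grid (conj (JI _ xJ) xN)).
rewrite mul1r -[RHS]pmass_setI01; apply: (pmass_eq dp mA mC).
  rewrite (_ : _ `\` _ = set0) ?measure0//; apply/seteqP; split=> // x [[/= xJ xi]].
  by apply; split=> //; exact: JI.
apply: null; last exact: measurableD.
move=> x [[/= xi xI] xA]; apply: contrapT => xN; apply: xA; split=> //=.
by have [x01 xT] := notin_grid (conj xI xN); rewrite inE'// xi.
Qed.

End Grid.

(** * Expectation functionals without measurability *)

Section Expectation.
Variable R : realType.

(** These properties hold for arbitrary nonnegative integrands. Additivity is left out, as lower
    integrals are not additive in general. *)
Record expectation (A : Type) (u : rand R A) : Prop := Expectation {
  exp_ge0 : forall f, (forall a, 0 <= f a)%E -> (0 <= u f)%E ;
  exp_le : forall f g, (forall a, 0 <= f a)%E -> (forall a, f a <= g a)%E ->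
    (u f <= u g)%E ;
  exp_cst : forall k, (0 <= k)%E -> u (fun=> k) = k }.

Lemma exp_ge_cst (A : Type) (u : rand R A) k f : expectation u -> (0 <= k)%E ->
  (forall a, k <= f a)%E -> (k <= u f)%E.
Proof. by move=> eu k0 kf; rewrite -[leLHS](exp_cst eu k0); apply: exp_le. Qed.

Lemma exp_le_cst (A : Type) (u : rand R A) k f : expectation u ->
  (forall a, 0 <= f a)%E -> (forall a, f a <= k)%E -> (0 <= k)%E -> (u f <= k)%E.
Proof. by move=> eu f0 fk k0; rewrite -[leRHS](exp_cst eu k0); apply: exp_le. Qed.

Lemma expectation_rret A (a : A) : expectation (rret (R := R) a).
Proof. by split=> [f f0|f g _ fg|k _]; rewrite /rret. Qed.

Lemma expectation_rbind A B (u : rand R A) (g : A -> rand R B) :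
  expectation u -> (forall a, expectation (g a)) -> expectation (rbind u g).
Proof.
move=> eu eg; rewrite /rbind; split=> [f f0|f h f0 fh|k k0].
- by apply: (exp_ge0 eu) => a; apply: (exp_ge0 (eg a)).
- by apply: (exp_le eu) => a; [apply: (exp_ge0 (eg a))|apply: (exp_le (eg a))].
- rewrite -[RHS](exp_cst eu k0); congr u; apply/funext => a.
  exact: (exp_cst (eg a)).
Qed.

Lemma expectation_iid A n (u : rand R A) : expectation u -> expectation (iid n u).
Proof.
move=> eu; elim: n => [|n IH] /=; first exact: expectation_rret.
apply: expectation_rbind => // x; apply: expectation_rbind => // s.
exact: expectation_rret.
Qed.

Lemma expectation_finite_law (A : finType) (pr : A -> R) :
  (forall a, 0 <= pr a) -> \sum_a pr a = 1 -> expectation (finite_law pr).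
Proof.
move=> p0 p1; rewrite /finite_law; split=> [f f0|f g f0 fg|k k0].
- by apply: sume_ge0 => a _; rewrite mule_ge0 ?lee_fin.
- by apply: lee_sum => a _; rewrite lee_wpmul2l ?lee_fin.
- rewrite -ge0_sume_distrl => [|a _]; last by rewrite lee_fin.
  by rewrite sumEFin p1 mul1e.
Qed.

Lemma expectation_coin (a : R) : 0 <= a <= 1 -> expectation (coin a).
Proof.
move=> a01; apply: expectation_finite_law => [b|]; first exact: bernoulli_pmf_ge0.
by rewrite big_bool /= /bernoulli_pmf addrC subrK.
Qed.

Lemma expectation_draw (p : R -> R) : density p -> expectation (draw p).
Proof.
move=> dp; split=> [f f0|f g f0 fg|k k0].
- exact: draw_ge0.
- by apply: le_draw.
- exact: draw_cst.
Qed.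

Lemma expectation_mixture A (u v : rand R A) :
  expectation u -> expectation v -> expectation (mixture u v).
Proof.
move=> eu ev; apply: expectation_rbind => [|[]//].
by apply: expectation_coin; rewrite invr_ge0 ler0n invf_le1 ?ler1n.
Qed.

Lemma poisson_pmf_sum (m : R) : 0 < m ->
  (\sum_(0 <= n <oo) (poisson_pmf m n)%:E = 1)%E.
Proof.
move=> m0; have := @probability_setT _ _ R (poisson_prob m 0%N).
rewrite /= /poisson_prob m0 => <-; apply: nneseries_esumT => n.
by rewrite lee_fin poisson_pmf_ge0.
Qed.

Lemma expectation_poi (m : R) : 0 < m -> expectation (poi m).
Proof.
move=> m0; rewrite /poi; split=> [f f0|f g f0 fg|k k0].
- by apply: nneseries_ge0 => n _ _; rewrite mule_ge0 ?lee_fin ?poisson_pmf_ge0.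
- apply: lee_nneseries => n _; first by rewrite mule_ge0 ?lee_fin ?poisson_pmf_ge0.
  by rewrite lee_wpmul2l ?lee_fin ?poisson_pmf_ge0.
case: k k0 => [k k0| _ |//].
  under eq_eseriesr do rewrite muleC.
  by rewrite nneseriesZl ?poisson_pmf_sum ?mule1// => n _; rewrite lee_fin poisson_pmf_ge0.
(* For [k = +oo] the term of index 0 is already infinite. *)
apply/eqP; rewrite eq_le leey /=.
have H : (0 < poisson_pmf m 0)%R.
  by rewrite /poisson_pmf m0 expr0 mul1r fact0 invr1 mul1r expR_gt0.
apply: (le_trans _ (nneseries_lim_ge 1 _)) => [|n _]; last first.
  by rewrite mule_ge0 ?lee_fin ?poisson_pmf_ge0// leey.
by rewrite big_nat1 gt0_muley ?lte_fin.
Qed.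

(** The constant stays inside because [expectation] provides no additivity; it will collect the
    sample counts of the other steps. *)
Lemma poi_mean (m a : R) : 0 < m -> 0 <= a ->
  poi m (fun n => (a + n%:R)%:E) = (a + m)%:E.
Proof.
move=> m0 a0; rewrite /poi.
have p0 n : (0 <= (poisson_pmf m n)%:E)%E by rewrite lee_fin poisson_pmf_ge0.
transitivity (\sum_(0 <= n <oo) (a%:E * (poisson_pmf m n)%:E
    + (poisson_pmf m n * n%:R)%:E))%E.
  by apply: eq_eseriesr => n _; rewrite -!EFinM -EFinD; congr EFin; ring.
rewrite nneseriesD => [|n _ _|n _ _]; last 2 first.
- by rewrite mule_ge0 ?lee_fin ?poisson_pmf_ge0.
- by rewrite lee_fin mulr_ge0// poisson_pmf_ge0.
rewrite nneseriesZl// poisson_pmf_sum// mule1 EFinD; congr (_ + _)%E.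
rewrite (nneseries_split 0 1) => [|n _]; last by rewrite lee_fin mulr_ge0// poisson_pmf_ge0.
rewrite big_nat1 mulr0 add0e add0n.
rewrite -nneseries_addn => [|n]; last by rewrite lee_fin mulr_ge0// poisson_pmf_ge0.
transitivity (\sum_(0 <= n <oo) m%:E * (poisson_pmf m n)%:E)%E; last first.
  by rewrite nneseriesZl// poisson_pmf_sum// mule1.
apply: eq_eseriesr => n _; rewrite -EFinM /poisson_pmf m0 addn1; congr EFin.
rewrite factS natrM exprS; field.
by rewrite nat1r !pnatr_eq0 -lt0n fact_gt0.
Qed.

Lemma expectation_poi_iid A (m : R) (u : rand R A) : 0 < m -> expectation u ->
  expectation (poi_iid m u).
Proof.
move=> m0 eu; apply: expectation_rbind => [|n]; first exact: expectation_poi.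
exact: expectation_iid.
Qed.

Lemma iid_size A n (u : rand R A) (g : nat -> \bar R) : expectation u ->
  (forall n, 0 <= g n)%E -> iid n u (fun s => g (size s)) = g n.
Proof.
move=> eu; elim: n g => [|n IH] g g0 //=.
rewrite -[RHS](exp_cst eu (g0 n.+1)); congr u; apply/funext => x.
by rewrite /rbind /rret /= (IH (fun n => g n.+1)).
Qed.

Lemma poi_iid_size A (m a : R) (u : rand R A) : 0 < m -> 0 <= a -> expectation u ->
  poi_iid m u (fun s => (a + (size s)%:R)%:E) = (a + m)%:E.
Proof.
move=> m0 a0 eu; rewrite -poi_mean//; congr poi; apply/funext => n.
by rewrite (@iid_size _ n u (fun n => (a + n%:R)%:E))// => k; rewrite lee_fin addr_ge0.
Qed.

Lemma expectation_shuffle A (s : seq A) : expectation (shuffle (R := R) s).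
Proof.
apply: expectation_rbind => [|pi]; last exact: expectation_rret.
apply: expectation_finite_law => [pi|]; first by rewrite invr_ge0.
by rewrite sumr_const card_Sn -[LHS]mulr_natl mulfV//.
Qed.

Lemma expectation_merge (X Y : seq R) : expectation (merge_samples X Y).
Proof.
apply: expectation_rbind => [|s]; first exact: expectation_shuffle.
exact: expectation_rret.
Qed.

Lemma expectation_run_tester (T : tester R) n k eps delta (u v : rand R 'I_n) :
  expectation u -> expectation v -> expectation (run_tester T k eps delta u v).
Proof.
move=> eu ev; apply: expectation_rbind => [|x]; first exact: expectation_iid.
apply: expectation_rbind => [|y]; first exact: expectation_iid.
apply: expectation_coin; exact: accept01.
Qed.

Lemma expectation_reduced W (p : R -> R) : density p -> expectation (reduced W (draw p)).
Proof.
move=> dp; apply: expectation_rbind => [|x]; first exact: expectation_draw.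
exact: expectation_rret.
Qed.

End Expectation.

(** * The tester on reduced distributions *)

Section TesterOnBuckets.
Variable R : realType.

(** After [bucket W], every [f] takes finitely many values on measurable sets, so equality holds
    here and the tester meets a finite distribution. *)
Lemma reduced_finite W (p : R -> R) (f : 'I_(size W).+1 -> \bar R) : density p ->
  (forall b, 0 <= f b)%E -> reduced W (draw p) f = finite_law (@red_mass R W p) f.
Proof.
move=> dp f0; rewrite /reduced /rbind /rret draw_fibers//.
exact: measurable_bucket.
Qed.

Lemma eq_iid A n (u v : rand R A) f : expectation v ->
  (forall f, (forall a, 0 <= f a)%E -> u f = v f) ->
  (forall s, 0 <= f s)%E -> iid n u f = iid n v f.
Proof.
move=> ev uv; elim: n f => [|n IH] f f0 //=.
rewrite /rbind /rret uv => [|a].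
  by congr v; apply/funext => a; apply: IH.
rewrite IH//; apply: (exp_ge0 (expectation_iid n ev)) => s.
exact: f0.
Qed.

Lemma run_tester_reduced (T : tester R) W k eps delta p q f : density p -> density q ->
  (forall b, 0 <= f b)%E ->
  run_tester T k eps delta (reduced W (draw p)) (reduced W (draw q)) f
  = run_tester T k eps delta (finite_law (@red_mass R W p)) (finite_law (@red_mass R W q)) f.
Proof.
move=> dp dq f0; rewrite /run_tester /rbind.
have [p0 p1] := red_mass_distr W dp; have [q0 q1] := red_mass_distr W dq.
have ep := expectation_finite_law p0 p1; have eq' := expectation_finite_law q0 q1.
have c0 x y : (0 <= coin (accept T (n := (size W).+1) k eps delta x y) f)%E.
  by apply: (exp_ge0 (expectation_coin _)) => //; exact: accept01.
rewrite (@eq_iid _ _ _ (finite_law (@red_mass R W p)) _ ep); last first.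
- by move=> x; apply: (exp_ge0 (expectation_iid _ (expectation_reduced _ dq))).
- by move=> g g0; exact: reduced_finite.
congr (iid _ _ _); apply/funext => x; apply: eq_iid => // g g0.
exact: reduced_finite.
Qed.

Lemma finite_law_scale (A : finType) (pr : A -> R) k f : (forall a, 0 <= pr a) ->
  0 <= k -> (forall a, 0 <= f a)%E ->
  finite_law pr (fun a => k%:E * f a)%E = (k%:E * finite_law pr f)%E.
Proof.
move=> p0 k0 f0; rewrite /finite_law ge0_sume_distrr => [|a _].
  by apply: eq_bigr => a _; rewrite muleCA.
by rewrite mule_ge0 ?lee_fin.
Qed.

Lemma iid_finite_law_scale (A : finType) n (pr : A -> R) k f : (forall a, 0 <= pr a) ->
  \sum_a pr a = 1 -> 0 <= k -> (forall a, 0 <= f a)%E ->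
  iid n (finite_law pr) (fun a => k%:E * f a)%E = (k%:E * iid n (finite_law pr) f)%E.
Proof.
move=> p0 p1 k0; elim: n f => [|n IH] f f0 //=.
rewrite /rbind /rret -finite_law_scale//; last first.
  move=> a; apply: (exp_ge0 (expectation_iid n (expectation_finite_law p0 p1))) => s.
  exact: f0.
by congr finite_law; apply/funext => a; rewrite IH.
Qed.

Lemma run_tester_scale (T : tester R) n k eps delta (p q : 'I_n -> R) (c : R) f :
  distr p -> distr q -> 0 <= c -> (forall b, 0 <= f b)%E ->
  run_tester T k eps delta (finite_law p) (finite_law q) (fun b => c%:E * f b)%E
  = (c%:E * run_tester T k eps delta (finite_law p) (finite_law q) f)%E.
Proof.
move=> [p0 p1] [q0 q1] c0 f0; rewrite /run_tester /rbind.
have ek x y : expectation (coin (accept T (n := n) k eps delta x y)).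
  by apply: expectation_coin; exact: accept01.
have ep := expectation_finite_law p0 p1; have eq' := expectation_finite_law q0 q1.
rewrite -iid_finite_law_scale//; last first.
  by move=> x; apply: (exp_ge0 (expectation_iid _ eq')) => y; apply: (exp_ge0 (ek x y)).
congr (iid _ _ _); apply/funext => x; rewrite -iid_finite_law_scale//.
congr (iid _ _ _); apply/funext => y; rewrite /coin finite_law_scale// => b.
by apply: bernoulli_pmf_ge0; exact: accept01.
by move=> y; apply: (exp_ge0 (ek x y)).
Qed.

Variables (T : tester R) (B D : R).
Hypothesis specT : tester_spec B D T.

(** [c] bounds the continuation after a YES from below; for finite laws it can be pulled out, so
    probabilities multiply over the rounds. *)
Lemma run_tester_accept W (p q : R -> R) k eps delta (c : R) f :
  density p -> density q -> (0 < k)%N -> 0 < eps -> 0 < delta < 1 -> 0 <= c ->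
  norm2 (@red_mass R W p) <= B / Num.sqrt (size W).+1%:R ->
  norm2 (@red_mass R W q) <= B / Num.sqrt (size W).+1%:R ->
  @red_mass R W p =1 @red_mass R W q -> (forall b, 0 <= f b)%E -> (c%:E <= f true)%E ->
  ((c * (1 - delta))%:E <=
     run_tester T k eps delta (reduced W (draw p)) (reduced W (draw q)) f)%E.
Proof.
move=> dp dq k0 eps0 delta01 c0 np nq pq f0 fc; rewrite run_tester_reduced//.
have Dp := red_mass_distr W dp; have Dq := red_mass_distr W dq.
have [_ H] := specT (size W).+1 k0 eps0 delta01.
have [H1 _] := H _ _ Dp Dq np nq; have {}H1 := H1 pq.
have er := expectation_run_tester T k eps delta (expectation_finite_law Dp.1 Dp.2)
   (expectation_finite_law Dq.1 Dq.2).
apply: le_trans (_ : _ <= run_tester T k eps delta (finite_law (@red_mass R W p))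
   (finite_law (@red_mass R W q)) (fun b => c%:E * (id b)%:R%:E)%E)%E _.
  rewrite run_tester_scale//.
  by rewrite EFinM lee_wpmul2l ?lee_fin.
apply: (exp_le er) => [b|[]]; rewrite ?mule1 ?mule0//.
by rewrite mule_ge0 ?lee_fin.
Qed.

Lemma run_tester_reject W (p q : R -> R) k eps delta f :
  density p -> density q -> (0 < k)%N -> 0 < eps -> 0 < delta < 1 ->
  norm2 (@red_mass R W p) <= B / Num.sqrt (size W).+1%:R ->
  norm2 (@red_mass R W q) <= B / Num.sqrt (size W).+1%:R ->
  eps < Ak_distr (@red_mass R W p) (@red_mass R W q) k -> (forall b, 0 <= f b)%E ->
  (1 <= f false)%E ->
  ((1 - delta)%:E <=
     run_tester T k eps delta (reduced W (draw p)) (reduced W (draw q)) f)%E.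
Proof.
move=> dp dq k0 eps0 delta01 np nq pq f0 fc; rewrite run_tester_reduced//.
have Dp := red_mass_distr W dp; have Dq := red_mass_distr W dq.
have [_ H] := specT (size W).+1 k0 eps0 delta01.
have [_ H1] := H _ _ Dp Dq np nq; apply: le_trans (H1 pq) _.
have er := expectation_run_tester T k eps delta (expectation_finite_law Dp.1 Dp.2)
   (expectation_finite_law Dq.1 Dq.2).
by apply: (exp_le er) => [b|[]]; rewrite ?lee_fin//=.
Qed.

End TesterOnBuckets.

(** * Expected number of samples *)

Section SampleComplexity.
Variables (R : realType) (T : tester R) (C eps m NS : R) (k : nat) (p q : R -> R).
Hypotheses (dp : density p) (dq : density q) (m0 : 0 < m).

Lemma expectation_test_rounds r N :
  expectation (test_rounds T C k eps m (draw p) (draw q) r N).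
Proof.
elim: r N => [|r IH] N /=; first exact: expectation_rret.
apply: expectation_rbind => [|W].
  by apply: expectation_poi_iid => //; apply: expectation_mixture; exact: expectation_draw.
apply: expectation_rbind => [|[]//]; last exact: expectation_rret.
by apply: expectation_run_tester; exact: expectation_reduced.
Qed.

Hypothesis NS0 : 0 <= NS.
Hypothesis nsNS : forall n,
  (nsamples T n (2 * k + 1) (eps / C) (C ^+ 2)^-1)%:R <= NS.

(** Stopping early only saves samples, so every round is charged [m] endpoints and [NS] samples from
    each distribution. *)
Lemma test_rounds_samples r N :
  (test_rounds T C k eps m (draw p) (draw q) r N (fun out => (out.2%:R : R)%:E)
    <= (N%:R + r%:R * (m + 2 * NS))%:E)%E.
Proof.
have em : expectation (poi_iid m (mixture (draw p) (draw q))).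
  by apply: expectation_poi_iid => //; apply: expectation_mixture; exact: expectation_draw.
have mNS : 0 <= m + 2 * NS by rewrite addr_ge0 ?mulr_ge0// ltW.
elim: r N => [|r IH] N /=; first by rewrite /rret mul0r addr0.
rewrite /rbind.
set a := N%:R + (2 * NS + r%:R * (m + 2 * NS)).
have a0 : 0 <= a by rewrite !addr_ge0 ?mulr_ge0.
rewrite (_ : N%:R + r.+1%:R * (m + 2 * NS) = a + m); last by rewrite /a -natr1; ring.
rewrite -(@poi_iid_size _ _ m a (mixture (draw p) (draw q)))//; last first.
  by apply: expectation_mixture; exact: expectation_draw.
have er W := expectation_run_tester T (2 * k + 1) (eps / C) (C ^+ 2)^-1
   (expectation_reduced W dp) (expectation_reduced W dq).
have f0 (N' : nat) (b : bool) : (0 <= (if b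
     then test_rounds T C k eps m (draw p) (draw q) r N'
     else rret (false, N')) (fun out => (out.2%:R : R)%:E))%E.
  case: b; last by rewrite /rret lee_fin.
  by apply: (exp_ge0 (expectation_test_rounds r N')) => out; rewrite lee_fin.
apply: (exp_le em) => W; first by apply: (exp_ge0 (er W)) => b; exact: f0.
apply: (exp_le_cst (er W)) => [b|b|]; first exact: f0; last first.
  by rewrite lee_fin addr_ge0.
set N' := (N + _ + _)%N.
have N'le : N'%:R <= N%:R + (size W)%:R + 2 * NS.
  by rewrite /N' 2!natrD natrM lerD2l ler_wpM2l.
have r0 : 0 <= r%:R * (m + 2 * NS) by rewrite mulr_ge0.
case: b; first apply: le_trans (IH N') _.
  by rewrite lee_fin /a; lra.
by rewrite /rret lee_fin /= /a; lra.
Qed.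

Lemma test_identity_samples (r : nat) :
  m = C * k%:R `^ (4 / 5) / eps `^ (6 / 5) ->
  (test_identity T C r k eps (draw p) (draw q) (fun out => (out.2%:R : R)%:E)
    <= (2 * m + r%:R * (m + 2 * NS))%:E)%E.
Proof.
move=> mE; rewrite /test_identity -mE /rbind.
have ep := expectation_draw dp; have eq' := expectation_draw dq.
have mNS : 0 <= r%:R * (m + 2 * NS) by rewrite mulr_ge0// addr_ge0 ?mulr_ge0// ltW.
set c := r%:R * (m + 2 * NS) in mNS *.
have f0 (X Y : seq R) (b : bool) : (0 <= (if b then rret (false, (size X + size Y)%N)
      else test_rounds T C k eps m (draw p) (draw q) r (size X + size Y))
      (fun out => (out.2%:R : R)%:E))%E.
  case: b; first by rewrite /rret lee_fin.
  by apply: (exp_ge0 (expectation_test_rounds r _)) => out; rewrite lee_fin.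
rewrite (_ : 2 * m + c = c + m + m); last by ring.
rewrite -(@poi_iid_size _ _ m (c + m) (draw p))//; last by rewrite addr_ge0// ltW.
apply: (exp_le (expectation_poi_iid m0 ep)) => X.
  apply: (exp_ge0 (expectation_poi_iid m0 eq')) => Y.
  by apply: (exp_ge0 (expectation_merge X Y)) => S; exact: f0.
rewrite (_ : c + m + (size X)%:R = (c + (size X)%:R) + m); last by ring.
rewrite -(@poi_iid_size _ _ m (c + (size X)%:R) (draw q))//; last by rewrite addr_ge0.
apply: (exp_le (expectation_poi_iid m0 eq')) => Y.
  by apply: (exp_ge0 (expectation_merge X Y)) => S; exact: f0.
apply: (exp_le_cst (expectation_merge X Y)) => [S|S|].
- exact: f0.
- case: ifP => _; first by rewrite /rret lee_fin /= natrD; lra.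
  apply: le_trans (test_rounds_samples _ _) _.
  by rewrite lee_fin natrD -/c; lra.
- by rewrite lee_fin !addr_ge0.
Qed.

End SampleComplexity.

Lemma pmass_ae (R : realType) (p q : R -> R) (A : set R) :
  density p -> density q -> measurable A ->
  {ae lebesgue_measure, forall x, x \in `[0, 1] -> p x = q x} -> pmass p A = pmass q A.
Proof.
move=> [mp p0 _] [mq q0 _] mA pq; rewrite /pmass /draw; congr fine.
have mind : measurable_fun (`[0, 1] : set R) (fun x => (\1_A x)%:E : \bar R).
  by apply/measurable_EFinP/measurable_funTS; exact: measurable_indic.
apply: ge0_ae_eq_integral => //.
- by apply: emeasurable_funM => //; exact/measurable_EFinP.
- by apply: emeasurable_funM => //; exact/measurable_EFinP.
- by move=> x Dx; rewrite mule_ge0 ?lee_fin// p0// inE.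
- by move=> x Dx; rewrite mule_ge0 ?lee_fin// q0// inE.
case: pq => N [mN N0 sub]; exists N; split=> // x /= H; apply: sub => /= pqx.
by apply: H => Dx; rewrite pqx.
Qed.

(** * From densities to cells *)

Section Discretisation.
Variables (R : realType) (T : seq R) (m tau : R) (p q : R -> R).
Hypotheses (m0 : 0 < m) (dp : density p) (dq : density q).
Hypotheses (pt : forall i, cell_mass T p i <= tau) (qt : forall i, cell_mass T q i <= tau).
Hypothesis mtau : 2 * m * tau <= 1.
Let M := (size T).+1.
Let P i := cell_mass T p i.
Let Q i := cell_mass T q i.
Let mu i := (P i + Q i) / 2.
Let G : set R := `[0, 1] `\` [set` 0 :: 1 :: T].

Let P0 i : 0 <= P i. Proof. exact: cell_mass_ge0. Qed.
Let Q0 i : 0 <= Q i. Proof. exact: cell_mass_ge0. Qed.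
Let tau0 : 0 <= tau. Proof. exact: le_trans (P0 0) (pt 0). Qed.

Lemma draw_cells r : density r ->
  dominates_cells (bucket T) G (draw r) (cell_mass T r).
Proof.
move=> dr; suff : dominates_cells (bucket T) G (draw r) (fun i : 'I_M => cell_mass T r i) by [].
have -> : (fun i : 'I_M => cell_mass T r i) = (fun i => pmass r (bucket T @^-1` [set i])).
  by apply/funext => i; rewrite cell_massE.
exact: (draw_dominates (@measurable_bucket R T) (measurable_grid T) (grid_null T) dr).
Qed.

(** The first factor accounts for two endpoints in one cell: the squares [(m * mu i)^2] sum to at
    most [m^2 * tau]. *)
Lemma bits_probability (B : pred bitseq) (k : R) (f : seq R -> \bar R) :
  0 <= k -> (forall s, 0 <= f s)%E ->
  (forall X, uniq (map (bucket T) X) -> B (cell_bits (bucket T) X) -> (k%:E <= f X)%E) ->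
  (((1 - m ^+ 2 * tau) * (k * pexp (wlaw m mu) 0 M (fun t => (B t)%:R)))%:E
    <= poi_iid m (mixture (draw p) (draw q)) f)%E.
Proof.
move=> k0 f0 H.
have mu0 i : 0 <= mu i by rewrite divr_ge0// addr_ge0.
have dom : dominates_cells (bucket T) G (mixture (draw p) (draw q)) mu.
  exact: mixture_dominates (draw_cells dp) (draw_cells dq).
have := poi_iid_bits m0 mu0 dom k0 f0 (P := B) (fun X _ => H X).
apply: le_trans; rewrite lee_fin.
have -> : pexp (bitlaw (fun i => m * mu i)) 0 M (fun t => (B t)%:R) =
   pexp (fun i b => (1 + m * mu i) * wlaw m mu i b) 0 M (fun t => (B t)%:R).
  congr pexp; apply/funext => i; apply/funext => b; rewrite /wlaw mulrA mulfV ?mul1r//.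
  by rewrite gt_eqF// ltr_wpDr// mulr_ge0// ltW.
rewrite (pexp_scale (wlaw m mu) (fun i => 1 + m * mu i)) add0n.
set E := pexp _ _ _ _; have E0 : 0 <= E.
  by apply: pexp_ge0 => [i b|t _]; [exact: (wlaw_law m0 mu0 i).1|exact: ler0n].
rewrite mulrCA [leRHS](_ : _ = k * (expR (- m) * (\prod_(0 <= i < M) (1 + m * mu i)) * E)); last by ring.
rewrite ler_wpM2l// ler_wpM2r//.
have mm i : 0 <= m * mu i <= 1.
  apply/andP; split; [by rewrite mulr_ge0// ltW|]; apply: le_trans (_ : _ <= m * tau) _.
    by rewrite ler_wpM2l ?(ltW m0)// /mu; have := pt i; have := qt i; rewrite -/(P i) -/(Q i); lra.
  by have := mulr_ge0 (ltW m0) tau0; have := mtau; lra.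
have S1 : \sum_(0 <= i < M) mu i = 1.
  by rewrite -mulr_suml big_split /= !sum_cell_mass//; field.
have := prod_exp_ge M mm; rewrite -mulr_sumr S1 mulr1; apply: le_trans.
rewrite lerB//; apply: le_trans (_ : _ <= \sum_(0 <= i < M) mu i * (m ^+ 2 * tau)) _.
  apply: ler_sum => i _; rewrite exprMn [_ * mu i ^+ 2]mulrC expr2 -mulrA ler_wpM2l//.
  rewrite mulrC ler_wpM2l ?sqr_ge0// /mu; have := pt i; have := qt i.
  by rewrite -/(P i) -/(Q i); lra.
by rewrite -mulr_suml S1 mul1r.
Qed.

(** The merged samples have total mean [2 * m] and cell means at most [2 * m * tau], whence the
    4. *)
Lemma symbols_probability (B : pred R) (k : R) (f : seq R -> seq R -> \bar R) :
  0 <= k -> (forall s s', 0 <= f s s')%E ->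
  (forall X Y, uniq (map (bucket T) (X ++ Y)) ->
     B (Zrun 0 (map (cell_sym (bucket T) X Y) (enum 'I_M))) -> (k%:E <= f X Y)%E) ->
  (((1 - 4 * m ^+ 2 * tau) * (k * pexp (zlaw (fun i => m * P i) (fun i => m * Q i)) 0 M
        (fun t => (B (Zrun 0 t))%:R)))%:E
    <= poi_iid m (draw p) (fun X => poi_iid m (draw q) (f X)))%E.
Proof.
move=> k0 f0 H.
have := poi_iid_pair m0 P0 Q0 (draw_cells dp) (draw_cells dq) k0 f0 H.
apply: le_trans; rewrite lee_fin.
pose x i := m * P i + m * Q i.
have x0 i : 0 <= x i by rewrite addr_ge0// mulr_ge0// ltW.
have -> : pexp (symlaw (fun i => m * P i) (fun i => m * Q i)) 0 M (fun t => (B (Zrun 0 t))%:R) =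
   pexp (fun i b => (1 + x i) * zlaw (fun i => m * P i) (fun i => m * Q i) i b) 0 M
     (fun t => (B (Zrun 0 t))%:R).
  congr pexp; apply/funext => i; apply/funext => b; rewrite /zlaw mulrA mulfV ?mul1r//.
  by rewrite gt_eqF// ltr_wpDr.
rewrite (pexp_scale (zlaw (fun i => m * P i) (fun i => m * Q i)) (fun i => 1 + x i)) add0n.
set E := pexp _ _ _ _; have E0 : 0 <= E.
  have mP i : 0 <= m * P i by rewrite mulr_ge0// ltW.
  have mQ i : 0 <= m * Q i by rewrite mulr_ge0// ltW.
  by apply: pexp_ge0 => [i b|t _]; [exact: (zlaw_law mP mQ i).1|exact: ler0n].
rewrite mulrCA [leRHS](_ : _ = k * (expR (- (2 * m)) * (\prod_(0 <= i < M) (1 + x i)) * E)); last by ring.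
rewrite ler_wpM2l// ler_wpM2r//.
have xt i : x i <= 2 * m * tau.
  rewrite /x -mulrDr -mulrA [leRHS]mulrCA ler_wpM2l ?(ltW m0)//.
  by have := pt i; have := qt i; rewrite -/(P i) -/(Q i); lra.
have mm i : 0 <= x i <= 1 by rewrite x0 (le_trans (xt i)).
have S1 : \sum_(0 <= i < M) x i = 2 * m.
  by rewrite big_split /= -!mulr_sumr !sum_cell_mass//; ring.
have := prod_exp_ge M mm; rewrite S1; apply: le_trans.
rewrite lerB//; apply: le_trans (_ : _ <= \sum_(0 <= i < M) x i * (2 * m * tau)) _.
  by apply: ler_sum => i _; rewrite expr2 ler_wpM2l.
by rewrite -mulr_suml S1 le_eqVlt; apply/orP; left; apply/eqP; ring.
Qed.

Definition good_bits (t0 : R) (t : bitseq) : bool :=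
  ((count id t)%:R < t0 * (m + 1)) && (Qrun mu 0 0 t < 5 * t0 / m).

Lemma norm2_good (t0 B : R) W : 1 <= t0 -> 8 * t0 <= B ->
  uniq (map (bucket T) W) -> good_bits t0 (cell_bits (bucket T) W) ->
  norm2 (@red_mass R W p) <= B / Num.sqrt (size W).+1%:R /\
  norm2 (@red_mass R W q) <= B / Num.sqrt (size W).+1%:R.
Proof.
move=> t1 tB uW /andP[cW QW].
have t00 : 0 <= t0 by lra.
have B0 : 0 <= B by lra.
pose r := 5 * t0 / m; have r0 : 0 <= r by rewrite divr_ge0 ?mulr_ge0// ltW.
have sW : count id (cell_bits (bucket T) W) = size W.
  have := rnk_cell_bits uW M; rewrite /rnk take_oversize ?size_cell_bits//.
  by move=> ->; rewrite (eq_count (a2 := predT)) ?count_predT// => w; rewrite /= ltn_ord.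
have NB : (size W).+1%:R * Num.min 1 (4 * r) <= B ^+ 2.
  rewrite sW in cW.
  have B2 : 64 * t0 ^+ 2 <= B ^+ 2.
    have -> : 64 * t0 ^+ 2 = (8 * t0) ^+ 2 by ring.
    by rewrite ler_sqr ?nnegrE ?mulr_ge0.
  apply: le_trans B2; rewrite -natr1.
  have mn0 : 0 <= Num.min 1 (4 * r) by rewrite le_min ler01 mulr_ge0.
  apply: le_trans (ler_wpM2r mn0 (_ : _ <= t0 * (m + 1) + 1)) _.
    by rewrite lerD2r ltW.
  (* For [m >= 1], the at most [3 * t0 * m] buckets times [4 * r = 20 * t0 / m] give [60 * t0^2].
     For [m < 1] there are at most [3 * t0] buckets, and the sum of squares is bounded by 1. *)
  have [m1|m1] := leP 1 m.
    apply: le_trans (_ : _ <= (3 * t0 * m) * (4 * r)) _.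
      apply: ler_pM => //; first by rewrite addr_ge0// mulr_ge0// addr_ge0// ltW.
        have := mulr_ge0 t00 (_ : 0 <= m - 1); rewrite subr_ge0 => /(_ m1).
        have := mulr_ge0 (_ : 0 <= t0 - 1) (ltW m0); rewrite subr_ge0 => /(_ t1).
        lra.
      by rewrite ge_min lexx orbT.
    have -> : 3 * t0 * m * (4 * r) = 60 * t0 ^+ 2 by rewrite /r; field; rewrite gt_eqF.
    by rewrite ler_wpM2r ?sqr_ge0// ler_nat.
  apply: le_trans (_ : _ <= (3 * t0) * 1) _.
    apply: ler_pM => //; first by rewrite addr_ge0// mulr_ge0// addr_ge0// ltW.
      have := mulr_ge0 t00 (_ : 0 <= 1 - m); rewrite subr_ge0 => /(_ (ltW m1)).
      lra.
    by rewrite ge_min lexx.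
  have := mulr_ge0 (_ : 0 <= t0 - 1) t00; rewrite subr_ge0 => /(_ t1); lra.
split; first exact: (norm2_red_mass uW dp dq B0 r0 (ltW QW)).
apply: (norm2_red_mass uW dq dp B0 r0 _ NB); apply: le_trans (ltW QW).
rewrite le_eqVlt; apply/orP; left; apply/eqP; congr (Qrun _ _ _ _).
by apply/funext => i; rewrite /mu addrC.
Qed.

End Discretisation.

(** * Arithmetic of the sample size *)

Lemma powR_bounds (R : realType) (C eps : R) (k : nat) (m := C * k%:R `^ (4 / 5) / eps `^ (6 / 5)) :
  0 < C -> 0 < eps -> (0 < k)%N -> 0 < m /\ m ^+ 5 * eps ^+ 6 = C ^+ 5 * k%:R ^+ 4.
Proof.
move=> C0 e0 k0; have k0' : 0 < k%:R :> R by rewrite ltr0n.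
split; first by rewrite /m divr_gt0 ?mulr_gt0 ?powR_gt0.
(* Fifth powers clear the fractional exponents, so that later estimates are polynomial. *)
have ke : (k%:R `^ (4 / 5)) ^+ 5 = k%:R ^+ 4 :> R.
  rewrite -!powR_mulrn ?powR_ge0 ?ler0n// -powRrM; congr (_ `^ _); by field.
have ee : (eps `^ (6 / 5)) ^+ 5 = eps ^+ 6.
  rewrite -!powR_mulrn ?powR_ge0 ?ltW// -powRrM; congr (_ `^ _); by field.
rewrite /m !exprMn exprVn ke ee divfK// gt_eqF// exprn_gt0//.
Qed.

(** The square of the first bound and the fifth power of the second follow from the polynomial
    identity for [m], the first with a factor [C] to spare. The condition [eps < 2] gives
    [1 <= m]. *)
Lemma sample_size_bounds (R : realType) (C eps m y : R) (k : nat) :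
  64 <= C -> 0 < eps < 2 -> (0 < k)%N -> 0 < m -> 0 < y -> y ^+ 2 = m ->
  m ^+ 5 * eps ^+ 6 = C ^+ 5 * k%:R ^+ 4 ->
  [/\ 1 <= m, k%:R ^+ 2 * y * C ^+ 2 <= m ^+ 3 * eps ^+ 3
    & k%:R * C ^+ 2 <= 2 * (m ^+ 2 * eps ^+ 2)].
Proof.
move=> C64 /andP[e0 e2] k0 m0 y0 ym E.
have C0 : 0 < C by lra.
have K1 : 1 <= k%:R :> R by rewrite ler1n.
have K0 : 0 < k%:R :> R by lra.
have pw (n : nat) (a b : R) : 0 <= b -> a ^+ n.+1 <= b ^+ n.+1 -> a <= b.
  move=> b0; apply: contraTT; rewrite -!ltNge => ba.
  by rewrite ltrXn2r ?nnegrE// ltW// (le_lt_trans b0 ba).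
have e6 : eps ^+ 6 <= 64.
  rewrite (_ : 64 = 2 ^+ 6 :> R); last by ring.
  by rewrite lerXn2r ?nnegrE// ltW.
have C1 : 1 <= C by lra.
have C5 : 64 <= C ^+ 5.
  by apply: le_trans C64 _; rewrite exprS ler_peMr ?(ltW C0)// exprn_ege1.
have m1 : 1 <= m.
  apply: (pw 4%N); first exact: ltW.
  rewrite expr1n -(ler_pM2r (exprn_gt0 6 e0)) mul1r E.
  apply: le_trans e6 _; apply: le_trans C5 _.
  by rewrite ler_peMr ?exprn_ege1// exprn_ge0// ltW.
split=> //.
  apply: (pw 1%N); first by rewrite mulr_ge0// exprn_ge0// ltW.
  have -> : (k%:R ^+ 2 * y * C ^+ 2) ^+ 2 = (C ^+ 4 * k%:R ^+ 4) * m by rewrite -ym; ring.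
  have -> : (m ^+ 3 * eps ^+ 3) ^+ 2 = (C ^+ 5 * k%:R ^+ 4) * m by rewrite -E; ring.
  have C4 : 0 <= C ^+ 4 by rewrite exprn_ge0// ltW.
  by rewrite ler_pM2r// ler_pM2r ?exprn_gt0// [leRHS]exprS ler_peMl.
apply: (pw 4%N); first exact: mulr_ge0 (ler0n _ 2) (mulr_ge0 (sqr_ge0 m) (sqr_ge0 eps)).
have -> : (2 * (m ^+ 2 * eps ^+ 2)) ^+ 5 = 32 * (C ^+ 5 * k%:R ^+ 4) ^+ 2 / eps ^+ 2.
  by rewrite -E; field; rewrite gt_eqF.
rewrite ler_pdivlMr ?exprn_gt0//.
have e2' : eps ^+ 2 <= 4.
  rewrite (_ : 4 = 2 ^+ 2 :> R); last by ring.
  by rewrite lerXn2r ?nnegrE// ltW.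
have -> : (k%:R * C ^+ 2) ^+ 5 * eps ^+ 2 = (k%:R ^+ 5 * eps ^+ 2) * C ^+ 10 by ring.
have -> : 32 * (C ^+ 5 * k%:R ^+ 4) ^+ 2 = (32 * k%:R ^+ 8) * C ^+ 10 by ring.
rewrite ler_pM2r ?exprn_gt0//.
apply: le_trans (_ : k%:R ^+ 5 * 4 <= _); first by rewrite ler_pM2l// exprn_gt0.
rewrite mulrC; apply: ler_pM => //; rewrite ?exprn_ge0 ?(ltW K0)// ?ler_nat//.
by rewrite ler_weXn2l.
Qed.

Lemma bernoulli_ineq (R : realFieldType) (x : R) r : 0 <= x <= 1 -> 1 - r%:R * x <= (1 - x) ^+ r.
Proof.
move=> /andP[x0 x1]; elim: r => [|r IH]; first by rewrite mul0r subr0.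
rewrite exprS; apply: le_trans (ler_wpM2l (_ : 0 <= 1 - x) IH); last by rewrite subr_ge0.
have := mulr_ge0 (ler0n R r) (mulr_ge0 x0 x0); rewrite -natr1; lra.
Qed.

Lemma three_losses (R : realFieldType) (a b c : R) : 0 <= a <= 1 -> 0 <= b <= 1 -> 0 <= c <= 1 ->
  1 - (a + b + c) <= (1 - a) * (1 - b) * (1 - c).
Proof.
move=> /andP[a0 a1] /andP[b0 b1] /andP[c0 c1].
have h1 := mulr_ge0 a0 b0.
have h2 : 0 <= (a + b - a * b) * c.
  rewrite mulr_ge0//; have := mulr_ge0 a0 (_ : 0 <= 1 - b); rewrite subr_ge0 => /(_ b1); lra.
lra.
Qed.

(** * The rounds of step (5) *)

Section Rounds.
Variables (R : realType) (T : tester R) (B D C eps m t0 tau : R) (k : nat).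
Variables (g : seq R) (p q : R -> R).
Hypothesis specT : tester_spec B D T.
Hypotheses (C1 : 1 < C) (eps0 : 0 < eps) (m0 : 0 < m) (t1 : 1 <= t0) (tB : 8 * t0 <= B).
Hypotheses (dp : density p) (dq : density q).
Hypotheses (pt : forall i, cell_mass g p i <= tau) (qt : forall i, cell_mass g q i <= tau).
Hypothesis mtau : 2 * m * tau <= 1.
Let M := (size g).+1.
Let P i := cell_mass g p i.
Let Q i := cell_mass g q i.
Let mu i := (P i + Q i) / 2.
Let delta := (C ^+ 2)^-1.

Let delta01 : 0 < delta < 1.
Proof.
have C2 : 1 < C ^+ 2 by rewrite exprn_egt1.
by rewrite /delta invr_gt0 invf_lt1 ?C2 ?andbT// (lt_trans ltr01 C2).
Qed.
Let epsC : 0 < eps / C. Proof. by rewrite divr_gt0// (lt_trans ltr01 C1). Qed.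
Let P0 i : 0 <= P i. Proof. exact: cell_mass_ge0. Qed.
Let Q0 i : 0 <= Q i. Proof. exact: cell_mass_ge0. Qed.
Let tau0 : 0 <= tau. Proof. exact: le_trans (P0 0) (pt 0). Qed.
Let mutau i : mu i <= tau.
Proof. by rewrite /mu; have := pt i; have := qt i; rewrite -/(P i) -/(Q i); lra. Qed.
Let mtau1 : m * tau <= 1.
Proof. by have := mulr_ge0 (ltW m0) tau0; have := mtau; lra. Qed.
Let t00 : 0 < t0. Proof. exact: lt_le_trans ltr01 t1. Qed.
Let PM : \sum_(0 <= i < M) P i = 1. Proof. exact: sum_cell_mass. Qed.
Let QM : \sum_(0 <= i < M) Q i = 1. Proof. exact: sum_cell_mass. Qed.

Let good := gap_good m0 P0 Q0 PM QM t00 mutau mtau1.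

Let k21 : (0 < 2 * k + 1)%N. Proof. by rewrite addn1. Qed.

(** Each factor of [rho] pays for one possible failure of a round: two endpoints in a cell, a wrong
    answer of the tester, a partition violating the norm hypothesis. *)
Lemma test_rounds_yes (rho := (1 - m ^+ 2 * tau) * (1 - delta) * (1 - 2 / t0)) r N :
  (forall A, measurable A -> pmass p A = pmass q A) ->
  0 <= 1 - m ^+ 2 * tau -> 0 <= 1 - 2 / t0 ->
  ((rho ^+ r)%:E <= test_rounds T C k eps m (draw p) (draw q) r N
     (fun out => (out.1)%:R%:E))%E.
Proof.
move=> pq a0 c0.
have d0 : 0 <= 1 - delta by rewrite subr_ge0; case/andP: delta01 => _ /ltW.
have rho0 : 0 <= rho by rewrite !mulr_ge0.
elim: r N => [|r IH] N; first by rewrite /= /rret.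
rewrite /= /rbind.
have r0 : 0 <= rho ^+ r by rewrite exprn_ge0.
have pos (b : bool) N' : (0 <= (if b then test_rounds T C k eps m (draw p) (draw q) r N'
    else rret (false, N')) (fun out : bool * nat => (out.1)%:R%:E))%E.
  case: b; last by rewrite /rret lee_fin.
  by apply: (exp_ge0 (expectation_test_rounds T C eps k dp dq m0 r N')) => out; rewrite lee_fin.
apply: (le_trans _ (bits_probability m0 dp dq pt qt mtau
  (B := good_bits g m p q t0) (k := rho ^+ r * (1 - delta)) _ _ _)).
- rewrite lee_fin exprSr.
  have -> : rho ^+ r * rho = (1 - m ^+ 2 * tau) * (rho ^+ r * (1 - delta) * (1 - 2 / t0)).
    by rewrite /rho; ring.
  by rewrite ler_wpM2l// ler_wpM2l ?mulr_ge0//; exact: good.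
- by rewrite mulr_ge0.
- move=> W; apply: (exp_ge0 (expectation_run_tester _ _ _ _ (expectation_reduced _ dp)
    (expectation_reduced _ dq))) => b; exact: pos.
move=> W uW gW; have [np nq] := norm2_good m0 dp dq t1 tB uW gW.
apply: (run_tester_accept specT dp dq k21 epsC delta01 r0 np nq) => [b|b|].
- by rewrite /red_mass pq//; exact: measurable_bucket.
- exact: pos.
- exact: IH.
Qed.

Variables (lo hi : 'I_k -> nat) (sig : 'I_k -> R) (v : R).
Hypothesis lohi : forall j, (lo j <= hi j <= M)%N.
Hypothesis partM : forall i, (i < M)%N -> (\sum_j in_piece lo hi j i)%N = 1%N.
Hypothesis sig1 : forall j, `|sig j| <= 1.
Hypothesis C8 : 8 <= C.
Hypothesis ktau : 32 * k%:R * tau <= eps.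

(** A NO in the first round decides; from the later rounds only nonnegativity is used. *)
Lemma test_rounds_no r N : (0 < r)%N -> 0 <= 1 - m ^+ 2 * tau ->
  v <= pexp (wlaw m mu) 0 M
    (fun t => (eps / 4 < Wrun (fun i => P i - Q i) (pval lo hi sig) 0 0 t)%R%:R) ->
  (((1 - m ^+ 2 * tau) * ((1 - delta) * (v - 2 / t0)))%:E <=
     test_rounds T C k eps m (draw p) (draw q) r N (fun out => (~~ out.1)%:R%:E))%E.
Proof.
case: r => // r _ a0 vW; rewrite /= /rbind.
have d0 : 0 <= 1 - delta by rewrite subr_ge0; case/andP: delta01 => _ /ltW.
pose Wgood t := eps / 4 < Wrun (fun i => P i - Q i) (pval lo hi sig) 0 0 t.
have pos (b : bool) N' : (0 <= (if b then test_rounds T C k eps m (draw p) (draw q) r N'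
    else rret (false, N')) (fun out : bool * nat => (~~ out.1)%:R%:E))%E.
  case: b; last by rewrite /rret lee_fin.
  by apply: (exp_ge0 (expectation_test_rounds T C eps k dp dq m0 r N')) => out; rewrite lee_fin.
have mu0 i : 0 <= mu i by rewrite divr_ge0// addr_ge0.
apply: (le_trans _ (bits_probability m0 dp dq pt qt mtau
  (B := fun t => good_bits g m p q t0 t && Wgood t) (k := 1 - delta) _ _ _)) => //.
- rewrite lee_fin ler_wpM2l// ler_wpM2l//.
  have h := @pexp2_mono R _ (wlaw m mu) 0 M (good_bits g m p q t0) Wgood
    (fun t => good_bits g m p q t0 t && Wgood t) (wlaw_law m0 mu0)
    (fun t _ a b => introT andP (conj a b)).
  apply: le_trans h; have := good; rewrite -/(good_bits g m p q t0).
  move=> h; move: vW h; rewrite /Wgood /good_bits; lra.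
- move=> W; apply: (exp_ge0 (expectation_run_tester _ _ _ _ (expectation_reduced _ dp)
    (expectation_reduced _ dq))) => b; exact: pos.
move=> W uW /andP[gW WW]; have [np nq] := norm2_good m0 dp dq t1 tB uW gW.
apply: (run_tester_reject specT dp dq k21 epsC delta01 np nq) => [|b|].
- have pq2 i : cell_mass g p i + cell_mass g q i <= 2 * tau.
    by have := pt i; have := qt i; lra.
  apply: lt_le_trans (Ak_red_mass uW lohi partM sig1 dp dq pq2 tau0).
  (* Of the [eps / 4] at most [4 * k * tau <= eps / 8] is lost to cut cells. *)
  apply: le_lt_trans (_ : eps / 8 < _); first by rewrite ler_wpM2l ?(ltW eps0)// lef_pV2 ?posrE// (lt_le_trans _ C8).
  have := WW; rewrite /Wgood; have := ktau; lra.
- exact: pos.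
- by rewrite /rret.
Qed.

End Rounds.

(** * Step (4) and the numerical constants *)

Section Merging.
Variables (R : realType) (g : seq R).

Lemma merge_run (X Y : seq R) (B : pred R) (v : R) (f : bool -> rand R (bool * nat)) h :
  0 <= v -> uniq (map (bucket g) (X ++ Y)) ->
  (v%:E <= f (B (Zrun 0 (map (cell_sym (bucket g) X Y) (enum 'I_(size g).+1)))) h)%E ->
  (v%:E <= merge_samples X Y (fun S => f (B (Zstat S)%:~R) h))%E.
Proof.
move=> v0 uXY H; apply: merge_samples_ge => [|s ps]; first by rewrite lee_fin.
by rewrite (Zstat_sort (@bucket_mono R g) uXY ps).
Qed.

End Merging.

Lemma fine_mesh (R : realFieldType) (m w eps : R) (k : nat) :
  0 < m -> 1 <= w -> 0 < eps -> (0 < k)%N ->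
  exists tau : R, [/\ 0 < tau, 1000 * m ^+ 2 * tau <= 1, 100 * (w * (m ^+ 2 * tau)) <= 1,
    2 * m * tau <= 1 & 32 * k%:R * tau <= eps].
Proof.
move=> m0 w1 e0 k0; have K0 : 0 < k%:R :> R by rewrite ltr0n.
have m2 : 0 < m ^+ 2 by rewrite exprn_gt0.
pose V := 1000 * (m ^+ 2 + m) * w.
have V0 : 0 < V by apply: mulr_gt0; [apply: mulr_gt0; [|exact: addr_gt0]|]; lra.
pose tau := Num.min V^-1 (eps / (32 * k%:R)).
have tau0 : 0 < tau by rewrite lt_min invr_gt0 V0 divr_gt0// mulr_gt0.
have tV : V * tau <= 1 by rewrite mulrC -ler_pdivlMr// div1r ge_min lexx.
have te : 32 * k%:R * tau <= eps.
  by rewrite mulrC -ler_pdivlMr ?mulr_gt0// ge_min lexx orbT.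
have VE : V * tau = 1000 * (w * (m ^+ 2 * tau) + w * (m * tau)) by rewrite /V; ring.
have a0 : 0 <= m ^+ 2 * tau by rewrite mulr_ge0// ltW.
have b0 : 0 <= m * tau by rewrite mulr_ge0// ltW.
have a1 : m ^+ 2 * tau <= w * (m ^+ 2 * tau) by rewrite ler_peMl.
have b1 : m * tau <= w * (m * tau) by rewrite ler_peMl.
rewrite VE in tV; clearbody tau; clear V V0 VE.
exists tau; split; [exact: tau0|rewrite -mulrA|..|exact: te]; last rewrite -mulrA; lra.
Qed.

(** Over all rounds the three losses are at most 1/100, 1/50 and 1/50, which add up to 1/20. *)
Lemma rounds_survive (R : realFieldType) (w a d s : R) r :
  0 <= a -> 0 <= d -> 0 <= s -> 1 <= w -> r%:R <= w ->
  100 * (w * a) <= 1 -> 50 * d <= 1 -> 50 * (r%:R * d) <= 1 -> 50 * (w * s) <= 1 ->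
  19 / 20 <= ((1 - a) * (1 - d) * (1 - s)) ^+ r.
Proof.
move=> a0 d0 s0 w1 rw wa d1 rd ws.
have r0 : 0 <= r%:R :> R by rewrite ler0n.
have h1 : r%:R * a <= w * a by rewrite ler_wpM2r.
have h2 : r%:R * s <= w * s by rewrite ler_wpM2r.
have h3 : a <= w * a by rewrite ler_peMl.
have h4 : s <= w * s by rewrite ler_peMl.
have x01 : 0 <= a + d + s <= 1 by apply/andP; split; lra.
apply: le_trans (_ : _ <= (1 - (a + d + s)) ^+ r) _.
  by apply: le_trans (bernoulli_ineq r x01); rewrite !mulrDr; lra.
rewrite lerXn2r ?nnegrE; first by [].
- by case/andP: x01 => _; rewrite subr_ge0.
- by rewrite !mulr_ge0 ?subr_ge0//; lra.
apply: three_losses; apply/andP; split; lra.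
Qed.

(** At most [c * C] rounds, each failing with probability [1 / C^2], fail with total probability at
    most [c / C]. *)
Lemma round_constants (R : realFieldType) (c C : R) : 0 < c -> 2000 <= C -> 100 * c <= C ->
  [/\ 1 < C, 50 * (C ^+ 2)^-1 <= 1 & 50 * (c * C * (C ^+ 2)^-1) <= 1].
Proof.
move=> c0 C2000 Cc; have C1 : 1 < C by apply: lt_le_trans C2000; rewrite ltr1n.
have C50 : 50 <= C by apply: le_trans C2000; rewrite ler_nat.
have C0 : 0 < C := lt_trans ltr01 C1.
clear C2000; rewrite expr2 invfM; split=> //.
- have h : 50 * C^-1 <= 1 by rewrite ler_pdivrMr// mul1r.
  apply: le_trans h; rewrite ler_wpM2l// ler_piMl ?invr_ge0 ?(ltW C0)//.
  by rewrite invf_le1// ltW.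
have -> : 50 * (c * C * (C^-1 * C^-1)) = 50 * c / C by field; rewrite gt_eqF.
rewrite ler_pdivrMr// mul1r; lra.
Qed.

Lemma Ak_dens_witness (R : realType) (p q : R -> R) (k : nat) (eps : R) :
  0 < eps -> eps < Ak_dens p q k ->
  exists2 J : 'I_k -> interval R, interval_partition (`[0, 1] : set R) J &
    eps < \sum_j `|mass p (J j) - mass q (J j)|.
Proof.
move=> e0; rewrite /Ak_dens /Ak_dist; set S := [set _ | _ in _] => eS.
(* The supremum of the empty set is 0, which [0 < eps] excludes. *)
have [S0|/set0P S0] := eqVneq S set0; first by rewrite S0 sup0 ltNge (ltW e0) in eS.
by have [_ [J JP <-] lt] := sup_gt S0 eS; exists J.
Qed.

(** * Correctness of the two answers *)

Section Correctness.
Variables (R : realType) (T : tester R) (B D C eps w tau : R) (k r : nat) (p q : R -> R).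
Let m := C * k%:R `^ (4 / 5) / eps `^ (6 / 5).
Let y := Num.sqrt m.
Let delta := (C ^+ 2)^-1.
Let s := (50 * w)^-1.
Hypothesis specT : tester_spec B D T.
Hypotheses (C1 : 1 < C) (k0 : (0 < k)%N) (eps0 : 0 < eps) (dp : density p) (dq : density q).
Hypotheses (w1 : 1 <= w) (wB : 800 * w <= B).
Hypotheses (tau0 : 0 < tau) (mtau : 2 * m * tau <= 1) (wtau : 100 * (w * (m ^+ 2 * tau)) <= 1).
Hypothesis delta50 : 50 * delta <= 1.

Let C0 : 0 < C. Proof. exact: lt_trans ltr01 C1. Qed.
Let m0 : 0 < m. Proof. exact: (powR_bounds C0 eps0 k0).1. Qed.
Let y0 : 0 < y. Proof. by rewrite sqrtr_gt0. Qed.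
Let ym : y ^+ 2 = m. Proof. by rewrite sqr_sqrtr// ltW. Qed.
Let delta0 : 0 <= delta. Proof. by rewrite invr_ge0 sqr_ge0. Qed.
Let w0 : 0 < w. Proof. exact: lt_le_trans ltr01 w1. Qed.
Let t1 : 1 <= 100 * w. Proof. by have := w1; lra. Qed.
Let tB : 8 * (100 * w) <= B. Proof. by have := wB; rewrite mulrA -natrM. Qed.
Let tE : 2 / (100 * w) = s. Proof. by rewrite /s; field; rewrite gt_eqF. Qed.
Let a0 : 0 <= m ^+ 2 * tau. Proof. by rewrite mulr_ge0 ?sqr_ge0// ltW. Qed.
Let a1 : 100 * (m ^+ 2 * tau) <= 1.
Proof. by have := ler_peMl a0 w1; have := wtau; lra. Qed.
Let s0 : 0 <= s. Proof. by rewrite invr_ge0 mulr_ge0// ltW. Qed.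
Let ws : 50 * (w * s) = 1. Proof. by rewrite /s; field; rewrite gt_eqF. Qed.
Let s1 : 50 * s <= 1. Proof. by have := ler_peMl s0 w1; have := ws; lra. Qed.

Let out_rand (X Y : seq R) (b : bool) : rand R (bool * nat) :=
  if b then rret (false, (size X + size Y)%N)
  else test_rounds T C k eps m (draw p) (draw q) r (size X + size Y).

Let out_rand_ge0 h (X Y : seq R) (P : pred R) : (forall o, 0 <= h o)%E ->
  (0 <= merge_samples X Y (fun S => out_rand X Y (P (Zstat S)%:~R) h))%E.
Proof.
move=> h0; apply: (exp_ge0 (expectation_merge X Y)) => S; rewrite /out_rand.
case: (P _); first exact: h0.
exact: (exp_ge0 (expectation_test_rounds T C eps k dp dq m0 r _)).
Qed.

Lemma test_identity_yes : r%:R <= w -> 50 * (r%:R * delta) <= 1 ->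
  {ae lebesgue_measure, forall x, x \in `[0, 1] -> p x = q x} ->
  ((2 / 3)%:E <= Pr (test_identity T C r k eps (draw p) (draw q)) (fun out => out.1))%E.
Proof.
move=> rw rd pqae.
have pq A : measurable A -> pmass p A = pmass q A by move=> mA; exact: pmass_ae.
have [g [_ _ pt qt]] := grid_exists [::] dp dq tau0.
pose rho := (1 - m ^+ 2 * tau) * (1 - delta) * (1 - s).
have rho_lo : 19 / 20 <= rho ^+ r.
  by apply: (rounds_survive (w := w)) => //; rewrite ws.
have rr0 : 0 <= rho ^+ r by move: rho_lo; lra.
have P0 i := @cell_mass_ge0 _ g p i dp.
have Q0 i := @cell_mass_ge0 _ g q i dq.
have Z : 23 / 25 <= pexp (zlaw (fun i => m * cell_mass g p i) (fun i => m * cell_mass g q i))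
    0 (size g).+1 (fun t => (~~ (5 * y < Zrun 0 t))%R%:R).
  rewrite (eq_pexp _ _ (g := fun t => (Zrun 0 t <= 5 * y)%R%:R)); last by move=> t _; rewrite leNgt.
  apply: (Z_null m0 y0 ym P0 Q0 (sum_cell_mass g dp) (sum_cell_mass g dq)) => i.
  by rewrite /cell_mass; case: ifP => // _; apply: pq; exact: measurable_bucket.
apply: (le_trans _ (symbols_probability m0 dp dq pt qt mtau
  (B := fun z => ~~ (5 * y < z)) (k := rho ^+ r) rr0 _ _
  (f := fun X Y => merge_samples X Y (fun S => out_rand X Y (5 * y < (Zstat S)%:~R) _)))).
- rewrite lee_fin; apply: le_trans (_ : _ <= (1 - 4 * m ^+ 2 * tau) * (19 / 20 * (23 / 25))) _.
    by rewrite -(mulrA 4); have := a1; lra.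
  apply: ler_wpM2l; first by rewrite -(mulrA 4); have := a1; lra.
  by apply: ler_pM => //; lra.
- by move=> X Y; apply: out_rand_ge0 => o; rewrite lee_fin.
- move=> X Y uXY HZ.
  apply: (merge_run (B := fun z => 5 * y < z) (f := out_rand X Y) rr0 uXY).
  rewrite (negbTE HZ) /out_rand /rho.
  have := test_rounds_yes k specT C1 eps0 m0 t1 tB dp dq pt qt mtau r (size X + size Y) pq.
  rewrite tE; apply; first by rewrite subr_ge0; have := a1; lra.
  by rewrite subr_ge0; have := s1; lra.
Qed.

Lemma test_identity_no : (0 < r)%N -> 2000 <= C -> 1000 * m ^+ 2 * tau <= 1 ->
  32 * k%:R * tau <= eps -> eps < Ak_dens p q k ->
  ((2 / 3)%:E <= Pr (test_identity T C r k eps (draw p) (draw q)) (fun out => ~~ out.1))%E.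
Proof.
move=> r0 C2000 mtau1000 ktau eA.
have [J JP epsJ] := Ak_dens_witness eps0 eA.
pose pts := flatten [seq itv_pts (J j) | j <- enum 'I_k].
have [g [gg ptsg pt qt]] := grid_exists pts dp dq tau0.
have [j z zj z01|lo [hi [lohi partM massE]]] := grid_pieces gg JP.
  by apply: ptsg z01; apply/flattenP; exists (itv_pts (J j)) => //; apply/mapP; exists j => //; rewrite mem_enum.
have P0 i := @cell_mass_ge0 _ g p i dp.
have Q0 i := @cell_mass_ge0 _ g q i dq.
have PM := sum_cell_mass g dp; have QM := sum_cell_mass g dq.
have {}epsJ : eps < \sum_j `|\sum_(lo j <= i < hi j) (cell_mass g p i - cell_mass g q i)|.
  apply: lt_le_trans epsJ _; apply: ler_sum => j _.
  by rewrite !massE// -sumrB.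
(* Two densities of mass 1 are at distance at most 2. *)
have eps2 : eps < 2.
  apply: lt_le_trans epsJ _.
  apply: le_trans (_ : \sum_j \sum_(lo j <= i < hi j) (cell_mass g p i + cell_mass g q i) <= _).
    apply: ler_sum => j _; apply: le_trans (ler_norm_sum _ _ _) _.
    apply: ler_sum => i _; apply: le_trans (ler_normB _ _) _.
    by rewrite !ger0_norm.
  by rewrite (sum_pieces lohi partM) big_split /= PM QM.
have muT i : (cell_mass g p i + cell_mass g q i) / 2 <= tau.
  by have := pt i; have := qt i; clear C2000 mtau1000; lra.
have mE := (powR_bounds C0 eps0 k0).2.
have [||m1 km3 km2] := sample_size_bounds (C := C) (y := y) _ _ k0 m0 y0 ym mE.
- by apply: le_trans C2000; rewrite ler_nat.
- by rewrite eps0.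
have C8 : 8 <= C by apply: le_trans C2000; rewrite ler_nat.
have b1 : 0 <= 1 - m ^+ 2 * tau by rewrite subr_ge0; have := a1; have := a0; clear C2000 mtau1000; lra.
have algE h : test_identity T C r k eps (draw p) (draw q) h =
  poi_iid m (draw p) (fun X => poi_iid m (draw q) (fun Y =>
    merge_samples X Y (fun S => out_rand X Y (5 * y < (Zstat S)%:~R) h))) by [].
rewrite /Pr algE.
have [Z|W] := Z_or_W m0 y0 ym P0 Q0 PM QM m1 muT mtau1000 C2000 eps0 k0 lohi partM epsJ km3 km2.
  apply: (le_trans _ (symbols_probability m0 dp dq pt qt mtau
    (B := fun z => 5 * y < z) (k := 1) ler01 _ _)).
  - rewrite lee_fin; apply: le_trans (_ : _ <= (1 - 4 * m ^+ 2 * tau) * (1 * (19 / 20))) _.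
      by rewrite -(mulrA 4); have := a1; clear C2000 mtau1000; lra.
    apply: ler_wpM2l; first by rewrite -(mulrA 4); have := a1; clear C2000 mtau1000; lra.
    by rewrite !mul1r.
  - by move=> X Y; apply: out_rand_ge0 => o; rewrite lee_fin.
  - move=> X Y uXY HZ.
    apply: (merge_run (B := fun z => 5 * y < z) (f := out_rand X Y) ler01 uXY).
    by rewrite HZ /out_rand /rret.
(* Nothing is known about step (4) in this case, but stopping there already means NO; otherwise the
   first round is likely to answer NO. *)
have v0 : (0 <= (2 / 3 : R)%:E)%E by rewrite lee_fin divr_ge0.
apply: (exp_ge_cst (expectation_poi_iid m0 (expectation_draw dp))) => // X.
apply: (exp_ge_cst (expectation_poi_iid m0 (expectation_draw dq))) => // Y.
apply: (exp_ge_cst (expectation_merge X Y)) => // S; rewrite /out_rand.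
case: ifP => _; first by rewrite /rret lee_fin ler_pdivrMr// mul1r ler_nat.
apply: (le_trans _ (test_rounds_no specT C1 eps0 m0 t1 tB dp dq pt qt mtau lohi partM
  (piece_sign_le1 _ _ _ _) C8 ktau _ r0 b1 W)).
rewrite lee_fin tE -/delta.
have h1 : 99 / 100 <= 1 - m ^+ 2 * tau by have := a1; clear C2000 mtau1000; lra.
have h2 : 49 / 50 <= 1 - delta by have := delta50; clear C2000 mtau1000; lra.
have h3 : 93 / 100 <= 19 / 20 - s by have := s1; clear C2000 mtau1000; lra.
apply: le_trans (_ : _ <= 99 / 100 * (49 / 50 * (93 / 100))) _; first by clear C2000 mtau1000; lra.
by apply: ler_pM => //; apply: ler_pM.
Qed.

End Correctness.

(** * Sample budget and choice of the constants *)

Lemma test_identity_budget (R : realType) (T : tester R) (B D C c eps : R) (k r : nat)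
    (p q : R -> R) (L := ln (((C ^+ 2)^-1)^-1)) :
  tester_spec B D T -> 1 < C -> r%:R <= c * C -> (0 < k)%N -> 0 < eps -> density p -> density q ->
  (test_identity T C r k eps (draw p) (draw q) (fun out => (out.2%:R : R)%:E) <=
    ((2 * C + c * C * (C + 4 * `|D| * C ^+ 2 * L)) *
       Num.max (k%:R `^ (4 / 5) / eps `^ (6 / 5)) (k%:R `^ (1 / 2) / eps ^+ 2))%:E)%E.
Proof.
move=> specT C1 rC k0 eps0 dp dq.
have C0 : 0 < C := lt_trans ltr01 C1.
have C2 : 1 < C ^+ 2 by rewrite exprn_egt1.
have delta01 : 0 < (C ^+ 2)^-1 < 1.
  by rewrite invr_gt0 invf_lt1 ?C2 ?andbT// (lt_trans ltr01 C2).
have L0 : 0 <= L by rewrite ln_ge0// invrK ltW.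
have [m0 _] := powR_bounds C0 eps0 k0.
set a := k%:R `^ (4 / 5) / eps `^ (6 / 5); set b := k%:R `^ (1 / 2) / eps ^+ 2.
have mE : C * k%:R `^ (4 / 5) / eps `^ (6 / 5) = C * a by rewrite /a mulrA.
rewrite mE in m0; set Mx := Num.max a b.
have aM : a <= Mx by rewrite le_max lexx.
have bM : b <= Mx by rewrite le_max lexx orbT.
have b0 : 0 <= b by rewrite divr_ge0 ?powR_ge0// sqr_ge0.
have k21 : (0 < 2 * k + 1)%N by rewrite addn1.
have epsC : 0 < eps / C by rewrite divr_gt0.
(* [D] is an arbitrary real, so its absolute value keeps [NS] nonnegative. *)
pose NS := `|D| * (Num.sqrt (2 * k + 1)%:R / (eps / C) ^+ 2 * L).
have X0 : 0 <= Num.sqrt (2 * k + 1)%:R / (eps / C) ^+ 2 * L.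
  by rewrite mulr_ge0// divr_ge0 ?sqrtr_ge0// sqr_ge0.
have NS0 : 0 <= NS by rewrite mulr_ge0.
have nsNS n : (nsamples T n (2 * k + 1) (eps / C) (C ^+ 2)^-1)%:R <= NS.
  have [h _] := specT n _ _ _ k21 epsC delta01; apply: le_trans h _.
  by rewrite /NS ler_wpM2r// ler_norm.
apply: (le_trans (test_identity_samples dp dq m0 NS0 nsNS r (esym mE))).
have NSb : NS <= 2 * (`|D| * C ^+ 2 * L) * Mx.
  have sq : Num.sqrt (2 * k + 1)%:R <= 2 * k%:R `^ (1 / 2) :> R.
    rewrite div1r powR12_sqrt ?ler0n//.
    have -> : 2 * Num.sqrt k%:R = Num.sqrt (2 ^+ 2 * k%:R) :> R.
      by rewrite sqrtrM ?sqr_ge0// sqrtr_sqr ger0_norm.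
    have K1 : 1 <= k%:R :> R by rewrite ler1n.
    by apply: ler_wsqrtr; rewrite natrD natrM expr2; lra.
  have -> : 2 * (`|D| * C ^+ 2 * L) * Mx = `|D| * (2 * C ^+ 2 * Mx * L) by ring.
  rewrite /NS; apply: ler_wpM2l => //; apply: ler_wpM2r => //.
  have -> : Num.sqrt (2 * k + 1)%:R / (eps / C) ^+ 2 =
      C ^+ 2 * (Num.sqrt (2 * k + 1)%:R / eps ^+ 2).
    by field; rewrite !gt_eqF.
  have -> : 2 * C ^+ 2 * Mx = C ^+ 2 * (2 * Mx) by ring.
  apply: ler_wpM2l; first exact: sqr_ge0.
  apply: le_trans (_ : 2 * b <= _); last by rewrite ler_wpM2l.
  by rewrite /b mulrA ler_wpM2r// invr_ge0 sqr_ge0.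
rewrite lee_fin.
have Mx0 : 0 <= Mx := le_trans b0 bM.
have Ca : C * a <= C * Mx by rewrite ler_wpM2l// ltW.
have DL : 0 <= `|D| * C ^+ 2 * L by apply: mulr_ge0 L0; apply: mulr_ge0 (sqr_ge0 _).
apply: le_trans (_ : _ <= 2 * (C * Mx) + c * C * (C * Mx + 2 * (2 * (`|D| * C ^+ 2 * L) * Mx))) _.
  apply: lerD; first by rewrite ler_wpM2l.
  apply: ler_pM => //; first by apply: addr_ge0; [exact: ltW|exact: mulr_ge0].
  by apply: lerD => //; rewrite ler_wpM2l.
by rewrite le_eqVlt; apply/orP; left; apply/eqP; ring.
Qed.

Theorem theorem3p10 (R : realType) (c : R) (hc : 0 < c) :
  exists C0 : R, forall C : R, C0 <= C ->
  exists B0 : R, forall B D : R, B0 <= B ->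
  exists K : R,
  forall (T : tester R), tester_spec B D T ->
  forall (r : nat), (0 < r)%N -> r%:R <= c * C ->
  forall (k : nat) (eps : R), (0 < k)%N -> 0 < eps ->
  forall (p q : R -> R), density p -> density q ->
  let alg := test_identity T C r k eps (draw p) (draw q) in
  [/\ (alg (fun out => (out.2%:R : R)%:E) <=
        (K * Num.max (k%:R `^ (4 / 5) / eps `^ (6 / 5))
                     (k%:R `^ (1 / 2) / eps ^+ 2))%:E)%E,
      {ae lebesgue_measure, forall x, x \in `[0, 1] -> p x = q x} ->
        ((2 / 3)%:E <= Pr alg (fun out => out.1))%E &
      eps < Ak_dens p q k ->
        ((2 / 3)%:E <= Pr alg (fun out => ~~ out.1))%E].
Proof.
(* 2000 comes from [Z_or_W], [100 * c] from the failures of the tester over all rounds. *)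
exists (Num.max 2000 (100 * c)) => C; rewrite ge_max => /andP[C2000 Cc].
have [C1 d50 cd50] := round_constants hc C2000 Cc.
have cC0 : 0 < c * C by rewrite mulr_gt0// (lt_trans ltr01).
(* A bound on the number of rounds, enlarged so as to be at least 1. *)
pose w := c * C + 1; have w1 : 1 <= w by rewrite lerDr ltW.
(* The Markov slack [t0 = 100 * w] makes the loss [2 / t0] small against [1 / w], and [norm2_good]
   asks for [8 * t0 <= B]. *)
exists (800 * w) => B D wB.
exists (2 * C + c * C * (C + 4 * `|D| * C ^+ 2 * ln (((C ^+ 2)^-1)^-1))).
move=> T specT r r0 rC k eps k0 eps0 p q dp dq alg.
have [m0 _] := powR_bounds (lt_trans ltr01 C1) eps0 k0.
have [tau [tau0 tau_m tau_w mtau ktau]] := fine_mesh m0 w1 eps0 k0.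
split; first exact: (test_identity_budget specT C1 rC k0 eps0 dp dq).
- apply: (test_identity_yes specT C1 k0 eps0 dp dq w1 wB tau0 mtau tau_w d50).
    by apply: le_trans rC _; rewrite lerDl.
  apply: le_trans cd50; rewrite ler_wpM2l// ler_wpM2r// invr_ge0 sqr_ge0//.
- exact: (test_identity_no specT C1 k0 eps0 dp dq w1 wB tau0 mtau tau_w d50 r0 C2000 tau_m ktau).
Qed.
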